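(* Let $r\ge2$ and let $\Xi=[\mathcal E_1\ \mathcal E_q\ \cdots\ \mathcal E_{q^{r-1}}]$ be the $r\times r$ matrix of functions on $\Omega^r$ whose columns are the vectorial Eisenstein series of weights $1,q,\dots,q^{r-1}$. The function $\det\Xi$ is a nowhere-vanishing, single-cuspidal deformation of Drinfeld modular forms in $\mathbb{T}^\times\otimes\bm M_{1+q+\cdots+q^{r-1},1}$ (i.e. it is the product of a unit of $\mathbb{T}$ and an element of $\bm M_{1+q+\cdots+q^{r-1},1}$). When $r=2$, the coefficient of $u$ in $\det\Xi$ equals $\widetilde\pi L(\chi_t,q)$, and when $r\ge3$, it equals $-\widetilde\pi\,\tau(\det\widetilde\Xi)$.
   Context: Let $\mathbb{F}_q$ be the finite field with $q$ elements, $A=\mathbb{F}_q[\theta]$, $A_+$ the set of monic elements of $A$, $K_\infty=\mathbb{F}_q((\theta^{-1}))$, and $\mathbb{C}_\infty$ the completion of an algebraic closure of $K_\infty$, with absolute value $|\cdot|$ normalized by $|\theta|=q$. Tate algebra. $\mathbb{T}$ is the completion of $\mathbb{C}_\infty[t]$ for the Gauss norm $\|\sum f_it^i\|=\max|f_i|$. Let $\tau(\sum f_it^i)=\sum f_i^qt^i$ on $\mathbb{T}$; $\tau$ acts on $\mathbb{T}$-valued functions by $\tau(f)(\bm z)=\tau(f(\bm z))$, and entrywise on vectors and matrices. Let $\chi_t:A\to\mathbb{F}_q[t]$ be the $\mathbb{F}_q$-algebra map $\theta\mapsto t$, and $\rho_t$ its entrywise extension to matrices and vectors over $A$. Set $L(\chi_t,q)=\sum_{a\in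 A_+}a^{-q}\chi_t(a)\in\mathbb{T}$. Period domain. $\Omega^r$ is $\mathbb{P}^{r-1}(\mathbb{C}_\infty)$ minus all $K_\infty$-rational hyperplanes, viewed as the set of row vectors $\bm z=(z_r,z_{r-1},\dots,z_1)\in\mathbb{C}_\infty^r$ with $z_1=1$ and $z_1,\dots,z_r$ linearly independent over $K_\infty$. Write $\bm z=(z_r,\widetilde{\bm z})$ with $\widetilde{\bm z}=(z_{r-1},\dots,z_1)\in\Omega^{r-1}$ ($\Omega^1$ is the single point $1$). $\Gamma_r=\mathrm{GL}_r(A)$ acts on $\Omega^r$ by $\gamma\bm z=j(\gamma,\bm z)^{-1}\bm z\gamma^{-1}$, where $j(\gamma,\bm z)=\bm z\gamma^{-1}\bm e_r$ is the last entry of $\bm z\gamma^{-1}$. Imaginary part and holomorphy. Put $|\bm z|=\max_i|z_i|$. Represent each $K_\infty$-rational hyperplane $H\subseteq\mathbb{P}^{r-1}(\mathbb{C}_\infty)$ by a linear form $\ell_H(\bm z)=\eta_1z_1+\cdots+\eta_rz_r$ with $\eta_i\in K_\infty$, $|\eta_i|\le1$ for all $i$ and $|\eta_j|=1$ for at least one $j$; then $|\ell_H(\bm z)|$ is well defined, and the imaginary part of $\bm z$ is $|\bm z|_\Im=\inf_H|\ell_H(\bm z)|$, the infimum over all $K_\infty$-rational hyperplanes $H$. For integers $n\ge0$ let $\Omega_n=\{\bm z\in\Omega^r:|\bm z|_\Im\ge q^{-n}|\bm z|\}$. A function $f:\Omega^r\to\mathbb{T}$ is holomorphic if for every $n$ its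 restriction to $\Omega_n$ is a uniform limit of rational functions in $z_1,\dots,z_r$ with coefficients in $\mathbb{T}$ whose poles lie outside $\Omega_n$. Parameter at infinity. Let $\widetilde\pi=\lambda_\theta\theta\prod_{j\ge1}(1-\theta^{1-q^j})^{-1}$, with $\lambda_\theta\in\mathbb{C}_\infty$ a fixed $(q-1)$-th root of $-\theta$. For a lattice $\Lambda\subset\mathbb{C}_\infty$ let $\mathfrak e_\Lambda(w)=w\prod_{0\ne\lambda\in\Lambda}(1-w\lambda^{-1})$. With $\Lambda(\widetilde{\bm z})=\widetilde{\bm z}A^{r-1}$, set $u=u_{\widetilde{\bm z}}(z_r)=\widetilde\pi^{-1}\mathfrak e_{\Lambda(\widetilde{\bm z})}(z_r)^{-1}$. Modular forms. For an integer $k$ and a class $m$ modulo $q-1$, a deformation of Drinfeld modular forms of weight $k$ and type $m$ is a holomorphic $f:\Omega^r\to\mathbb{T}$ such that (i) $f(\gamma\bm z)=j(\gamma,\bm z)^k\det(\gamma)^mf(\bm z)$ for all $\gamma\in\Gamma_r$, $\bm z\in\Omega^r$; and (ii) there are holomorphic $f_i:\Omega^{r-1}\to\mathbb{T}$ with $f(\bm z)=\sum_{i\ge N}f_i(\widetilde{\bm z})u_{\widetilde{\bm z}}(z_r)^i$ for some $N\ge0$ and all $|\bm z|_\Im$ sufficiently large, both depending on $f$ (the $u$-expansion; $f_1$, a function of $\widetilde{\bm z}$, is the coefficient of $u$). $\bm M_{k,m}$ is the $\mathbb{C}_\infty$-space of those that are $\mathbb{C}_\infty$-valued. Such an $f$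 is single-cuspidal if the expansion begins at $N=1$ with $f_1\ne0$. It is nowhere-vanishing if $f(\bm z)\ne0$ for all $\bm z\in\Omega^r$. Eisenstein series. For $k\ge1$, $\mathcal E_k:\Omega^r\to\mathbb{T}^r$ (column vectors) is $\mathcal E_k(\bm z)=\sum_{0\ne\bm a\in A^r}(\bm z\bm a)^{-k}\rho_t(\bm a)$, where $A^r$ consists of column vectors. Define $\widetilde{\mathcal E}_1:\Omega^{r-1}\to\mathbb{T}^{r-1}$ by $\widetilde{\mathcal E}_1(\widetilde{\bm z})=\sum_{0\ne\widetilde{\bm a}\in A^{r-1}}(\widetilde{\bm z}\widetilde{\bm a})^{-1}\rho_t(\widetilde{\bm a})$ and $\widetilde\Xi=[\widetilde{\mathcal E}_1\ \tau(\widetilde{\mathcal E}_1)\ \cdots\ \tau^{r-2}(\widetilde{\mathcal E}_1)]$.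
   Formalization: Since z_1 = 1 forces |z|_Im ≤ 1 on Ω^r, ''|z|_Im sufficiently large'' in the u-expansion is void as written; it is replaced by: the distance from z_r to the K_∞-span of z_{r-1},…,z_1 exceeds B·|z̃|, with B depending only on f. *)

(* Defs.v *)
From HB Require Import structures.
From mathcomp Require Import all_boot all_order all_algebra finmap.
From mathcomp Require Import all_classical all_reals all_analysis.
(* [mpoly] and [summability] are used through qualified names only: importing
   [mpoly] clashes with the notations of MathComp-Analysis. *)
From mathcomp Require mpoly summability.

Set Implicit Arguments.
Unset Strict Implicit.
Unset Printing Implicit Defensive.
Import Order.TTheory GRing.Theory Num.Theory.
Import numFieldNormedType.Exports.
Local Open Scope classical_set_scope.
Local Open Scope ring_scope.

(** * Limits with respect to an R-valued norm *)

(* MathComp-Analysis normed modules live over a field of characteristic 0, so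
   limits for the norms of characteristic p used below are phrased through the
   convergence to 0 of a real-valued distance along a filter. *)
Section Limits.
Context {R : realType} {V : zmodType} (N : V -> R).

Definition ncvg {I : Type} (G : set_system I) (u : I -> V) (l : V) : Prop :=
  (fun i => N (u i - l)) @ G --> (0 : R).

(* By convention 0 when the limit does not exist. *)
Definition nlim {I : Type} (G : set_system I) (u : I -> V) : V :=
  xget 0 [set l | ncvg G u l].

(* Unconditional sum of the family x over the indices satisfying P: limit along
   the filter of finite sets of indices ordered by inclusion. *)
Definition nsum {I : choiceType} (P : pred I) (x : I -> V) : V :=
  nlim (@summability.totally I)
    (fun S : {fset I} => \sum_(i <- S | P i) x i).

End Limits.

(** * The field C_oo *)

(* An algebraically closed field containing F_q and an element theta, with a
   multiplicative ultrametric absolute value such that |theta| = q. *)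
Record valuedField (F : finFieldType) (R : realType) := ValuedField {
  vfield :> closedFieldType;
  vemb : {rmorphism F -> vfield};
  vtheta : vfield;
  vabs : vfield -> R;
  vabs_ge0 : forall x, 0 <= vabs x;
  vabs_eq0 : forall x, vabs x = 0 -> x = 0;
  vabsM : forall x y, vabs (x * y) = vabs x * vabs y;
  vabsD : forall x y, vabs (x + y) <= Num.max (vabs x) (vabs y);
  vabs_theta : vabs vtheta = #|F|%:R }.

Section Field.
Context {F : finFieldType} {R : realType} (X : valuedField F R).

(* K_oo = F_q((1/theta)): the sums in X of the Laurent series
   \sum_(i >= 0) c_i theta^(N - i). *)
Definition Kinf : set X :=
  [set x | exists (N : int) (c : nat -> F),
    ncvg (@vabs _ _ X) \oo
      (fun n => \sum_(i < n) vemb X (c i) * vtheta X ^ (N - i%:Z)) x].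

Definition algebraic_over_Kinf (x : X) : Prop :=
  exists p : {poly X}, [/\ p != 0, (forall i, Kinf p`_i) & root p x].

Definition vcomplete : Prop := forall u : nat -> X,
  (forall e : R, 0 < e -> exists n0 : nat, forall m n : nat,
     (n0 <= m)%N -> (n0 <= n)%N -> vabs (u m - u n) < e) ->
  exists l, ncvg (@vabs _ _ X) \oo u l.

(* X is a completion of an algebraic closure of K_oo: it is complete, and the
   algebraic closure of K_oo in the algebraically closed field X is dense. *)
Definition is_Cinf : Prop :=
  vcomplete /\
  (forall (x : X) (e : R), 0 < e ->
     exists y, algebraic_over_Kinf y /\ vabs (x - y) < e).

End Field.

(** * The Tate algebra *)

Section TateDef.
Context {F : finFieldType} {R : realType} (X : valuedField F R).

Definition decays (f : nat -> X) : Prop := (fun i => vabs (f i)) @ \oo --> (0 : R).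

(* The completion of X[t] for the Gauss norm, realised as the power series
   \sum_i f_i t^i with f_i --> 0. *)
Record tate := Tate { tcoef : nat -> X; tcoef_decays : decays tcoef }.

End TateDef.

Section Tate.
Context {F : finFieldType} {R : realType} {X : valuedField F R}.
Implicit Types (f g h : tate X) (x y : X) (s : nat -> X).

Lemma vabs0 : vabs (0 : X) = 0.
Proof.
have := vabsM (vtheta X) (0 : X); rewrite mulr0 vabs_theta => /eqP.
rewrite -subr_eq0 -{1}[vabs _]mul1r -mulrBl mulf_eq0 => /orP[|/eqP//].
rewrite subr_eq0 => /eqP q1; have := card_finNzRing_gt1 F.
by rewrite -(ltr_nat R) -q1 ltxx.
Qed.

Lemma vabs1 : vabs (1 : X) = 1.
Proof.
have := vabsM (1 : X) 1; rewrite mulr1 => /eqP.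
rewrite -{1}[vabs _]mulr1 -subr_eq0 -mulrBr mulf_eq0 => /orP[/eqP/vabs_eq0/eqP|].
  by rewrite oner_eq0.
by rewrite subr_eq0 => /eqP.
Qed.

Lemma vabsN x : vabs (- x) = vabs x.
Proof.
have N1 : vabs (-1 : X) = 1.
  have := vabsM (-1 : X) (-1); rewrite mulrNN mulr1 vabs1 => /esym/eqP.
  rewrite -expr2 sqrf_eq1 => /orP[/eqP//|/eqP Na].
  by have := vabs_ge0 (-1 : X); rewrite Na oppr_ge0 ler10.
by rewrite -mulN1r vabsM N1 mul1r.
Qed.

Lemma vabs_sum_lt (I : Type) (r : seq I) (P : pred I) (G : I -> X) (e : R) :
  0 < e -> (forall i, P i -> vabs (G i) < e) -> vabs (\sum_(i <- r | P i) G i) < e.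
Proof.
move=> e0 He; elim/big_ind: _ => //; first by rewrite vabs0.
by move=> x y xe ye; apply: le_lt_trans (vabsD x y) _; rewrite gt_max xe.
Qed.

Lemma decaysP s : decays s <->
  forall e : R, 0 < e -> exists n0, forall n, (n0 <= n)%N -> vabs (s n) < e.
Proof.
rewrite /decays; split.
  move=> /cvgrPdist_lt sl e /sl[n0 _ Hn]; exists n0 => n /Hn /=.
  by rewrite sub0r normrN ger0_norm ?vabs_ge0.
move=> sl; apply/cvgrPdist_lt => e /sl[n0 Hn]; exists n0 => // n /= /Hn.
by rewrite sub0r normrN ger0_norm ?vabs_ge0.
Qed.

Lemma decays_bounded s : decays s -> exists2 M : R, 0 < M & forall n, vabs (s n) < M.
Proof.
move=> /decaysP/(_ 1 ltr01)[n0 Hn].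
exists (1 + \sum_(i < n0) vabs (s i)).
  by rewrite ltr_pwDl// sumr_ge0// => i _; exact: vabs_ge0.
move=> n; have [n0n|nn0] := leqP n0 n.
  by apply: lt_le_trans (Hn _ n0n) _; rewrite lerDl sumr_ge0// => i _; exact: vabs_ge0.
rewrite (bigD1 (Ordinal nn0))//= addrCA ltr_pwDr// ?ltr_pwDl//.
by apply: sumr_ge0 => i _; exact: vabs_ge0.
Qed.

Definition conv s s' : nat -> X := fun n => \sum_(i < n.+1) s i * s' (n - i)%N.

Lemma convE N s s' n : (n < N)%N ->
  conv s s' n = ((\poly_(i < N) s i) * (\poly_(i < N) s' i))`_n.
Proof.
move=> nN; rewrite coefM; apply: eq_bigr => i _; rewrite !coef_poly.
rewrite (leq_ltn_trans _ nN) ?(leq_ltn_trans _ nN)// ?leq_subr//.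
by rewrite -ltnS.
Qed.

Lemma decays_conv s s' : decays s -> decays s' -> decays (conv s s').
Proof.
move=> ds ds'; have [M M0 HM] := decays_bounded ds.
have [M' M'0 HM'] := decays_bounded ds'.
apply/decaysP => e e0.
have /decaysP/(_ _ (divr_gt0 e0 M'0))[n1 H1] := ds.
have /decaysP/(_ _ (divr_gt0 e0 M0))[n2 H2] := ds'.
exists (n1 + n2)%N => n nn; apply: vabs_sum_lt => // i _; rewrite vabsM.
have [n1i|in1] := leqP n1 i.
  apply: le_lt_trans (_ : _ <= vabs (s i) * M') _.
    by rewrite ler_wpM2l ?vabs_ge0// ltW.
  by rewrite -ltr_pdivlMr// H1.
apply: le_lt_trans (_ : _ <= M * vabs (s' (n - i)%N)) _.
  by rewrite ler_wpM2r ?vabs_ge0// ltW.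
rewrite mulrC -ltr_pdivlMr// H2// leq_subRL; last by rewrite -ltnS ltn_ord.
by apply: leq_trans nn; rewrite leq_add2r ltnW.
Qed.

Lemma decaysD s s' : decays s -> decays s' -> decays (fun n => s n + s' n).
Proof.
move=> /decaysP ds /decaysP ds'; apply/decaysP => e e0.
have [n1 H1] := ds _ e0; have [n2 H2] := ds' _ e0.
exists (maxn n1 n2) => n; rewrite geq_max => /andP[/H1 ? /H2 ?].
by apply: le_lt_trans (vabsD _ _) _; rewrite gt_max; apply/andP.
Qed.

Lemma decaysN s : decays s -> decays (fun n => - s n).
Proof.
move=> /decaysP ds; apply/decaysP => e /ds[n0 H].
by exists n0 => n /H; rewrite vabsN.
Qed.

Lemma decays_finite (n0 : nat) s : (forall n, (n0 <= n)%N -> s n = 0) -> decays s.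
Proof.
by move=> s0; apply/decaysP => e e0; exists n0 => n /s0 ->; rewrite vabs0.
Qed.

Lemma decays_const x : decays (fun n => if n == 0%N then x else 0).
Proof. by apply: (@decays_finite 1) => -[]. Qed.

Lemma decays_scale x s : decays s -> decays (fun n => x * s n).
Proof.
move=> /decaysP ds; apply/decaysP => e e0.
have x1 : 0 < vabs x + 1 by rewrite ltr_wpDl// vabs_ge0.
have [n0 H] := ds _ (divr_gt0 e0 x1); exists n0 => n /H.
rewrite vabsM ltr_pdivlMr//; apply: le_lt_trans.
by rewrite mulrC ler_wpM2l ?vabs_ge0// lerDl.
Qed.

Lemma decays_exp s k : (0 < k)%N -> decays s -> decays (fun n => s n ^+ k).
Proof.
move=> k0 ds; elim: k k0 => // -[_ _|k IH _].
  exact: ds.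
apply/decaysP => e e0; have [M M0 HM] := decays_bounded ds.
have /decaysP/(_ _ (divr_gt0 e0 M0))[n0 H] := IH isT.
exists n0 => n /H; rewrite ltr_pdivlMr// => Hn.
rewrite exprS vabsM; apply: le_lt_trans Hn.
by rewrite mulrC ler_wpM2l ?vabs_ge0// ltW.
Qed.

Lemma tateP f g : tcoef f =1 tcoef g -> f = g.
Proof.
case: f g => [f df] [g dg] /= /funext fg.
by case: _ / fg in dg *; congr Tate; exact: Prop_irrelevance.
Qed.

HB.instance Definition _ := gen_eqMixin (tate X).
HB.instance Definition _ := gen_choiceMixin (tate X).

Definition tate0 := Tate (@decays_const 0).
Definition tate1 := Tate (@decays_const 1).
Definition tateD f g := Tate (decaysD (tcoef_decays f) (tcoef_decays g)).
Definition tateN f := Tate (decaysN (tcoef_decays f)).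
Definition tateM f g := Tate (decays_conv (tcoef_decays f) (tcoef_decays g)).
Definition tateZ x f := Tate (decays_scale x (tcoef_decays f)).

Fact tateDA : associative tateD.
Proof. by move=> f g h; apply: tateP => n /=; rewrite addrA. Qed.
Fact tateDC : commutative tateD.
Proof. by move=> f g; apply: tateP => n /=; rewrite addrC. Qed.
Fact tate0D : left_id tate0 tateD.
Proof. by move=> f; apply: tateP => n /=; case: eqP; rewrite add0r. Qed.
Fact tateND : left_inverse tate0 tateN tateD.
Proof. by move=> f; apply: tateP => n /=; case: eqP; rewrite addNr. Qed.
HB.instance Definition _ :=
  GRing.isZmodule.Build (tate X) tateDA tateDC tate0D tateND.

Fact tateMA : associative tateM.
Proof.
have trunc s s' n : \poly_(i < n.+1) conv s s' i =
    \poly_(i < n.+1) ((\poly_(i < n.+1) s i) * (\poly_(i < n.+1) s' i))`_i.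
  by apply/polyP => i; rewrite !coef_poly; case: ifP => // ?; rewrite -convE.
have truncr s s' n : ((\poly_(i < n.+1) s i) * (\poly_(i < n.+1) s' i))`_n =
    \sum_(i < n.+1) s i * s' (n - i)%N.
  by rewrite -convE.
move=> f g h; apply: tateP => n /=.
transitivity ((\poly_(i < n.+1) tcoef f i) * ((\poly_(i < n.+1) tcoef g i) *
  (\poly_(i < n.+1) tcoef h i)))`_n.
  rewrite coefM; apply: eq_bigr => i _; rewrite coef_poly ltn_ord.
  by rewrite -convE // ltnS leq_subr.
rewrite mulrA coefM; apply: eq_bigr => i _; rewrite -convE//.
by rewrite coef_poly ltnS leq_subr.
Qed.
Fact tateMC : commutative tateM.
Proof.
by move=> f g; apply: tateP => n /=; rewrite !(@convE n.+1)// mulrC.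
Qed.
Fact tate1M : left_id tate1 tateM.
Proof.
move=> f; apply: tateP => n /=; rewrite /conv big_ord_recl /= mul1r subn0.
by rewrite big1 ?addr0// => i _; rewrite mul0r.
Qed.
Fact tateMDl : left_distributive tateM tateD.
Proof.
move=> f g h; apply: tateP => n /=; rewrite /conv -big_split /=.
by apply: eq_bigr => i _; rewrite mulrDl.
Qed.
Fact tate1_neq0 : tate1 != 0 :> tate X.
Proof.
apply/eqP => /(congr1 (fun f => tcoef f 0)) /= /eqP; exact/negP/oner_neq0.
Qed.
HB.instance Definition _ := GRing.Zmodule_isComNzRing.Build (tate X)
  tateMA tateMC tate1M tateMDl tate1_neq0.

Fact tateZA x y f : tateZ x (tateZ y f) = tateZ (x * y) f.
Proof. by apply: tateP => n /=; rewrite mulrA. Qed.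
Fact tate1Z : left_id 1 tateZ.
Proof. by move=> f; apply: tateP => n /=; rewrite mul1r. Qed.
Fact tateZDr : right_distributive tateZ +%R.
Proof. by move=> x f g; apply: tateP => n /=; rewrite mulrDr. Qed.
Fact tateZDl f : {morph tateZ^~ f : x y / x + y}.
Proof. by move=> x y; apply: tateP => n /=; rewrite mulrDl. Qed.
HB.instance Definition _ := GRing.Zmodule_isLmodule.Build X (tate X)
  tateZA tate1Z tateZDr tateZDl.
Fact tateZAl x f g : x *: (f * g) = (x *: f) * g.
Proof.
apply: tateP => n /=; rewrite /conv mulr_sumr.
by apply: eq_bigr => i _; rewrite mulrA.
Qed.
HB.instance Definition _ := GRing.Lmodule_isLalgebra.Build X (tate X) tateZAl.
HB.instance Definition _ := GRing.Lalgebra_isComAlgebra.Build X (tate X).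

Definition gauss_norm f : R := sup (range (fun i => vabs (tcoef f i))).

Definition is_unit f : Prop := exists g, f * g = 1.

(* tau (\sum_i f_i t^i) = \sum_i f_i^q t^i *)
Definition tau f : tate X :=
  Tate (decays_exp (ltnW (card_finNzRing_gt1 F)) (tcoef_decays f)).

Lemma decays_chi (a : {poly F}) : decays (fun i => vemb X a`_i).
Proof.
by apply: (@decays_finite (size a)) => n /leq_sizeP -> //; rewrite rmorph0.
Qed.

(* chi_t : A = F[theta] -> F[t], theta |-> t *)
Definition chi (a : {poly F}) : tate X := Tate (decays_chi a).

End Tate.

(** * Period domain, group action, holomorphy *)

Section Period.
Context {F : finFieldType} {R : realType} (X : valuedField F R).
Local Notation q := #|F|.
Local Notation T := (tate X).

(* The embedding of A = F_q[theta] in X. *)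
Definition Aemb (a : {poly F}) : X := (map_poly (vemb X) a).[vtheta X].

(* L(chi_t, q) *)
Definition Lchi : T :=
  nsum gauss_norm (fun a : {poly F} => a \is monic)
    (fun a => (Aemb a ^+ q)^-1 *: chi a).

(* Row vectors are (z_r, ..., z_1): z_r has index ord0 and z_1 has index
   ord_max. The rank r is written n.+1. *)
Definition Omega (n : nat) : set 'rV[X]_n.+1 :=
  [set z : 'rV[X]_n.+1 | z 0 ord_max = 1 /\
    forall c : 'cV[X]_n.+1, (forall i, Kinf (c i 0)) -> z *m c = 0 -> c = 0].

Definition vnorm (n : nat) (z : 'rV[X]_n.+1) : R :=
  \big[Num.max/0]_i vabs (z 0 i).

(* The normalised linear forms, given by their column of coefficients. *)
Definition unimodular (n : nat) : set 'cV[X]_n.+1 :=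
  [set eta : 'cV[X]_n.+1 | [/\ (forall i, Kinf (eta i 0)),
                 (forall i, vabs (eta i 0) <= 1)
               & exists j, vabs (eta j 0) = 1]].

(* |z|_Im *)
Definition imag (n : nat) (z : 'rV[X]_n.+1) : R :=
  inf [set vabs ((z *m eta) 0 0) | eta in @unimodular n].

Definition Omega_ (n : nat) (m : nat) : set 'rV[X]_n.+1 :=
  [set z : 'rV[X]_n.+1 | Omega z /\ (q%:R ^- m) * vnorm z <= imag z].

Definition T_eval (n : nat) (P : mpoly.mpoly n.+1 T) (z : 'rV[X]_n.+1) : T :=
  mpoly.meval (fun i => (z 0 i)%:A) P.

(* Uniform limits on every Omega_m of rational functions P / Q, with P and Q in
   T[z_1, ..., z_r]; that P / Q has no pole in Omega_m means that Q takes there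
   invertible values, so that P / Q is T-valued on Omega_m. *)
Definition holomorphic (n : nat) (f : 'rV[X]_n.+1 -> T) : Prop :=
  forall (m : nat) (e : R), 0 < e ->
  exists P Q : mpoly.mpoly n.+1 T, forall z, Omega_ m z ->
  exists2 w : T, T_eval Q z * w = 1 & gauss_norm (f z - T_eval P z * w) < e.

Definition jfac (n : nat) (g : 'M[{poly F}]_n.+1) (z : 'rV[X]_n.+1) : X :=
  (z *m map_mx Aemb (invmx g)) 0 ord_max.

Definition gact (n : nat) (g : 'M[{poly F}]_n.+1) (z : 'rV[X]_n.+1) :
  'rV[X]_n.+1 := (jfac g z)^-1 *: (z *m map_mx Aemb (invmx g)).

(** * The parameter at infinity and u-expansions *)

(* \tilde\pi, where lam is the chosen (q-1)-th root of - theta *)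
Definition pitilde (lam : X) : X :=
  lam * vtheta X *
  nlim (@vabs _ _ X) \oo
    (fun m => \prod_(1 <= j < m) (1 - vtheta X ^ (1 - (q ^ j)%N%:Z))^-1).

Definition lattice (n : nat) (z : 'rV[X]_n.+1) : set X :=
  range (fun a : 'cV[{poly F}]_n.+1 => (z *m map_mx Aemb a) 0 0).

(* e_L(w) = w \prod_(0 != l in L) (1 - w / l) *)
Definition lattice_exp (L : set X) (w : X) : X :=
  w * nlim (@vabs _ _ X) (@summability.totally X)
    (fun S : {fset X} => \prod_(l <- S | (l \in L) && (l != 0)) (1 - w / l)).

(* \tilde z: the vector z with its first entry z_r removed *)
Definition ztilde (n : nat) (z : 'rV[X]_n.+2) : 'rV[X]_n.+1 := col' ord0 z.

Definition upar (lam : X) (n : nat) (z : 'rV[X]_n.+2) : X :=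
  (pitilde lam)^-1 * (lattice_exp (lattice (ztilde z)) (z 0 ord0))^-1.

(* The distance from z_r to the K_oo-span of z_(r-1), ..., z_1, i.e. the
   infimum of |l_H(z)| over the forms normalised by eta_r = 1. *)
Definition imag_last (n : nat) (z : 'rV[X]_n.+2) : R :=
  inf [set vabs (z 0 ord0 - (ztilde z *m c) 0 0) |
        c in [set c : 'cV[X]_n.+1 | forall i, Kinf (c i 0)]].

(* f(z) = \sum_(i >= N) f_i(\tilde z) u^i near infinity. Since z_1 = 1, the
   normalisation used in [imag] gives |z|_Im <= 1 on Omega (lemma [imag_le1]
   below), so "|z|_Im sufficiently large" cannot refer to it. As for r = 2,
   where |\tilde z| = 1, the quantity that has to be large is the distance
   [imag_last] of z_r to the K_oo-span of \tilde z, taken relative to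
   |\tilde z| so that the bound depends on f only. *)
Definition u_expansion (lam : X) (n : nat) (f : 'rV[X]_n.+2 -> T) (N : nat)
    (fs : nat -> 'rV[X]_n.+1 -> T) : Prop :=
  (forall i, (N <= i)%N -> holomorphic (fs i)) /\
  exists B : R, forall z, Omega z -> B * vnorm (ztilde z) < imag_last z ->
    ncvg gauss_norm \oo
      (fun M => \sum_(N <= i < M) upar lam z ^+ i *: fs i (ztilde z)) (f z).

(** * Modular forms *)

(* Deformations of Drinfeld modular forms of rank n.+2, weight k and type m;
   det g is a nonzero constant, so only m modulo q - 1 matters. *)
Definition deformation (lam : X) (n : nat) (k m : int) (f : 'rV[X]_n.+2 -> T) :
    Prop :=
  [/\ holomorphic f,
      (forall g : 'M[{poly F}]_n.+2, g \in unitmx -> forall z, Omega z ->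
         f (gact g z) = (jfac g z ^ k * Aemb (\det g) ^ m) *: f z)
    & exists (N : nat) (fs : nat -> 'rV[X]_n.+1 -> T), u_expansion lam f N fs].

(* M_(k, m) *)
Definition modular_form (lam : X) (n : nat) (k m : int) (f : 'rV[X]_n.+2 -> T) :
    Prop :=
  deformation lam k m f /\ forall z, Omega z -> exists c : X, f z = c%:A.

Definition single_cuspidal (lam : X) (n : nat) (f : 'rV[X]_n.+2 -> T) : Prop :=
  exists2 fs, u_expansion lam f 1 fs &
    exists2 z : 'rV[X]_n.+1, Omega z & fs 1%N z != 0.

Definition nowhere_vanishing (n : nat) (f : 'rV[X]_n.+1 -> T) : Prop :=
  forall z, Omega z -> f z != 0.

(** * Vectorial Eisenstein series *)

Definition Eis (n k : nat) (z : 'rV[X]_n.+1) : 'cV[T]_n.+1 :=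
  \col_i nsum gauss_norm (fun a : 'cV[{poly F}]_n.+1 => a != 0)
    (fun a => ((z *m map_mx Aemb a) 0 0 ^+ k)^-1 *: chi (a i 0)).

(* Xi = [E_1 E_q ... E_(q^(r-1))] *)
Definition Xi (n : nat) (z : 'rV[X]_n.+1) : 'M[T]_n.+1 :=
  \matrix_(i, j) Eis (q ^ j) z i 0.

(* [E_1 tau(E_1) ... tau^(r-1)(E_1)], in rank r = n.+1 *)
Definition Xi_tau (n : nat) (z : 'rV[X]_n.+1) : 'M[T]_n.+1 :=
  \matrix_(i, j) iter j tau (Eis 1 z i 0).

End Period.

Lemma Kinf0 {F : finFieldType} {R : realType} (X : valuedField F R) :
  Kinf (0 : X).
Proof.
exists 0, (fun=> 0); rewrite /ncvg; apply: cvg_near_cst; apply: nearW => n.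
by rewrite big1 ?subrr ?vabs0// => i _; rewrite rmorph0 mul0r.
Qed.

Lemma Kinf1 {F : finFieldType} {R : realType} (X : valuedField F R) :
  Kinf (1 : X).
Proof.
exists 0, (fun i => (i == 0%N)%:R); apply: cvg_near_cst; exists 1%N => // -[//|n] _ /=.
rewrite big_ord_recl/= rmorph1 mul1r subr0 expr0z big1 ?addr0 ?subrr ?vabs0//.
by move=> i _; rewrite rmorph0 mul0r.
Qed.

Lemma imag_le1 {F : finFieldType} {R : realType} (X : valuedField F R) (n : nat)
  (z : 'rV[X]_n.+1) : Omega z -> imag z <= 1.
Proof.
case=> z1 _; have -> : 1 = vabs ((z *m delta_mx ord_max (0 : 'I_1)) 0 0).
  by rewrite -colE mxE z1 vabs1.
apply: ge_inf; first by exists 0 => _ [eta _ <-]; exact: vabs_ge0.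
exists (delta_mx ord_max 0) => //; split.
- by move=> i; rewrite mxE andbT; case: eqP => _; [exact: Kinf1|exact: Kinf0].
- by move=> i; rewrite mxE andbT; case: eqP => _; rewrite ?vabs1 ?vabs0 ?ler01.
- by exists ord_max; rewrite mxE !eqxx vabs1.
Qed.

(* Main.v *)
(* Let e be the exponential function of the lattice z A^r. Its Anderson generating
   functions omega(w) = \sum_j e(w / theta^(j+1)) t^j satisfy, by partial fractions
   and because low powers sum to 0 over F_q-spaces,
     \sum_i tau^k(omega(z_i)) E_(1,i) = 1/(t - theta), 0 or a constant kappa(z)
   according as k = 0, 0 < k < r or k = r. Since E_(q^j) = tau^j(E_1), the product of
   the matrix (tau^k(omega(z_i))) by Xi is triangular with units on the diagonal, so
   that det Xi is a unit. The case k = r shows moreover that tau multiplies det Xi,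
   up to a factor independent of z, by a constant; hence the ratio of the values of
   det Xi at two points is a unit and an eigenvector of tau, and is thus a constant.
   At infinity, let e and Et be the exponential and the E_1 of \tilde z. Grouping the
   lattice points by their first coordinate a, and modulo a, expresses E_1 through
   the inverses of e(z_r) + x, with x an a-torsion point, which are power series in u
   without constant term. If G is the additive function extending
   \tilde z b |-> chi_t(b), the series obtained are
     E_(1,r)   = - pitilde u + O(u^2),
     E_(1,j)   = Et_j + O(u) - G_j(z_r) E_(1,r),     tau(G) = G + e Et.
   A row operation removes the terms G_j(z_r) from det Xi, whose first row becomes
   (- pitilde u, 0, ..., 0) + O(u^2) and whose other rows become tau^k(Et) + O(u): the
   coefficient of u is - pitilde det(tau^k(Et))_(1 <= k < r). For r = 2, grouping the
   polynomials by their monic multiples gives tau(Et) = - L(chi_t, q). *)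

From HB Require Import structures.
Require Import Defs.
From mathcomp Require Import all_boot all_order all_algebra all_field finmap.
From mathcomp Require Import all_classical all_reals all_analysis.
From mathcomp Require Import zify ring lra.
From mathcomp Require mpoly summability.

Set Implicit Arguments.
Unset Strict Implicit.
Unset Printing Implicit Defensive.
Import Order.TTheory GRing.Theory Num.Theory.
Import numFieldNormedType.Exports.
Local Open Scope classical_set_scope.
Local Open Scope ring_scope.
Import -(notations) mpoly.

(** * Ultrametric summation *)

(** Convergence, holomorphy and boundedness have to survive every regrouping; three notions carry
    them. [sums] is unconditional summation in an ultrametric group: it passes through reindexing,
    fibrewise regrouping and continuous additive maps. [bholomorphic] adds boundedness on each
    [Omega_ m] to uniform approximation, which closes the class under products. [has_uexp lam f h]
    is an expansion in u from exponent 0 with constant coefficient h; applied to det Xi divided by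
    u, it makes h the coefficient of u. The row operation uses the same G_j for every column k,
    whereas column k contains tau^k(G_j); the difference has poles of order at most q^(k-1) in u and
    is absorbed by tau^k(E_(1,r)), of order at least q^k. Expansions are proved where |\tilde z| is
    less than the distance from z_r to its span: there all torsion values are smaller than e(z_r) by
    a common ratio. The coefficient of u is nonzero because it is, up to a nonzero constant, tau of
    the unit given by rank r - 1; moving z_r to infinity over a fixed \tilde z shows that every
    expansion has this coefficient. *)

Definition ultranorm (R : realType) (V : zmodType) (N : V -> R) : Prop :=
  [/\ forall x, N x = 0 -> x = 0, N 0 = 0, forall x, N (- x) = N x
    & forall x y, N (x + y) <= Num.max (N x) (N y)].

Definition ucomplete (R : realType) (V : zmodType) (N : V -> R) : Prop :=
  forall u : nat -> V,
  (forall e : R, 0 < e -> exists n0 : nat, forall m n : nat,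
     (n0 <= m)%N -> (n0 <= n)%N -> N (u m - u n) < e) ->
  exists l, forall e : R, 0 < e -> exists n0 : nat, forall n, (n0 <= n)%N ->
     N (l - u n) < e.

(* In an ultrametric group this says that x tends to 0 and that its finite
   partial sums tend to s. *)
Definition sums (R : realType) (V : zmodType) (N : V -> R) (I : choiceType)
    (x : I -> V) (s : V) : Prop :=
  forall e : R, 0 < e -> exists S : {fset I},
    N (s - \sum_(i <- S) x i) < e /\ forall i, i \notin S -> N (x i) < e.

Definition nullfam (R : realType) (V : zmodType) (N : V -> R) (I : choiceType)
    (x : I -> V) : Prop :=
  forall e : R, 0 < e -> exists S : {fset I}, forall i, i \notin S -> N (x i) < e.

Lemma big_fset_split (T : Type) (idx : T) (op : Monoid.com_law idx)
    (I : choiceType) (S S' : {fset I}) (x : I -> T) :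
  (S `<=` S')%fset ->
  \big[op/idx]_(i <- S') x i =
  op (\big[op/idx]_(i <- S) x i) (\big[op/idx]_(i <- S' | i \notin S) x i).
Proof.
move=> SS'; rewrite (bigID (mem S)) /=; congr (op _ _).
rewrite big_mkcond -(big_fset_incl _ SS') /=.
  by apply: eq_big_seq => i ->.
by move=> i _ /negPf ->.
Qed.

Section Ultra.
Context {R : realType} {V : zmodType} {N : V -> R} (hN : ultranorm N).

Lemma un_eq0 x : N x = 0 -> x = 0. Proof. by case: hN => + _ _ _; exact. Qed.
Lemma un0 : N 0 = 0. Proof. by case: hN. Qed.
Lemma unN x : N (- x) = N x. Proof. by case: hN. Qed.
Lemma unD x y : N (x + y) <= Num.max (N x) (N y). Proof. by case: hN. Qed.
Lemma unC x y : N (x - y) = N (y - x). Proof. by rewrite -opprB unN. Qed.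
Lemma un_ge0 x : 0 <= N x.
Proof. by have := unD x (- x); rewrite subrr un0 unN maxxx. Qed.

Lemma unD_le x y M : N x <= M -> N y <= M -> N (x + y) <= M.
Proof. by move=> hx hy; apply: le_trans (unD x y) _; rewrite ge_max hx. Qed.
Lemma unD_lt x y M : N x < M -> N y < M -> N (x + y) < M.
Proof. by move=> hx hy; apply: le_lt_trans (unD x y) _; rewrite gt_max hx. Qed.
Lemma unB_le x y M : N x <= M -> N y <= M -> N (x - y) <= M.
Proof. by move=> hx hy; apply: unD_le => //; rewrite unN. Qed.
Lemma unB_lt x y M : N x < M -> N y < M -> N (x - y) < M.
Proof. by move=> hx hy; apply: unD_lt => //; rewrite unN. Qed.
Lemma un_dist_lt y x z M : N (x - y) < M -> N (y - z) < M -> N (x - z) < M.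
Proof. by move=> h1 h2; rewrite -(subrK y x) -addrA; apply: unD_lt. Qed.
Lemma un_dist_le y x z M : N (x - y) <= M -> N (y - z) <= M -> N (x - z) <= M.
Proof. by move=> h1 h2; rewrite -(subrK y x) -addrA; apply: unD_le. Qed.

Lemma un_eq x y : N (x - y) < N x -> N y = N x.
Proof.
move=> h; apply/eqP; rewrite eq_le; apply/andP; split.
  by rewrite -(subKr x y); apply: unB_le => //; exact: ltW.
rewrite leNgt; apply/negP => h'.
by have := unD_lt h h'; rewrite subrK ltxx.
Qed.

Lemma un_sum_lt (I : Type) (r : seq I) (P : pred I) (x : I -> V) e : 0 < e ->
  (forall i, P i -> N (x i) < e) -> N (\sum_(i <- r | P i) x i) < e.
Proof.
move=> e0 h; elim/big_ind: _ => //; [by rewrite un0|move=> *; exact: unD_lt].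
Qed.

Lemma un_sum_le (I : Type) (r : seq I) (P : pred I) (x : I -> V) e : 0 <= e ->
  (forall i, P i -> N (x i) <= e) -> N (\sum_(i <- r | P i) x i) <= e.
Proof.
move=> e0 h; elim/big_ind: _ => //; [by rewrite un0|move=> *; exact: unD_le].
Qed.

Lemma un_eq0_lt x : (forall e, 0 < e -> N x < e) -> x = 0.
Proof.
move=> h; apply: un_eq0; apply/eqP; rewrite eq_le un_ge0 andbT leNgt.
by apply/negP => /h; rewrite ltxx.
Qed.

Section Families.
Context {I : choiceType}.
Implicit Types (x y : I -> V) (s t : V) (S : {fset I}).

Lemma sums_null x s : sums N x s -> nullfam N x.
Proof. by move=> xs e /xs[S [_ h]]; exists S. Qed.

(** Any S off which the terms are below e will do, and not only the sets supplied by [sums]: S and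
    such a set differ by finitely many terms below e, whose sum stays below e. *)
Lemma sums_tail x s S e : sums N x s -> 0 < e ->
  (forall i, i \notin S -> N (x i) < e) -> N (s - \sum_(i <- S) x i) < e.
Proof.
move=> xs e0 hS; have [S' [h1 h2]] := xs _ e0.
apply: (@un_dist_lt (\sum_(i <- (S `|` S')%fset) x i)).
  rewrite (@big_fset_split _ _ _ _ S') ?fsubsetUr// opprD addrA.
  by apply: unB_lt => //; apply: un_sum_lt.
rewrite (@big_fset_split _ _ _ _ S (S `|` S')%fset) ?fsubsetUl// addrC addKr.
exact: un_sum_lt.
Qed.

Lemma sums_uniq x s t : sums N x s -> sums N x t -> s = t.
Proof.
move=> xs xt; apply/eqP; rewrite -subr_eq0; apply/eqP/un_eq0_lt => e e0.
have [S [h1 h2]] := xs _ e0.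
apply: (@un_dist_lt (\sum_(i <- S) x i)) => //; rewrite unC.
exact: sums_tail.
Qed.

Lemma sums_le x s M : 0 <= M -> sums N x s -> (forall i, N (x i) <= M) -> N s <= M.
Proof.
move=> M0 xs h; rewrite leNgt; apply/negP => Ms.
have s0 : 0 < N s by apply: le_lt_trans Ms.
have := @sums_tail x s fset0 (N s) xs s0 (fun i _ => le_lt_trans (h i) Ms).
by rewrite big_seq_fset0 subr0 ltxx.
Qed.

Lemma sums_ext x y s : x =1 y -> sums N x s -> sums N y s.
Proof. by move=> /funext ->. Qed.

Lemma sumsD x y s t : sums N x s -> sums N y t ->
  sums N (fun i => x i + y i) (s + t).
Proof.
move=> xs yt e e0; have [S [_ hS]] := xs _ e0; have [S' [_ hS']] := yt _ e0.
exists (S `|` S')%fset; split; last first.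
  by move=> i; rewrite in_fsetU negb_or => /andP[/hS ? /hS' ?]; apply: unD_lt.
rewrite big_split opprD addrACA; apply: unD_lt; apply: sums_tail => // i;
  by rewrite in_fsetU negb_or => /andP[? ?]; auto.
Qed.

Lemma sums0 : sums N (fun _ : I => 0) 0.
Proof.
by move=> e e0; exists fset0; rewrite big1// subrr un0.
Qed.

Lemma sums_sum (J : Type) (r : seq J) (P : pred J) (x : J -> I -> V) (s : J -> V) :
  (forall j, P j -> sums N (x j) (s j)) ->
  sums N (fun i => \sum_(j <- r | P j) x j i) (\sum_(j <- r | P j) s j).
Proof.
move=> h; elim: r => [|j r IH].
  rewrite big_nil; apply: (sums_ext _ sums0) => i; by rewrite big_nil.
rewrite big_cons; case: ifP => Pj.
  by apply: (sums_ext _ (sumsD (h _ Pj) IH)) => i; rewrite big_cons Pj.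
by apply: (sums_ext _ IH) => i; rewrite big_cons Pj.
Qed.

Lemma sums_fset x S : (forall i, i \notin S -> x i = 0) ->
  sums N x (\sum_(i <- S) x i).
Proof.
by move=> h e e0; exists S; rewrite subrr un0; split => // i /h ->; rewrite un0.
Qed.

(** Existence of the limit along finite sets excludes the default value of [nlim]. The restriction P
    becomes a conditional family, so that rearrangements take place over whole index types. *)
Lemma sums_nsum (P : pred I) x s :
  sums N (fun i => if P i then x i else 0) s -> nsum N P x = s.
Proof.
move=> xs; rewrite /nsum /nlim; have FF := @summability.totally_filter I.
have cs : ncvg N (@summability.totally I)
    (fun S : {fset I} => \sum_(i <- S | P i) x i) s.
  apply/cvgrPdist_lt => e e0; have [S [_ hS]] := xs _ e0.
  exists S => // S' /= SS'; rewrite sub0r normrN ger0_norm ?un_ge0// unC big_mkcond /=.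
  apply: sums_tail => // i iS'; apply: hS; apply: contraNN iS'.
  exact: (fsubsetP SS').
case: xgetP => [l _ /= cl|/(_ s)//].
apply/eqP; rewrite -subr_eq0; apply/eqP/un_eq0_lt => e e0.
move: cl cs => /cvgrPdist_lt/(_ e e0)[S _ hS] /cvgrPdist_lt/(_ e e0)[S' _ hS'].
have := hS (S `|` S')%fset; rewrite /= fsubsetUl => /(_ isT).
have := hS' (S `|` S')%fset; rewrite /= fsubsetUr => /(_ isT).
rewrite !sub0r !normrN !ger0_norm ?un_ge0// => h1 h2.
by apply: (un_dist_lt _ h1); rewrite unC.
Qed.

(** Ultrametric summability criterion: in a complete group, terms tending to 0 suffice, without any
    order on the index type. *)
Lemma null_sums x : ucomplete N -> nullfam N x -> exists s, sums N x s.
Proof.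
move=> cN nx.
have inv0 (k : nat) : 0 < (k.+1%:R^-1 : R) by rewrite invr_gt0 ltr0n.
have [T hT] := choice (fun k : nat => nx _ (inv0 k)).
(* Increasing finite sets: every term off [U k] is below 1/(k+1), so the partial sums over them form
   a Cauchy sequence. *)
pose U := fix U k := if k is k'.+1 then (U k' `|` T k)%fset else T 0%N.
have TU k : (T k `<=` U k)%fset by case: k => [|k] //=; rewrite fsubsetUr.
have UU m n : (m <= n)%N -> (U m `<=` U n)%fset.
  elim: n => [|n IH]; first by rewrite leqn0 => /eqP ->.
  rewrite leq_eqVlt => /orP[/eqP -> //|]; rewrite ltnS => /IH /fsubset_trans; apply.
  exact: fsubsetUl.
have small e : 0 < e -> exists n0 : nat, n0.+1%:R^-1 < e :> R.
  move=> e0; exists (Num.truncn e^-1).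
  rewrite invf_plt ?posrE ?ltr0n//; exact: Num.Theory.truncnS_gt.
have off k e i : k.+1%:R^-1 < e -> i \notin U k -> N (x i) < e.
  move=> ke iU; apply: lt_trans ke; apply: hT; apply: contraNN iU.
  exact: (fsubsetP (TU k)).
have step k n e : 0 < e -> k.+1%:R^-1 < e -> (k <= n)%N ->
    N (\sum_(i <- U n) x i - \sum_(i <- U k) x i) < e.
  move=> e0 ke kn; rewrite (big_fset_split _ _ (UU _ _ kn)) addrC addKr.
  by apply: un_sum_lt => // i; exact: off.
have [|l hl] := cN (fun k => \sum_(i <- U k) x i).
  move=> e e0; have [n0 h0] := small _ e0; exists n0 => m n nm nn.
  apply: (@un_dist_lt (\sum_(i <- U n0) x i)); first exact: step.
  by rewrite unC; exact: step.
exists l => e e0; have [n0 h0] := small _ e0; have [n1 h1] := hl _ e0.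
exists (U (maxn n0 n1)); split; first by apply: h1; exact: leq_maxr.
move=> i iU; apply: (off n0) => //; apply: contraNN iU.
by apply: fsubsetP; apply: UU; exact: leq_maxl.
Qed.

End Families.

Lemma sums_finType (I : finType) (x : I -> V) : sums N x (\sum_i x i).
Proof.
move=> e e0; exists [fset i in enum I]%fset; split; last first.
  by move=> i; rewrite !inE mem_enum.
have pE : perm_eq [fset i in enum I]%fset (enum I).
  by apply: uniq_perm; rewrite ?fset_uniq ?enum_uniq// => i; rewrite !inE.
by rewrite (perm_big _ pE) big_enum subrr un0.
Qed.

Lemma sums_inj (I J : choiceType) (f : J -> I) (x : I -> V) s : injective f ->
  (forall i, (forall j, i <> f j) -> x i = 0) ->
  sums N (x \o f) s -> sums N x s.
Proof.
move=> fI x0 xs e e0; have [S [h1 h2]] := xs _ e0.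
exists (f @` S)%fset; split.
  by rewrite big_imfset//= => i j _ _; exact: fI.
move=> i iS; have [[j ij]|h] := pselect (exists j, i = f j).
  rewrite ij; apply: h2; apply: contraNN iS => jS; rewrite ij.
  by apply/imfsetP; exists j.
by rewrite x0 ?un0// => j ij; apply: h; exists j.
Qed.

(** One finite set S serves all fibres: its complement is small in each of them, so each [y j] is
    close to the part of its fibre lying in S, and is itself small when j is not in the image of
    S. *)
Lemma sums_regroup (I J : choiceType) (p : I -> J) (x : I -> V) (y : J -> V) s :
  sums N x s -> (forall j, sums N (fun i => if p i == j then x i else 0) (y j)) ->
  sums N y s.
Proof.
move=> xs xy e e0; have [S [h1 h2]] := xs _ e0.
exists (p @` S)%fset.
have tail j : N (y j - \sum_(i <- S) (if p i == j then x i else 0)) < e.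
  by apply: (sums_tail (xy j)) => // i iS; case: eqP => _; rewrite ?un0//; exact: h2.
split.
  apply: (un_dist_lt h1).
  have -> : \sum_(i <- S) x i =
      \sum_(j <- (p @` S)%fset) \sum_(i <- S) (if p i == j then x i else 0).
    rewrite exchange_big /=; apply: eq_big_seq => i iS.
    rewrite (big_fsetD1 (p i)) /= ?eqxx; last by apply/imfsetP; exists i.
    rewrite big_seq big1 ?addr0// => j; rewrite !inE => /andP[/negPf ji _].
    by rewrite eq_sym ji.
  rewrite -sumrB; apply: un_sum_lt => // j _; by rewrite unC.
move=> j jS; have := tail j; rewrite big_seq big1 ?subr0// => i iS.
case: eqP => // pij; case/negP: jS; apply/imfsetP; exists i => //.
Qed.

Lemma sums_sub (I J : choiceType) (f : J -> I) (x : I -> V) s : injective f ->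
  (forall i, (forall j, i <> f j) -> x i = 0) ->
  sums N x s -> sums N (x \o f) s.
Proof.
move=> fI x0 xs e e0; have [S [h1 h2]] := xs _ e0.
pose S' := [fset i in S | `[< exists j, i = f j >]]%fset.
(* A partial inverse of f, used to pull the finite set S back to J. *)
have /choice[g hg] i : exists o : option J,
    match o with Some j => i = f j | None => forall j, i <> f j end.
  have [[j ij]|h] := pselect (exists j, i = f j); first by exists (Some j).
  by exists None => j ij; apply: h; exists j.
have gf j : g (f j) = Some j.
  by have := hg (f j); case: (g (f j)) => [k /fI ->//|/(_ j)].
pose T := [fset j in pmap g S]%fset.
have jT j : (j \in T) = (f j \in S).
  rewrite inE mem_pmap; apply/mapP/idP => [[i iS gi]|fS].
    by have := hg i; rewrite -gi => <-.
  by exists (f j).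
exists T; split; last by move=> j; rewrite jT; exact: h2.
have fTS : ((f @` T) `<=` S)%fset.
  by apply/fsubsetP => i /imfsetP[j /= jT' ->]; rewrite -jT.
have -> : \sum_(j <- T) (x \o f) j = \sum_(i <- (f @` T)%fset) x i.
  by rewrite [RHS]big_imfset//= => i j _ _; exact: fI.
rewrite (big_fset_incl _ fTS)// => i iS iT; apply: x0 => j ij; case/negP: iT.
by rewrite ij; apply/imfsetP; exists j => //=; rewrite jT -ij.
Qed.

End Ultra.

(** Only additivity and continuity at 0 are asked for, so that coefficient maps, multiplications and
    the Frobenius twist are all covered. *)
Lemma sums_map (R : realType) (V W : zmodType) (N : V -> R) (N' : W -> R)
  (hN : ultranorm N) (hN' : ultranorm N') (I : choiceType)
  (phi : V -> W) (x : I -> V) s :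
  {morph phi : u v / u + v} ->
  (forall e, 0 < e -> exists2 d, 0 < d & forall v, N v < d -> N' (phi v) < e) ->
  sums N x s -> sums N' (phi \o x) (phi s).
Proof.
move=> phiD phic xs e e0; have [d d0 hd] := phic _ e0.
have [S [h1 h2]] := xs _ d0; exists S; split; last by move=> i /h2/hd.
have phi0 : phi 0 = 0 by apply: (@addrI _ (phi 0)); rewrite -phiD !addr0.
have phiN u : phi (- u) = - phi u by apply: (@addrI _ (phi u)); rewrite -phiD !subrr.
rewrite -(big_morph phi phiD phi0) -phiN -phiD; exact: hd.
Qed.

(** * The absolute value and the Tate algebra *)

Section BasicField.
Context {F : finFieldType} {R : realType} {X : valuedField F R}.
Local Notation q := #|F|.
Local Notation N := (@vabs F R X).
Implicit Types x y : X.

Lemma q_gt1 : (1 < q)%N. Proof. exact: card_finNzRing_gt1. Qed.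
Lemma q_gt0 : (0 < q)%N. Proof. exact: ltnW q_gt1. Qed.
Lemma qR_gt1 : 1 < q%:R :> R. Proof. by rewrite ltr1n q_gt1. Qed.
Lemma qR_gt0 : 0 < q%:R :> R. Proof. by rewrite ltr0n q_gt0. Qed.
Lemma qR_ge1 : 1 <= q%:R :> R. Proof. exact: ltW qR_gt1. Qed.
Lemma qR_neq0 : q%:R != 0 :> R. Proof. exact: lt0r_neq0 qR_gt0. Qed.
Hint Resolve q_gt0 q_gt1 qR_gt1 qR_gt0 qR_ge1 qR_neq0 : core.

Lemma qRX_gt0 k : 0 < q%:R ^+ k :> R. Proof. by rewrite exprn_gt0. Qed.

Lemma qRV_small (e : R) : 0 < e -> exists k, q%:R ^- k < e.
Proof.
move=> e0; exists (Num.truncn e^-1).+1; rewrite invf_plt ?posrE ?qRX_gt0//.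
apply: lt_le_trans (Num.Theory.truncnS_gt _) _.
by rewrite -natrX ler_nat; apply: ltnW; apply: ltn_expl.
Qed.

Lemma vabs_un : ultranorm N.
Proof.
split; [exact: vabs_eq0|exact: vabs0|exact: vabsN|exact: vabsD].
Qed.

Lemma vabs_neq0 x : x != 0 -> 0 < N x.
Proof.
move=> x0; rewrite lt_neqAle vabs_ge0 andbT eq_sym.
by apply: contraNneq x0 => /vabs_eq0 ->.
Qed.

Lemma vabs_eq0E x : (N x == 0) = (x == 0).
Proof. by apply/eqP/eqP => [/vabs_eq0|->]//; exact: vabs0. Qed.

Lemma vabs_gt0 x : (0 < N x) = (x != 0).
Proof. by rewrite lt_neqAle vabs_ge0 andbT eq_sym vabs_eq0E. Qed.

Lemma vabsX x k : N (x ^+ k) = N x ^+ k.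
Proof. by elim: k => [|k IH]; rewrite ?expr0 ?vabs1// !exprS vabsM IH. Qed.

Lemma vabsV x : N x^-1 = (N x)^-1.
Proof.
have [->|x0] := eqVneq x 0; first by rewrite invr0 vabs0 invr0.
apply: (mulfI (lt0r_neq0 (vabs_neq0 x0))).
by rewrite -vabsM !divff ?vabs1// vabs_eq0E.
Qed.

Lemma vabs_prod (I : Type) (r : seq I) (P : pred I) (x : I -> X) :
  N (\prod_(i <- r | P i) x i) = \prod_(i <- r | P i) N (x i).
Proof. by apply: (big_morph N) => [u v|]; rewrite ?vabsM ?vabs1. Qed.

Lemma theta_neq0 : vtheta X != 0.
Proof. by rewrite -vabs_gt0 vabs_theta. Qed.

Lemma expf_card_m1 (c : F) : c != 0 -> c ^+ q.-1 = 1.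
Proof.
move=> c0; apply: (mulfI c0); rewrite -exprS prednK//.
by rewrite expf_card mulr1.
Qed.

Lemma vabs_vemb (c : F) : c != 0 -> N (vemb X c) = 1.
Proof.
move=> c0; have : N (vemb X c) ^+ q.-1 = 1.
  by rewrite -vabsX -rmorphXn /= expf_card_m1// rmorph1 vabs1.
move/eqP; rewrite pexprn_eq1 ?vabs_ge0//.
by have := q_gt1; case: (q) => [|[|k]]//= _ /eqP.
Qed.

Lemma vabs_vemb_le1 (c : F) : N (vemb X c) <= 1.
Proof.
by have [->|/vabs_vemb ->//] := eqVneq c 0; rewrite rmorph0 vabs0.
Qed.

(** The form of [q is a power of the characteristic] from which the additivity of x |-> x^(q^k)
    follows. *)
Lemma pnat_card k : ([pchar X].-nat (q ^ k))%N.
Proof.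
have [p p_pr pF] := finPcharP F.
have : p.-nat q by have := pprimeChar_pgroup pF; rewrite /pgroup.pgroup cardsT.
move=> pq; rewrite pnatX; apply/orP; left.
apply: sub_in_pnat pq => r _; rewrite inE => /eqP ->.
exact: (rmorph_pchar (vemb X)).
Qed.

Lemma frobD k x y : (x + y) ^+ (q ^ k) = x ^+ (q ^ k) + y ^+ (q ^ k).
Proof. exact: exprDn_pchar (pnat_card k). Qed.

Lemma qX_gt0 k : (0 < q ^ k)%N. Proof. by rewrite expn_gt0 q_gt0. Qed.

Lemma frobN k x : (- x) ^+ (q ^ k) = - x ^+ (q ^ k).
Proof.
apply: (@addrI _ (x ^+ (q ^ k))).
by rewrite -frobD !subrr expr0n eqn0Ngt qX_gt0.
Qed.

Lemma frobB k x y : (x - y) ^+ (q ^ k) = x ^+ (q ^ k) - y ^+ (q ^ k).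
Proof. by rewrite frobD frobN. Qed.

Lemma frob_sum k (I : Type) (r : seq I) (P : pred I) (x : I -> X) :
  (\sum_(i <- r | P i) x i) ^+ (q ^ k) = \sum_(i <- r | P i) x i ^+ (q ^ k).
Proof.
apply: (big_morph (fun y => y ^+ (q ^ k))) => [u v|]; first exact: frobD.
by rewrite expr0n eqn0Ngt qX_gt0.
Qed.

Lemma vemb_frob k (c : F) : vemb X c ^+ (q ^ k) = vemb X c.
Proof.
elim: k => [|k IH]; first by rewrite expn0 expr1.
by rewrite expnSr exprM IH -rmorphXn /= expf_card.
Qed.

Lemma q_eq0 : q%:R = 0 :> X.
Proof.
have [p p_pr pF] := finPcharP F.
have pX : p \in [pchar X] := rmorph_pchar (vemb X) pF.
have /p_natP[[|m] mE] : p.-nat q.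
  by have := pprimeChar_pgroup pF; rewrite /pgroup.pgroup cardsT.
  by have := q_gt1; rewrite mE.
by rewrite mE expnS natrM (pcharf0 pX) mul0r.
Qed.

Lemma Aemb_is_zmod_morphism : zmod_morphism (Aemb X).
Proof. by move=> a b; rewrite /Aemb rmorphB hornerD hornerN. Qed.
Lemma Aemb_is_monoid_morphism : monoid_morphism (Aemb X).
Proof.
by split => [|a b]; rewrite /Aemb ?rmorph1 ?hornerC// rmorphM hornerM.
Qed.
HB.instance Definition _ := GRing.isZmodMorphism.Build {poly F} X (Aemb X)
  Aemb_is_zmod_morphism.
HB.instance Definition _ := GRing.isMonoidMorphism.Build {poly F} X (Aemb X)
  Aemb_is_monoid_morphism.

Lemma AembC (c : F) : Aemb X c%:P = vemb X c.
Proof. by rewrite /Aemb map_polyC hornerC. Qed.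
Lemma AembX : Aemb X 'X = vtheta X.
Proof. by rewrite /Aemb map_polyX hornerX. Qed.

Lemma vabs_Aemb_lt (a : {poly F}) k : (size a <= k)%N -> N (Aemb X a) < q%:R ^+ k.
Proof.
move=> ak; rewrite /Aemb horner_coef size_map_poly.
apply: vabs_sum_lt => [|i _]; first exact: qRX_gt0.
rewrite coef_map vabsM vabsX vabs_theta.
apply: le_lt_trans (_ : _ <= q%:R ^+ i) _.
  by rewrite ler_piMl ?exprn_ge0 ?ler0n// vabs_vemb_le1.
rewrite ltr_eXn2l ?qR_gt1//; exact: leq_trans ak.
Qed.

Lemma vabs_Aemb (a : {poly F}) : a != 0 -> N (Aemb X a) = q%:R ^+ (size a).-1.
Proof.
move=> a0; have sa : size a = (size a).-1.+1 by rewrite prednK// size_poly_gt0.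
have -> : Aemb X a = vemb X (lead_coef a) * vtheta X ^+ (size a).-1 +
    Aemb X (\poly_(i < (size a).-1) a`_i).
  rewrite /Aemb [in LHS]horner_coef size_map_poly [in LHS]sa big_ord_recr /= addrC.
  congr (_ + _); first by rewrite coef_map.
  rewrite (horner_coef_wide _ (n := (size a).-1)); last first.
    by rewrite size_map_poly size_poly.
  by apply: eq_bigr => i _; rewrite !coef_map coef_poly ltn_ord.
set u := _ * _; have Nu : N u = q%:R ^+ (size a).-1.
  by rewrite /u vabsM vabsX vabs_theta vabs_vemb ?mul1r// lead_coef_eq0.
rewrite -Nu; apply/(un_eq vabs_un); rewrite opprD addNKr vabsN Nu.
exact/vabs_Aemb_lt/size_poly.
Qed.

Lemma vabs_Aemb_ge1 (a : {poly F}) : a != 0 -> 1 <= N (Aemb X a).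
Proof. by move=> a0; rewrite vabs_Aemb// exprn_ege1. Qed.

Lemma Aemb_eq0 (a : {poly F}) : (Aemb X a == 0) = (a == 0).
Proof.
have [->|a0] := eqVneq a 0; first by rewrite rmorph0 eqxx.
by rewrite -vabs_eq0E vabs_Aemb// gt_eqF// qRX_gt0.
Qed.

Lemma vabs_ucomplete : vcomplete X -> ucomplete N.
Proof.
move=> cX u /cX[l /cvgrPdist_lt ul]; exists l => e /ul[n0 _ h]; exists n0 => n /h /=.
by rewrite sub0r normrN ger0_norm ?vabs_ge0// (unC vabs_un).
Qed.

End BasicField.
#[export] Hint Resolve q_gt0 q_gt1 qR_gt1 qR_gt0 qR_ge1 qR_neq0 : core.

Section TateTheory.
Context {F : finFieldType} {R : realType} {X : valuedField F R}.
Local Notation q := #|F|.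
Local Notation N := (@vabs F R X).
Local Notation T := (tate X).
Local Notation G := (@gauss_norm F R X).
Implicit Types (f g : T) (x y : X).

Lemma gauss_has_sup f : has_sup (range (fun i => N (tcoef f i))).
Proof.
split; first by exists (N (tcoef f 0)), 0%N.
have [M _ hM] := decays_bounded (tcoef_decays f).
by exists M => _ [i _ <-]; exact: ltW.
Qed.

Lemma gauss_coef f i : N (tcoef f i) <= G f.
Proof.
by apply: sup_upper_bound; [exact: gauss_has_sup|exists i].
Qed.

Lemma gauss_le f M : (forall i, N (tcoef f i) <= M) -> G f <= M.
Proof.
move=> h; apply: ge_sup; first by exists (N (tcoef f 0)), 0%N.
by move=> _ [i _ <-].
Qed.

Lemma gauss_ge0 f : 0 <= G f.
Proof. exact: le_trans (vabs_ge0 _) (gauss_coef f 0). Qed.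

Lemma tcoefN f i : tcoef (- f) i = - tcoef f i. Proof. by []. Qed.
Lemma tcoefB f g i : tcoef (f - g) i = tcoef f i - tcoef g i. Proof. by []. Qed.
Lemma tcoefZ x f i : tcoef (x *: f) i = x * tcoef f i. Proof. by []. Qed.
Lemma tcoef0 i : tcoef (0 : T) i = 0. Proof. by case: i. Qed.
Lemma tcoef1 i : tcoef (1 : T) i = (i == 0%N)%:R. Proof. by case: i. Qed.
Lemma tcoefM f g i : tcoef (f * g) i = \sum_(j < i.+1) tcoef f j * tcoef g (i - j)%N.
Proof. by []. Qed.
Lemma tcoefA x i : tcoef (x%:A : T) i = if i == 0%N then x else 0.
Proof. by rewrite tcoefZ tcoef1; case: i => [|i]; rewrite ?mulr1 ?mulr0. Qed.
Lemma tcoef_tau f i : tcoef (tau f) i = tcoef f i ^+ q. Proof. by []. Qed.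
Lemma tcoef_chi (a : {poly F}) i : tcoef (chi a : T) i = vemb X a`_i. Proof. by []. Qed.

Lemma gauss_un : ultranorm G.
Proof.
split.
- move=> f f0; apply: tateP => i; rewrite tcoef0; apply: vabs_eq0.
  by apply/eqP; rewrite eq_le vabs_ge0 -f0 gauss_coef.
- apply/eqP; rewrite eq_le gauss_ge0 andbT.
  by apply: gauss_le => i; rewrite tcoef0 vabs0.
- move=> f; apply/eqP; rewrite eq_le; apply/andP; split; apply: gauss_le => i.
    by rewrite tcoefN vabsN gauss_coef.
  by rewrite -vabsN -tcoefN gauss_coef.
- move=> f g; apply: gauss_le => i; apply: le_trans (vabsD _ _) _.
  by rewrite ge_max !le_max !gauss_coef orbT.
Qed.

Lemma gaussZ_le x f : G (x *: f) <= N x * G f.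
Proof.
by apply: gauss_le => i; rewrite tcoefZ vabsM ler_wpM2l ?vabs_ge0// gauss_coef.
Qed.

Lemma gaussZ x f : G (x *: f) = N x * G f.
Proof.
apply/eqP; rewrite eq_le gaussZ_le /=.
have [->|x0] := eqVneq x 0; first by rewrite vabs0 mul0r gauss_ge0.
rewrite -{1}(scalerK x0 f); apply: le_trans (_ : N x * (N x^-1 * G (x *: f)) <= _).
  by rewrite ler_wpM2l ?vabs_ge0// gaussZ_le.
by rewrite mulrA vabsV divff ?mul1r// vabs_eq0E.
Qed.

Lemma gaussM f g : G (f * g) <= G f * G g.
Proof.
apply: gauss_le => i; rewrite tcoefM; apply: (un_sum_le vabs_un).
  by rewrite mulr_ge0 ?gauss_ge0.
by move=> j _; rewrite vabsM ler_pM ?vabs_ge0 ?gauss_coef.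
Qed.

Lemma gauss1 : G 1 = 1.
Proof.
apply/eqP; rewrite eq_le; apply/andP; split.
  by apply: gauss_le => -[|i]; rewrite tcoef1 ?vabs1 ?vabs0.
by rewrite -(vabs1 (X := X)); apply: le_trans (gauss_coef 1 0).
Qed.

Lemma gaussA x : G (x%:A) = N x.
Proof. by rewrite gaussZ gauss1 mulr1. Qed.

Lemma gauss_chi (a : {poly F}) : G (chi a) <= 1.
Proof. by apply: gauss_le => i; exact: vabs_vemb_le1. Qed.

Lemma gauss_tau f : G (tau f) <= G f ^+ q.
Proof.
by apply: gauss_le => i; rewrite tcoef_tau vabsX lerXn2r ?nnegrE ?vabs_ge0 ?gauss_ge0 ?gauss_coef.
Qed.

(** Limits are taken coefficient by coefficient; the Cauchy rate is uniform in the index, so the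
    limit sequence still decays. *)
Lemma gauss_ucomplete : ucomplete N -> ucomplete G.
Proof.
move=> cN u cu.
have ci i : exists l, forall e : R, 0 < e -> exists n0 : nat, forall n, (n0 <= n)%N ->
    N (l - tcoef (u n) i) < e.
  apply: cN => e /cu[n0 h]; exists n0 => m n m0 n0'.
  by apply: le_lt_trans (h _ _ m0 n0'); rewrite -tcoefB gauss_coef.
have [l hl] := choice ci.
have ul e : 0 < e -> exists n0 : nat, forall n, (n0 <= n)%N -> forall i,
    N (l i - tcoef (u n) i) < e.
  move=> e0; have [n0 h] := cu _ e0; exists n0 => n nn i.
  have [n1 h1] := hl i _ e0.
  apply: (un_dist_lt vabs_un (h1 (maxn n0 n1) (leq_maxr _ _))).
  by apply: le_lt_trans (h _ _ (leq_maxl n0 n1) nn); rewrite -tcoefB gauss_coef.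
have dl : decays l.
  apply/decaysP => e e0; have [n0 h0] := ul _ e0.
  have [n1 h1] := proj1 (decaysP _) (tcoef_decays (u n0)) _ e0.
  exists n1 => n /h1 h; rewrite -(subrK (tcoef (u n0) n) (l n)).
  by apply: (unD_lt vabs_un) => //; apply: h0.
(* Halving e restores a strict inequality, the Gauss norm being a supremum. *)
exists (Tate dl) => e e0; have e20 : 0 < e / 2 by rewrite divr_gt0.
have [n0 h] := ul _ e20; exists n0 => n nn; apply: le_lt_trans (_ : e / 2 < e).
  by apply: gauss_le => i; rewrite tcoefB; apply/ltW/h.
by rewrite ltr_pdivrMr// ltr_pMr// ltr1n.
Qed.

Lemma sums_tcoef (I : choiceType) (x : I -> T) s i : sums G x s ->
  sums N (fun j => tcoef (x j) i) (tcoef s i).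
Proof.
apply: (sums_map gauss_un vabs_un (phi := fun f => tcoef f i)) => // e e0.
by exists e => // f; apply: le_lt_trans (gauss_coef f i).
Qed.

Lemma sums_mull (I : choiceType) (x : I -> T) s f : sums G x s ->
  sums G (fun j => f * x j) (f * s).
Proof.
apply: (sums_map gauss_un gauss_un (phi := fun g => f * g)) => [u v|e e0].
  by rewrite mulrDr.
have f1 : 0 < G f + 1 by rewrite ltr_wpDl ?gauss_ge0.
exists (e / (G f + 1)); first by rewrite divr_gt0.
move=> g; rewrite ltr_pdivlMr// => h; apply: le_lt_trans h.
by apply: le_trans (gaussM _ _) _; rewrite mulrC ler_wpM2l ?gauss_ge0 ?lerDl.
Qed.

Lemma sums_scale (I : choiceType) (x : I -> T) s (c : X) : sums G x s ->
  sums G (fun j => c *: x j) (c *: s).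
Proof.
move=> /(@sums_mull _ _ _ (c%:A)); rewrite mulr_algl; apply: sums_ext => j.
by rewrite mulr_algl.
Qed.

Lemma sums_scalel (I : choiceType) (x : I -> X) s (f : T) : sums N x s ->
  sums G (fun j => x j *: f) (s *: f).
Proof.
apply: (sums_map vabs_un gauss_un (phi := fun c => c *: f)) => [u v|e e0].
  by rewrite scalerDl.
have f1 : 0 < G f + 1 by rewrite ltr_wpDl ?gauss_ge0.
exists (e / (G f + 1)); first by rewrite divr_gt0.
move=> c; rewrite ltr_pdivlMr// => h; apply: le_lt_trans h.
by rewrite gaussZ ler_wpM2l ?vabs_ge0 ?lerDl.
Qed.

Lemma sums_mulX (I : choiceType) (x : I -> X) s (c : X) : sums N x s ->
  sums N (fun j => c * x j) (c * s).
Proof.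
move=> xs; apply: (@sums_map _ _ _ _ _ vabs_un vabs_un _ ( *%R c) x s _ _ xs) => [u v|e e0].
  by rewrite mulrDr.
have f1 : 0 < N c + 1 by rewrite ltr_wpDl ?vabs_ge0.
exists (e / (N c + 1)); first by rewrite divr_gt0.
move=> g; rewrite ltr_pdivlMr// => h; apply: le_lt_trans h.
by rewrite vabsM mulrC ler_wpM2l ?vabs_ge0 ?lerDl.
Qed.

Lemma tau_is_zmod_morphism : zmod_morphism (@tau F R X).
Proof.
move=> f g; apply: tateP => i; have := frobB 1 (tcoef f i) (tcoef g i).
by rewrite expn1.
Qed.

Lemma tau_is_monoid_morphism : monoid_morphism (@tau F R X).
Proof.
split=> [|f g]; apply: tateP => i.
  by rewrite tcoef_tau tcoef1; case: eqP => _; rewrite ?expr1n// expr0n eqn0Ngt q_gt0.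
have := frob_sum 1 (index_enum 'I_i.+1) predT (fun j => tcoef f j * tcoef g (i - j)%N).
rewrite expn1 tcoef_tau !tcoefM => ->.
by apply: eq_bigr => j _; rewrite exprMn.
Qed.

HB.instance Definition _ := GRing.isZmodMorphism.Build T T (@tau F R X)
  tau_is_zmod_morphism.
HB.instance Definition _ := GRing.isMonoidMorphism.Build T T (@tau F R X)
  tau_is_monoid_morphism.

Lemma tauZ x f : tau (x *: f) = x ^+ q *: tau f.
Proof. by apply: tateP => i; rewrite tcoef_tau !tcoefZ exprMn. Qed.

Lemma tau_chi (a : {poly F}) : tau (chi a) = chi a :> T.
Proof.
by apply: tateP => i; have := vemb_frob (X := X) 1 a`_i; rewrite expn1.
Qed.

Lemma sums_tau (I : choiceType) (x : I -> T) s : sums G x s ->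
  sums G (fun j => tau (x j)) (tau s).
Proof.
apply: (sums_map gauss_un gauss_un (phi := @tau F R X)) => [u v|e e0].
  exact: raddfD.
exists (Num.min e 1); first by rewrite lt_min e0 ltr01.
move=> g; rewrite lt_min => /andP[ge g1]; apply: le_lt_trans (gauss_tau _) _.
apply: le_lt_trans ge; have := q_gt0 (F := F); case: (q) => // k _.
by rewrite exprS ler_piMr ?gauss_ge0// exprn_ile1 ?gauss_ge0 ?ltW.
Qed.

Definition itau (k : nat) f : T := iter k (@tau F R X) f.

Lemma itau_is_zmod_morphism k : zmod_morphism (itau k).
Proof. by elim: k => [|k IH] f g //; rewrite /itau /= -!/(itau k _) IH raddfB. Qed.
Lemma itau_is_monoid_morphism k : monoid_morphism (itau k).
Proof.
elim: k => [|k [IH1 IHM]]; first by split.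
split=> [|f g]; rewrite /itau /= -!/(itau k _); first by rewrite IH1 rmorph1.
by rewrite IHM rmorphM.
Qed.
HB.instance Definition _ k := GRing.isZmodMorphism.Build T T (itau k)
  (itau_is_zmod_morphism k).
HB.instance Definition _ k := GRing.isMonoidMorphism.Build T T (itau k)
  (itau_is_monoid_morphism k).

Lemma itauS k f : itau k.+1 f = tau (itau k f). Proof. by []. Qed.
Lemma itauSr k f : itau k.+1 f = itau k (tau f). Proof. exact: iterSr. Qed.
Lemma itauD k l f : itau (k + l) f = itau k (itau l f). Proof. exact: iterD. Qed.
Lemma tcoef_itau k f i : tcoef (itau k f) i = tcoef f i ^+ (q ^ k).
Proof.
elim: k => [|k IH]; first by rewrite expn0 expr1.
by rewrite itauS tcoef_tau IH expnSr exprM.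
Qed.
Lemma itauZ k x f : itau k (x *: f) = x ^+ (q ^ k) *: itau k f.
Proof. by apply: tateP => i; rewrite tcoef_itau !tcoefZ tcoef_itau exprMn. Qed.
Lemma itau_chi k (a : {poly F}) : itau k (chi a) = chi a :> T.
Proof. by apply: tateP => i; rewrite tcoef_itau tcoef_chi vemb_frob. Qed.
Lemma sums_itau k (I : choiceType) (x : I -> T) s : sums G x s ->
  sums G (fun j => itau k (x j)) (itau k s).
Proof. by elim: k => //= k IH /IH /sums_tau. Qed.

Lemma chi_is_zmod_morphism : zmod_morphism (@chi F R X).
Proof. by move=> a b; apply: tateP => i; rewrite tcoefB !tcoef_chi coefB rmorphB. Qed.
Lemma chi_is_monoid_morphism : monoid_morphism (@chi F R X).
Proof.
split=> [|a b]; apply: tateP => i; rewrite tcoef_chi.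
  by rewrite coef1 tcoef1 rmorph_nat.
rewrite coefM tcoefM rmorph_sum; apply: eq_bigr => j _.
by rewrite /= rmorphM.
Qed.
HB.instance Definition _ := GRing.isZmodMorphism.Build {poly F} T (@chi F R X)
  chi_is_zmod_morphism.
HB.instance Definition _ := GRing.isMonoidMorphism.Build {poly F} T (@chi F R X)
  chi_is_monoid_morphism.

Lemma chiC (c : F) : chi c%:P = (vemb X c)%:A :> T.
Proof.
apply: tateP => i; rewrite tcoef_chi coefC tcoefA; case: eqP => //.
by rewrite rmorph0.
Qed.

Lemma is_unitM f g : is_unit f -> is_unit g -> is_unit (f * g).
Proof. by move=> [f' ff] [g' gg]; exists (f' * g'); rewrite mulrACA ff gg mulr1. Qed.
Lemma is_unitMl f g : is_unit (f * g) -> is_unit f.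
Proof. by move=> [h fgh]; exists (g * h); rewrite mulrA. Qed.
Lemma is_unit_neq0 f : is_unit f -> f != 0.
Proof.
move=> [g fg]; apply/eqP => f0; have := oner_neq0 T.
by rewrite -fg f0 mul0r eqxx.
Qed.
Lemma is_unit_tau k f : is_unit f -> is_unit (itau k f).
Proof. by move=> [g fg]; exists (itau k g); rewrite -rmorphM fg rmorph1. Qed.
Lemma is_unit_prod (I : Type) (r : seq I) (P : pred I) (f : I -> T) :
  (forall i, P i -> is_unit (f i)) -> is_unit (\prod_(i <- r | P i) f i).
Proof.
by move=> h; elim/big_ind: _ => //; [exists 1; rewrite mulr1|exact: is_unitM].
Qed.
Lemma is_unit_mulI f g h : is_unit f -> f * g = f * h -> g = h.
Proof.
by move=> [f' ff] fgh; rewrite -[g]mul1r -[h]mul1r -ff ![f * f']mulrC -!mulrA fgh.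
Qed.

End TateTheory.

(** * The local field at infinity *)

Section KinfTheory.
Context {F : finFieldType} {R : realType} {X : valuedField F R}.
Local Notation q := #|F|.
Local Notation N := (@vabs F R X).
Local Notation th := (vtheta X).
Implicit Types x y : X.

(** The ring F_q[theta, 1/theta]. Its closure is K_oo, where sums, products and inverses are easier
    to control than on the digit expansions defining [Kinf]. *)
Definition laurent_poly x := exists (p : {poly F}) k, x = Aemb X p / th ^+ k.

Definition approximable x := forall e : R, 0 < e ->
  exists2 y, laurent_poly y & N (x - y) < e.

Lemma laurent_polyE p (k m : nat) : Aemb X p / th ^+ k = Aemb X (p * 'X^m) / th ^+ (m + k).
Proof.
rewrite rmorphM rmorphXn /= AembX exprD [th ^+ m * _]mulrC -mulf_div divff ?mulr1//.
by rewrite expf_neq0// theta_neq0.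
Qed.

Lemma laurent_polyD x y : laurent_poly x -> laurent_poly y -> laurent_poly (x + y).
Proof.
move=> [p [k ->]] [r [m ->]]; exists (p * 'X^m + r * 'X^k), (m + k)%N.
by rewrite rmorphD mulrDl -laurent_polyE addnC -laurent_polyE.
Qed.

Lemma laurent_polyM x y : laurent_poly x -> laurent_poly y -> laurent_poly (x * y).
Proof.
move=> [p [k ->]] [r [m ->]]; exists (p * r), (k + m)%N.
by rewrite rmorphM exprD mulf_div.
Qed.

Lemma laurent_poly_Aemb p : laurent_poly (Aemb X p).
Proof. by exists p, 0%N; rewrite expr0 divr1. Qed.

Lemma laurent_polyN x : laurent_poly x -> laurent_poly (- x).
Proof. by move=> [p [k ->]]; exists (- p), k; rewrite rmorphN mulNr. Qed.

Lemma laurent_poly_theta (m : int) : laurent_poly (th ^ m).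
Proof.
case: m => m; first by exists 'X^m, 0%N; rewrite rmorphXn /= AembX expr0 divr1.
by exists 1, m.+1; rewrite rmorph1 div1r.
Qed.

Lemma laurent_poly_sum (I : Type) (r : seq I) (P : pred I) (x : I -> X) :
  (forall i, P i -> laurent_poly (x i)) -> laurent_poly (\sum_(i <- r | P i) x i).
Proof.
move=> h; elim/big_ind: _ => //; last by move=> *; exact: laurent_polyD.
by rewrite -(rmorph0 (Aemb X)); exact: laurent_poly_Aemb.
Qed.

Lemma approximable_laurent x : laurent_poly x -> approximable x.
Proof. by move=> h e e0; exists x => //; rewrite subrr vabs0. Qed.

Lemma approximable_lim x :
  (forall e : R, 0 < e -> exists2 y, approximable y & N (x - y) < e) -> approximable x.
Proof.
move=> h e e0; have [y hy xy] := h _ e0; have [z hz yz] := hy _ e0.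
by exists z => //; exact: (un_dist_lt vabs_un xy yz).
Qed.

Lemma approximableD x y : approximable x -> approximable y -> approximable (x + y).
Proof.
move=> hx hy e e0; have [x' lx xx] := hx _ e0; have [y' ly yy] := hy _ e0.
exists (x' + y'); first exact: laurent_polyD.
by rewrite opprD addrACA; exact: (unD_lt vabs_un).
Qed.

Lemma approximableN x : approximable x -> approximable (- x).
Proof.
move=> hx e e0; have [x' lx xx] := hx _ e0.
by exists (- x'); [exact: laurent_polyN|rewrite -opprD vabsN].
Qed.

Lemma approximable_mull x y : laurent_poly x -> approximable y -> approximable (x * y).
Proof.
move=> lx hy e e0; have x1 : 0 < N x + 1 by rewrite ltr_wpDl ?vabs_ge0.
have [y' ly yy] := hy _ (divr_gt0 e0 x1).
exists (x * y'); first exact: laurent_polyM.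
rewrite -mulrBr vabsM; move: yy; rewrite ltr_pdivlMr//; apply: le_lt_trans.
by rewrite mulrC ler_wpM2l ?vabs_ge0 ?lerDl.
Qed.

Lemma approximableM x y : approximable x -> approximable y -> approximable (x * y).
Proof.
move=> hx hy; apply: approximable_lim => e e0.
have y1 : 0 < N y + 1 by rewrite ltr_wpDl ?vabs_ge0.
have [x' lx xx] := hx _ (divr_gt0 e0 y1).
exists (x' * y); first exact: approximable_mull.
rewrite -mulrBl vabsM; move: xx; rewrite ltr_pdivlMr//; apply: le_lt_trans.
by rewrite ler_wpM2l ?vabs_ge0 ?lerDl.
Qed.

Lemma vabs_theta_int (m : int) : N (th ^ m) = q%:R ^ m.
Proof.
case: m => m; first by rewrite -exprnP vabsX vabs_theta.
by rewrite NegzE -!exprnN vabsV vabsX vabs_theta.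
Qed.

(** A nonzero element has the absolute value of any sufficiently close approximation; hence the
    value group of K_oo is generated by |theta|. *)
Lemma approximable_vabs x : approximable x -> x != 0 -> exists m : int, N x = N (th ^ m).
Proof.
move=> hx x0; have [y [p [k yE]] xy] := hx _ (vabs_neq0 x0).
have Nyx : N y = N x by exact: (un_eq vabs_un xy).
have p0 : p != 0.
  by rewrite -(Aemb_eq0 (X := X)); apply: contraNneq x0 => p0; rewrite -vabs_eq0E -Nyx yE p0 mul0r vabs0.
exists ((size p).-1%:Z - k%:Z); rewrite -Nyx yE.
rewrite vabsM vabsV vabs_Aemb// vabsX vabs_theta vabs_theta_int.
by rewrite expfzDr ?qR_neq0// -exprnN.
Qed.

(** The residue field of K_oo is F_q: the digit is the coefficient of theta^k in the numerator p of
    an approximation p / theta^k, and p has size at most k + 1. *)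
Lemma approximable_step x : approximable x -> N x <= 1 ->
  exists c : F, N (x - vemb X c) <= q%:R^-1.
Proof.
move=> hx x1; have q1 : 0 < q%:R^-1 :> R by rewrite invr_gt0 qR_gt0.
have [y [p [k yE]] xy] := hx _ q1; exists p`_k.
apply: (un_dist_le vabs_un (ltW xy)).
have y1 : N y <= 1.
  rewrite -(subKr x y); apply: (unB_le vabs_un) => //; apply: le_trans (ltW xy) _.
  by rewrite invf_cp1 ?qR_gt0 ?qR_ge1 ?qR_gt1.
have thk : th ^+ k != 0 by rewrite expf_neq0// theta_neq0.
have Nthk : N (th ^+ k) = q%:R ^+ k by rewrite vabsX vabs_theta.
have sp : (size p <= k.+1)%N.
  have [->|p0] := eqVneq p 0; first by rewrite size_poly0.
  move: y1; rewrite yE vabsM vabsV vabs_Aemb// Nthk ler_pdivrMr ?qRX_gt0// mul1r.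
  by rewrite ler_eXn2l ?qR_gt1//; have := size_poly_gt0 p; rewrite p0; case: (size p).
have -> : y - vemb X p`_k = Aemb X (p - p`_k *: 'X^k) / th ^+ k.
  rewrite yE rmorphB mulrBl -mul_polyC rmorphM rmorphXn /= AembX AembC.
  by rewrite -mulrA divff// mulr1.
have [->|r0] := eqVneq (p - p`_k *: 'X^k) 0.
  by rewrite rmorph0 mul0r vabs0 ltW.
have sr : (size (p - p`_k *: 'X^k)%R <= k)%N.
  apply/leq_sizeP => j kj; rewrite coefB coefZ coefXn.
  move: kj; rewrite leq_eqVlt => /orP[/eqP <-|kj].
    by rewrite eqxx mulr1 subrr.
  by rewrite gtn_eqF// mulr0 subr0; move/leq_sizeP: sp => ->.
rewrite vabsM vabsV vabs_Aemb// Nthk ler_pdivrMr ?qRX_gt0//.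
have k0 : (0 < k)%N by apply: leq_trans sr; rewrite size_poly_gt0.
have -> : q%:R^-1 * q%:R ^+ k = q%:R ^+ k.-1 :> R.
  by rewrite -{1}(prednK k0) exprS mulKf ?qR_neq0.
by rewrite ler_eXn2l ?qR_gt1// -!subn1 leq_sub2r.
Qed.

Lemma vabs_le_theta x : exists k, N x <= q%:R ^+ k.
Proof.
exists (Num.truncn (N x)).+1; apply: le_trans (ltW (Num.Theory.truncnS_gt _)) _.
by rewrite -natrX ler_nat; apply: ltnW; apply: ltn_expl; exact: q_gt1.
Qed.

(** Digits are extracted one at a time: x is scaled into the unit ball, its residue is removed, and
    the remainder, of absolute value at most 1/q, is multiplied by theta. *)
Lemma KinfP x : Kinf x <-> approximable x.
Proof.
split.
  move=> [M [c /cvgrPdist_lt xc]] e /xc[n _ /(_ n (leqnn n))] /=.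
  rewrite sub0r normrN ger0_norm ?vabs_ge0// (unC vabs_un) => h.
  exists (\sum_(i < n) vemb X (c i) * th ^ (M - i%:Z)) => //.
  apply: laurent_poly_sum => i _; apply: laurent_polyM; last exact: laurent_poly_theta.
  by rewrite -AembC; exact: laurent_poly_Aemb.
move=> hx; have [k xk] := vabs_le_theta x.
have thn : forall k, th ^+ k != 0 by move=> j; rewrite expf_neq0// theta_neq0.
have /choice[c hc] (y : X) : exists c : F, approximable y -> N y <= 1 ->
    N (y - vemb X c) <= q%:R^-1.
  have [h|h] := pselect (approximable y /\ N y <= 1).
    by have [c hc] := approximable_step h.1 h.2; exists c.
  by exists 0 => h1 h2; case: h.
pose xs (i : nat) := iter i (fun y => (y - vemb X (c y)) * th) (x / th ^+ k).
have xsP i : approximable (xs i) /\ N (xs i) <= 1.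
  elim: i => [|i [IH1 IH2]] /=.
    rewrite mulrC; split.
      by apply: approximable_mull => //; exists 1, k; rewrite rmorph1 mul1r.
    by rewrite vabsM vabsV vabsX vabs_theta mulrC ler_pdivrMr ?qRX_gt0// mul1r.
  split.
    rewrite mulrC; apply: approximable_mull.
      by have := laurent_poly_theta 1; rewrite expr1z.
    apply: approximableD => //; apply: approximableN; apply: approximable_laurent.
    by rewrite -AembC; exact: laurent_poly_Aemb.
  rewrite vabsM vabs_theta; apply: le_trans (_ : q%:R^-1 * q%:R <= _).
    by rewrite ler_wpM2r ?ler0n// hc.
  by rewrite mulVf ?qR_neq0.
exists k%:Z, (fun i => c (xs i)); apply/cvgrPdist_lt => e e0.
have [n0 hn0] := @qRV_small F R (e / q%:R ^+ k) (divr_gt0 e0 (qRX_gt0 _)).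
exists n0 => // n /= n0n; rewrite sub0r normrN ger0_norm ?vabs_ge0// (unC vabs_un).
have -> : x - \sum_(i < n) vemb X (c (xs i)) * th ^ (k%:Z - i%:Z) =
    th ^+ k * (xs n / th ^+ n).
  elim: n {n0n} => [|n IH].
    by rewrite big_ord0 subr0 expr0 divr1 /= mulrC divfK.
  rewrite big_ord_recr /= opprD addrA IH expfzDr ?theta_neq0//.
  rewrite -exprnN -exprnP.
  rewrite exprSr; set y := xs n.
  by field; rewrite thn theta_neq0.
rewrite vabsM vabsX vabs_theta vabsM vabsV vabsX vabs_theta.
move: hn0; rewrite ltr_pdivlMr ?qRX_gt0// mulrC; apply: le_lt_trans.
apply: ler_wpM2l; first by rewrite exprn_ge0 ?ler0n.
apply: le_trans (_ : q%:R ^- n <= _).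
  by apply: ler_piMl; [rewrite invr_ge0 exprn_ge0 ?ler0n|case: (xsP n)].
by rewrite lef_pV2 ?posrE ?qRX_gt0// ler_eXn2l ?qR_gt1.
Qed.

Lemma KinfD x y : Kinf x -> Kinf y -> Kinf (x + y).
Proof. by move=> /KinfP ? /KinfP ?; apply/KinfP/approximableD. Qed.
Lemma KinfN x : Kinf x -> Kinf (- x).
Proof. by move=> /KinfP ?; apply/KinfP/approximableN. Qed.
Lemma KinfM x y : Kinf x -> Kinf y -> Kinf (x * y).
Proof. by move=> /KinfP ? /KinfP ?; apply/KinfP/approximableM. Qed.
Lemma Kinf_Aemb p : Kinf (Aemb X p).
Proof. by apply/KinfP/approximable_laurent/laurent_poly_Aemb. Qed.
Lemma Kinf_theta (m : int) : Kinf (th ^ m).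
Proof. by apply/KinfP/approximable_laurent/laurent_poly_theta. Qed.
Lemma Kinf_sum (I : Type) (r : seq I) (P : pred I) (x : I -> X) :
  (forall i, P i -> Kinf (x i)) -> Kinf (\sum_(i <- r | P i) x i).
Proof.
move=> h; elim/big_ind: _ => //; [exact: Kinf0|by move=> *; exact: KinfD].
Qed.
Lemma Kinf_lim x : (forall e : R, 0 < e -> exists2 y, Kinf y & N (x - y) < e) -> Kinf x.
Proof.
move=> h; apply/KinfP/approximable_lim => e /h[y /KinfP hy xy].
by exists y.
Qed.
Lemma Kinf_vabs x : Kinf x -> x != 0 -> exists m : int, N x = N (th ^ m).
Proof. by move=> /KinfP; exact: approximable_vabs. Qed.

(** A nonzero element is theta^m c (1 - ep) with c a nonzero constant and |ep| <= 1/q; the last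
    factor is inverted by the geometric series. *)
Lemma KinfV x : Kinf x -> Kinf x^-1.
Proof.
move=> hx; have [->|x0] := eqVneq x 0; first by rewrite invr0; exact: Kinf0.
have [m xm] := Kinf_vabs hx x0.
have tm : th ^ m != 0 by rewrite expfz_neq0// theta_neq0.
have hy : Kinf (x / th ^ m) by rewrite invr_expz; apply: KinfM => //; exact: Kinf_theta.
have Ny : N (x / th ^ m) = 1 by rewrite vabsM vabsV -xm divff// vabs_eq0E.
have Ny1 : N (x / th ^ m) <= 1 by rewrite Ny.
have [c hc] := approximable_step (proj1 (KinfP _) hy) Ny1.
have q1 : q%:R^-1 < 1 :> R by rewrite invf_cp1 ?qR_gt0 ?qR_ge1 ?qR_gt1.
have Nc : N (vemb X c) = 1.
  by rewrite -Ny; apply: (un_eq vabs_un); rewrite Ny; exact: le_lt_trans q1.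
have c0 : vemb X c != 0 by rewrite -vabs_eq0E Nc oner_neq0.
pose ep := 1 - x / th ^ m / vemb X c.
have Nep : N ep <= q%:R^-1.
  rewrite /ep -(divff c0) -mulrBl vabsM vabsV Nc invr1 mulr1 (unC vabs_un)//.
have Kc : Kinf (vemb X c)^-1.
  by rewrite -fmorphV -AembC; exact: Kinf_Aemb.
have Kep : Kinf ep.
  by apply: KinfD; [exact: Kinf1|apply: KinfN; exact: KinfM].
have xE : x = th ^ m * vemb X c * (1 - ep).
  rewrite /ep subKr -mulrA [_ * (x / _ / _)]mulrC divfK// mulrC divfK//.
have ep1 : 1 - ep != 0 by apply: contraNneq x0 => e0; rewrite xE e0 mulr0.
have Nep1 : N (1 - ep) = 1.
  rewrite -(vabs1 (X := X)); apply: (un_eq vabs_un).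
  by rewrite subKr vabs1; exact: le_lt_trans q1.
rewrite xE !invfM; apply: KinfM; first apply: KinfM => //.
  by rewrite invr_expz; exact: Kinf_theta.
apply: Kinf_lim => e e0; have [k hk] := @qRV_small F R e e0.
exists (\sum_(i < k) ep ^+ i).
  apply: Kinf_sum => i _; elim: (nat_of_ord i) => [|j IH]; first exact: Kinf1.
  by rewrite exprS; exact: KinfM.
have -> : (1 - ep)^-1 - \sum_(i < k) ep ^+ i = ep ^+ k / (1 - ep).
  apply: (mulfI ep1); rewrite mulrBr divff// mulrCA divff// mulr1.
  have := subrXX 1 ep k; rewrite expr1n => h.
  have -> : \sum_(i < k) ep ^+ i = \sum_(i < k) 1 ^+ (k.-1 - i) * ep ^+ i.
    by apply: eq_bigr => i _; rewrite expr1n mul1r.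
  by rewrite -h subKr.
rewrite vabsM vabsV Nep1 invr1 mulr1 vabsX; apply: le_lt_trans hk.
by rewrite -exprVn lerXn2r ?nnegrE ?vabs_ge0 ?invr_ge0 ?ler0n.
Qed.

Lemma Kinf_theta_mul (m : int) x : Kinf x -> Kinf (th ^ m * x).
Proof. by move=> hx; apply: KinfM => //; exact: Kinf_theta. Qed.

End KinfTheory.

(** * Linear algebra over K_oo *)

Section KinfField.
Context {F : finFieldType} {R : realType} {X : valuedField F R}.

Definition kinf_pred : {pred X} := fun x => `[< Kinf x >].

Lemma kinf_divring_closed : divring_closed kinf_pred.
Proof.
split=> [|x y /asboolP hx /asboolP hy|x y /asboolP hx /asboolP hy]; apply/asboolP.
- exact: Kinf1.
- by apply: KinfD => //; exact: KinfN.
- by apply: KinfM => //; exact: KinfV.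
Qed.
HB.instance Definition _ := GRing.isDivringClosed.Build X kinf_pred kinf_divring_closed.

(** K_oo as a field in its own right, which gives access to ranks and kernels of matrices over
    it. *)
Record kinfT := KinfT { kinf_val : X; kinf_valP : kinf_val \in kinf_pred }.
HB.instance Definition _ := [isSub of kinfT for kinf_val].
HB.instance Definition _ := [Choice of kinfT by <:].
HB.instance Definition _ := [SubChoice_isSubIntegralDomain of kinfT by <:].
HB.instance Definition _ := [SubIntegralDomain_isSubField of kinfT by <:].

Lemma Kinf_dependent (s : nat) (C : 'M[X]_(s.+1, s)) : (forall i j, Kinf (C i j)) ->
  exists u : 'rV[X]_s.+1, [/\ u != 0, forall i, Kinf (u 0 i) & u *m C = 0].
Proof.
move=> KC.
have KC' i j : C i j \in kinf_pred by apply/asboolP.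
pose D : 'M[kinfT]_(s.+1, s) := \matrix_(i, j) KinfT (KC' i j).
have DC : map_mx (val : kinfT -> X) D = C by apply/matrixP => i j; rewrite !mxE.
have : kermx D != 0.
  rewrite -mxrank_eq0 mxrank_ker -lt0n subn_gt0 ltnS; exact: rank_leq_col.
move=> /rowV0Pn[v /sub_kermxP vD v0]; exists (map_mx (val : kinfT -> X) v); split.
- by rewrite map_mx_eq0.
- by move=> i; rewrite mxE; apply/asboolP; exact: kinf_valP.
- by rewrite -DC -map_mxM vD map_mx0.
Qed.

End KinfField.

(** * Lattices attached to points of the period domain *)

Section PeriodDomain.
Context {F : finFieldType} {R : realType} {X : valuedField F R}.
Context (hX : vcomplete X).
Local Notation q := #|F|.
Local Notation N := (@vabs F R X).

Lemma Kinf_limit (u : nat -> X) : (forall k, Kinf (u k)) ->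
  (forall e : R, 0 < e -> exists n0 : nat, forall m n : nat,
     (n0 <= m)%N -> (n0 <= n)%N -> N (u m - u n) < e) ->
  exists2 l, Kinf l & forall e : R, 0 < e -> exists n0 : nat, forall n,
     (n0 <= n)%N -> N (l - u n) < e.
Proof.
move=> Ku cu; have [l hl] := vabs_ucomplete hX cu; exists l => //.
apply: Kinf_lim => e /hl[n0 h]; exists (u n0) => //; exact: h.
Qed.

(** Equivalence of norms on a finite-dimensional space over the complete field K_oo; it makes the
    imaginary part positive on the period domain. *)
Lemma independent_lower_bound (n : nat) (z : nat -> X) :
  (forall c : nat -> X, (forall i, Kinf (c i)) -> \sum_(i < n) c i * z i = 0 ->
     forall i, (i < n)%N -> c i = 0) ->
  exists2 d : R, 0 < d & forall c : nat -> X, (forall i, Kinf (c i)) ->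
     forall i, (i < n)%N -> d * N (c i) <= N (\sum_(i < n) c i * z i).
Proof.
elim: n => [|n IH] ind; first by exists 1.
have [|d d0 hd] := IH.
  move=> c Kc c0 i ni; pose c' j := if (j < n)%N then c j else 0.
  have Kc' j : Kinf (c' j) by rewrite /c'; case: ifP => _ //; exact: Kinf0.
  have := ind c' Kc'; rewrite big_ord_recr /= {2}/c' ltnn mul0r addr0.
  rewrite (eq_bigr (fun i : 'I_n => c i * z i)); last by move=> j _; rewrite /c' ltn_ord.
  by move=> /(_ c0 i (leqW ni)); rewrite /c' ni.
have [[eta eta0 heta]|none] := pselect (exists2 eta : R, 0 < eta &
    forall c : nat -> X, (forall i, Kinf (c i)) ->
    eta <= N (z n - \sum_(i < n) c i * z i)); last first.
  (* If [z n] were a limit of combinations of the previous [z i], the bound for n would make the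
     coefficients Cauchy, and their limits would give a forbidden relation. *)
  exfalso.
  have ex (k : nat) : exists c : nat -> X, (forall i, Kinf (c i)) /\
      N (z n - \sum_(i < n) c i * z i) < q%:R ^- k.
    apply: contrapT => nc; apply: none; exists (q%:R ^- k).
      by rewrite invr_gt0 qRX_gt0.
    by move=> c Kc; rewrite leNgt; apply/negP => h; apply: nc; exists c.
  have [c hc] := choice ex.
  have small (e : R) : 0 < e -> exists n0 : nat, forall k, (n0 <= k)%N ->
      N (z n - \sum_(i < n) c k i * z i) < e.
    move=> e0; have [n0 h0] := @qRV_small F R _ e0; exists n0 => k nk.
    apply: lt_trans (hc k).2 _; apply: le_lt_trans h0.
    by rewrite lef_pV2 ?posrE ?qRX_gt0// ler_eXn2l ?qR_gt1.
  have cauchy i : (i < n)%N -> forall e : R, 0 < e -> exists n0 : nat, forall m k : nat,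
      (n0 <= m)%N -> (n0 <= k)%N -> N (c m i - c k i) < e.
    move=> ni e e0; have [n0 h0] := small _ (mulr_gt0 d0 e0); exists n0 => m k nm nk.
    rewrite -(ltr_pM2l d0); have := hd (fun i => c m i - c k i).
    move=> /(_ (fun i => KinfD ((hc m).1 i) (KinfN ((hc k).1 i))) i ni).
    move=> /le_lt_trans; apply; rewrite (eq_bigr (fun i : 'I_n => c m i * z i - c k i * z i)).
      rewrite sumrB; apply: (un_dist_lt vabs_un (y := z n)); last exact: h0.
      by rewrite (unC vabs_un); exact: h0.
    by move=> j _; rewrite mulrBl.
  have /choice[l hl] (i : nat) : exists l, Kinf l /\ ((i < n)%N ->
      forall e : R, 0 < e -> exists n0 : nat, forall k, (n0 <= k)%N -> N (l - c k i) < e).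
    have [ni|ni] := ltnP i n; last by exists 0; split => //; exact: Kinf0.
    have [l Kl hl] := Kinf_limit (fun k => (hc k).1 i) (cauchy i ni).
    by exists l.
  have zn : z n = \sum_(i < n) l i * z i.
    apply/eqP; rewrite -subr_eq0; apply/eqP/(un_eq0_lt vabs_un) => e e0.
    have [n0 h0] := small _ e0.
    pose M := 1 + \sum_(i < n) N (z i).
    have M0 : 0 < M by rewrite ltr_pwDl// sumr_ge0// => i _; exact: vabs_ge0.
    have MN (i : 'I_n) : N (z i) <= M.
      rewrite /M (bigD1 i)//= addrCA lerDl addr_ge0 ?ler01 ?sumr_ge0// => j _.
      exact: vabs_ge0.
    have /choice[m hm] (i : 'I_n) := (hl i).2 (ltn_ord i) _ (divr_gt0 e0 M0).
    pose k := maxn n0 (\max_(i < n) m i).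
    apply: (un_dist_lt vabs_un (y := \sum_(i < n) c k i * z i)).
      by apply: h0; exact: leq_maxl.
    rewrite -sumrB; apply: (un_sum_lt vabs_un) => // i _.
    rewrite -mulrBl vabsM (unC vabs_un); apply: le_lt_trans (_ : N (l i - c k i) * M < _).
      by rewrite ler_wpM2l ?vabs_ge0.
    rewrite -ltr_pdivlMr// hm// /k leq_max; apply/orP; right.
    exact: (leq_bigmax (F := m)).
  pose c' j := if (j < n)%N then l j else if j == n then -1 else 0.
  have Kc' j : Kinf (c' j).
    rewrite /c'; case: ifP => _; first by case: (hl j).
    by case: ifP => _; [apply: KinfN; exact: Kinf1|exact: Kinf0].
  have := ind c' Kc'; rewrite big_ord_recr /= {2}/c' ltnn eqxx.
  rewrite (eq_bigr (fun i : 'I_n => l i * z i)); last by move=> j _; rewrite /c' ltn_ord.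
  rewrite -zn mulN1r subrr => /(_ erefl n (leqnn _)); rewrite /c' ltnn eqxx => /eqP.
  by rewrite oppr_eq0 oner_eq0.
(* The last coefficient is controlled by the whole sum through [eta]; removing the last term costs a
   factor |z n| / eta, which B absorbs before the induction bound is applied to the others. *)
pose B := Num.max 1 (N (z n) / eta).
have B1 : 1 <= B by rewrite le_max lexx.
have B0 : 0 < B by exact: lt_le_trans B1.
exists (Num.min eta (d / B)); first by rewrite lt_min eta0 divr_gt0.
move=> c Kc i ni; rewrite big_ord_recr /=.
set v := \sum_(i < n) _; set t := v + _.
have hn : eta * N (c n) <= N t.
  have [->|cn0] := eqVneq (c n) 0; first by rewrite vabs0 mulr0 vabs_ge0.
  have -> : t = c n * (z n - \sum_(i < n) (- c i / c n) * z i).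
    rewrite mulrBr mulr_sumr /t addrC; congr (_ + _).
    by rewrite /v -sumrN; apply: eq_bigr => j _; field.
  rewrite vabsM [leLHS]mulrC; apply: (ler_wpM2l (vabs_ge0 (c n))).
  apply: (heta (fun i => - c i / c n)) => j.
  by apply: KinfM; [exact: KinfN|exact: KinfV].
have [ni'|] := ltnP i n; last first.
  move=> ni'; have -> : i = n by apply/eqP; rewrite eqn_leq -ltnS ni.
  by apply: le_trans hn; rewrite ler_wpM2r ?vabs_ge0// ge_min lexx.
apply: le_trans (_ : d / B * N (c i) <= _).
  by rewrite ler_wpM2r ?vabs_ge0// ge_min lexx orbT.
rewrite mulrAC ler_pdivrMr//; apply: le_trans (hd c Kc i ni') _; rewrite -/v.
rewrite -(addrK (c n * z n) v) -/t; apply: (unB_le vabs_un).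
  by rewrite ler_peMr ?vabs_ge0.
rewrite vabsM; apply: le_trans (_ : N t * (N (z n) / eta) <= _).
  rewrite mulrA ler_pdivlMr// mulrAC ler_wpM2r ?vabs_ge0// mulrC//.
by rewrite ler_wpM2l ?vabs_ge0// le_max lexx orbT.
Qed.

End PeriodDomain.

(** * Finite boxes of polynomial vectors *)

Section Boxes.
Context {F : finFieldType}.
Local Notation A := {poly F}.

(** Sizes, not degrees: the value is 0 on the zero vector and otherwise one more than the largest
    degree, whence the exponents [(cdeg a).-1] below. *)
Definition cdeg (s : nat) (a : 'cV[A]_s) : nat := \max_i size (a i 0%R).

(** Coefficient matrices form a finite F-vector space, so that finite parts of the lattice, and
    residues modulo a polynomial, are indexed by a finite additive group. *)
Definition of_coefs (s d : nat) (m : 'M[F]_(s, d)) : 'cV[A]_s :=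
  \col_i rVpoly (row i m).

Lemma of_coefsD s d : {morph @of_coefs s d : m m' / m + m'}.
Proof. by move=> m m'; apply/matrixP => i j; rewrite !mxE linearD /= linearD. Qed.

Lemma of_coefsN s d : {morph @of_coefs s d : m / - m}.
Proof. by move=> m; apply/matrixP => i j; rewrite !mxE linearN /= linearN. Qed.

Lemma of_coefsZ s d (c : F) (m : 'M[F]_(s, d)) : of_coefs (c *: m) = c%:P *: of_coefs m.
Proof. by apply/matrixP => i j; rewrite !mxE linearZ /= linearZ /= mul_polyC. Qed.

Lemma of_coefs0 s d : of_coefs (0 : 'M[F]_(s, d)) = 0.
Proof. by apply/matrixP => i j; rewrite !mxE linear0 linear0. Qed.

Lemma of_coefs_inj s d : injective (@of_coefs s d).
Proof.
move=> m m' /matrixP mm; apply/row_matrixP => i; apply: (can_inj rVpolyK).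
by have := mm i 0; rewrite !mxE.
Qed.

Lemma cdeg_of_coefs s d (m : 'M[F]_(s, d)) : (cdeg (of_coefs m) <= d)%N.
Proof. by apply/bigmax_leqP => i _; rewrite mxE size_poly. Qed.

Lemma of_coefs_surj s d (a : 'cV[A]_s) : (cdeg a <= d)%N -> exists m : 'M[F]_(s, d), a = of_coefs m.
Proof.
move=> /bigmax_leqP ad; exists (\matrix_i poly_rV (a i 0)).
apply/matrixP => i j; rewrite !mxE ord1 rowK poly_rV_K//; exact: ad.
Qed.

Lemma size_cdeg s (a : 'cV[A]_s) i : (size (a i 0%R) <= cdeg a)%N.
Proof. exact: (leq_bigmax (F := fun i => size (a i 0%R))). Qed.

Lemma cdeg_gt0 s (a : 'cV[A]_s) : a != 0 -> (0 < cdeg a)%N.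
Proof.
apply: contraNT; rewrite -leqNgt leqn0 => /eqP a0; apply/eqP/matrixP => i j.
rewrite ord1 mxE; apply/eqP; rewrite -size_poly_eq0 -leqn0.
by apply: leq_trans (size_cdeg a i) _; rewrite a0.
Qed.

Lemma cdeg_max s (a : 'cV[A]_s) : a != 0 -> exists i, cdeg a = size (a i 0%R).
Proof.
move=> a0; have := cdeg_gt0 a0; rewrite /cdeg; case: s => [|s] in a a0 *.
  by rewrite big_ord0.
have s0 : (0 < #|'I_s.+1|)%N by rewrite card_ord.
by move=> _; have [i ->] := @bigop.eq_bigmax _ (fun i => size (a i 0%R)) s0; exists i.
Qed.

Definition box (s d : nat) : {fset 'cV[A]_s} :=
  [fset a in [seq of_coefs m | m : 'M[F]_(s, d)]]%fset.

Lemma in_box s d (a : 'cV[A]_s) : (a \in box s d) = (cdeg a <= d)%N.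
Proof.
rewrite inE; apply/mapP/idP => [[m _ ->]|/of_coefs_surj[m ->]].
  exact: cdeg_of_coefs.
by exists m => //; rewrite mem_enum.
Qed.

Lemma big_box (V : Type) (idx : V) (op : Monoid.com_law idx) s d (P : pred 'cV[A]_s)
    (f : 'cV[A]_s -> V) :
  \big[op/idx]_(a <- box s d | P a) f a =
  \big[op/idx]_(m : 'M[F]_(s, d) | P (of_coefs m)) f (of_coefs m).
Proof.
rewrite (perm_big [seq of_coefs m | m : 'M[F]_(s, d)]).
  by rewrite big_map big_enum_cond.
apply: uniq_perm; rewrite ?fset_uniq//.
  by rewrite map_inj_uniq ?enum_uniq//; exact: of_coefs_inj.
by move=> a; rewrite !inE.
Qed.

Lemma null_cdeg (R : realType) (V : zmodType) (N : V -> R) s (x : 'cV[A]_s -> V) :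
  (forall e, 0 < e -> exists d, forall a, (d < cdeg a)%N -> N (x a) < e) ->
  nullfam N x.
Proof.
move=> h e /h[d hd]; exists (box s d) => a; rewrite in_box -ltnNge; exact: hd.
Qed.

Definition pbox (d : nat) : {fset A} := [fset a in [seq rVpoly m | m : 'rV[F]_d]]%fset.

Lemma in_pbox d (a : A) : (a \in pbox d) = (size a <= d)%N.
Proof.
rewrite inE; apply/mapP/idP => [[m _ ->]|ad]; first exact: size_poly.
by exists (poly_rV a); rewrite ?mem_enum ?poly_rV_K.
Qed.

End Boxes.

(** * Imaginary part and points of the period domain *)

Section OmegaTheory.
Context {F : finFieldType} {R : realType} {X : valuedField F R}.
Context (hX : vcomplete X).
Local Notation q := #|F|.
Local Notation N := (@vabs F R X).
Local Notation th := (vtheta X).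
Local Notation A := {poly F}.

Definition zdot (n : nat) (z : 'rV[X]_n.+1) (a : 'cV[A]_n.+1) : X :=
  (z *m map_mx (Aemb X) a) 0 0.

Lemma zdotE n (z : 'rV[X]_n.+1) a : zdot z a = \sum_i z 0 i * Aemb X (a i 0).
Proof. by rewrite /zdot mxE; apply: eq_bigr => i _; rewrite mxE. Qed.
Lemma zdotD n (z : 'rV[X]_n.+1) : {morph zdot z : a b / a + b}.
Proof. by move=> a b; rewrite /zdot map_mxD mulmxDr mxE. Qed.
Lemma zdotN n (z : 'rV[X]_n.+1) : {morph zdot z : a / - a}.
Proof. by move=> a; rewrite /zdot map_mxN mulmxN mxE. Qed.
Lemma zdotB n (z : 'rV[X]_n.+1) : {morph zdot z : a b / a - b}.
Proof. by move=> a b; rewrite zdotD zdotN. Qed.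
Lemma zdot0 n (z : 'rV[X]_n.+1) : zdot z 0 = 0.
Proof. by rewrite /zdot map_mx0 mulmx0 mxE. Qed.
Lemma zdotZ n (z : 'rV[X]_n.+1) p a : zdot z (p *: a) = Aemb X p * zdot z a.
Proof. by rewrite /zdot map_mxZ -scalemxAr mxE. Qed.
Lemma zdot_lattice n (z : 'rV[X]_n.+1) a : lattice z (zdot z a).
Proof. by exists a. Qed.

Lemma imag_has_inf n (z : 'rV[X]_n.+1) :
  has_inf [set N ((z *m eta) 0 0) | eta in @unimodular F R X n].
Proof.
split; last by exists 0 => _ [eta _ <-]; exact: vabs_ge0.
exists (N ((z *m delta_mx ord_max (0 : 'I_1)) 0 0)).
exists (delta_mx ord_max 0) => //; split.
- by move=> i; rewrite mxE andbT; case: eqP => _; [exact: Kinf1|exact: Kinf0].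
- by move=> i; rewrite mxE andbT; case: eqP => _; rewrite ?vabs1 ?vabs0 ?ler01.
- by exists ord_max; rewrite mxE !eqxx vabs1.
Qed.

Lemma imag_gt0 n (z : 'rV[X]_n.+1) : Omega z -> 0 < imag z.
Proof.
move=> [_ ind].
have [|d d0 hd] := @independent_lower_bound F R X hX n.+1 (fun i => z 0 (inord i)).
  move=> c Kc c0 i ni; have := ind (\col_i c i).
  move=> /(_ (fun i => _)) h; have Kc' (j : 'I_n.+1) : Kinf ((\col_i c i : 'cV[X]_n.+1) j 0).
    by rewrite mxE.
  have := ind _ Kc'; have -> : z *m \col_i c i = 0.
    apply/matrixP => j k; rewrite !ord1 !mxE -[RHS]c0; apply: eq_bigr => l _.
    by rewrite mxE inord_val mulrC.
  by move=> /(_ erefl)/matrixP/(_ (inord i) 0); rewrite !mxE inordK.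
apply: lt_le_trans d0 _; apply: lb_le_inf; first by case: (imag_has_inf z).
move=> _ [eta [Keta _ [j etaj]] <-].
have Kc i : Kinf (eta (inord i) (0 : 'I_1)) by exact: Keta.
have := hd (fun i => eta (inord i) 0) Kc j (ltn_ord j).
rewrite inord_val etaj mulr1 => /le_trans; apply.
rewrite le_eqVlt mxE; apply/orP; left; apply/eqP; congr (N _); apply: eq_bigr => i _.
by rewrite inord_val mulrC.
Qed.

(** Homogeneous form of the infimum: the value group of K_oo being generated by |theta|, dividing a
    nonzero c by a power of theta makes it unimodular. *)
Lemma imag_le n (z : 'rV[X]_n.+1) (c : 'cV[X]_n.+1) i : (forall i, Kinf (c i 0)) ->
  imag z * N (c i 0) <= N ((z *m c) 0 0).
Proof.
move=> Kc; have [j _ hj] := arg_maxP (fun i => N (c i 0)) (erefl (xpredT i)).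
have i0 : 0 <= imag z.
  apply: lb_le_inf; first by case: (imag_has_inf z).
  by move=> _ [eta _ <-]; exact: vabs_ge0.
have [cj0|cj0] := eqVneq (c j 0) 0.
  have -> : N (c i 0) = 0.
    by apply/eqP; rewrite eq_le vabs_ge0 andbT; have := hj i isT; rewrite cj0 vabs0.
  by rewrite mulr0 vabs_ge0.
have [m hm] := Kinf_vabs (Kc j) cj0.
have tm : th ^ m != 0 by rewrite expfz_neq0// theta_neq0.
have Ntm : 0 < N (th ^ m) by rewrite vabs_gt0.
apply: le_trans (_ : imag z * N (c j 0) <= _).
  by apply: (ler_wpM2l i0); exact: hj.
rewrite hm -ler_pdivlMr// -vabsV -vabsM mulrC; apply: ge_inf; first by case: (imag_has_inf z).
exists ((th ^ m)^-1 *: c); last by rewrite -scalemxAr mxE.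
split.
- by move=> k; rewrite mxE invr_expz; exact: Kinf_theta_mul.
- by move=> k; rewrite mxE vabsM vabsV mulrC ler_pdivrMr// mul1r -hm; exact: hj.
- by exists j; rewrite mxE vabsM vabsV hm mulVf// vabs_eq0E.
Qed.

Lemma zdot_ge n (z : 'rV[X]_n.+1) a : a != 0 ->
  imag z * q%:R ^+ (cdeg a).-1 <= N (zdot z a).
Proof.
move=> a0; have [i ai] := cdeg_max a0.
have ai0 : a i 0 != 0 by rewrite -size_poly_gt0 -ai cdeg_gt0.
have Ka j : Kinf ((map_mx (Aemb X) a) j 0) by rewrite mxE; exact: Kinf_Aemb.
by have := imag_le z i Ka; rewrite mxE vabs_Aemb// ai.
Qed.

Lemma zdot_eq0 n (z : 'rV[X]_n.+1) a : Omega z -> (zdot z a == 0) = (a == 0).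
Proof.
move=> Oz; apply/eqP/eqP => [az|->]; last exact: zdot0.
apply/eqP; apply: contraT => a0; have := zdot_ge z a0; rewrite az vabs0 leNgt.
by rewrite mulr_gt0 ?imag_gt0 ?qRX_gt0.
Qed.

Lemma zdot_inj n (z : 'rV[X]_n.+1) : Omega z -> injective (zdot z).
Proof.
by move=> Oz a b /eqP; rewrite -subr_eq0 -zdotB zdot_eq0// subr_eq0 => /eqP.
Qed.

Lemma vnorm_ge n (z : 'rV[X]_n.+1) i : N (z 0 i) <= vnorm z.
Proof. exact: (le_bigmax _ (fun i => N (z 0 i))). Qed.

Lemma vnorm_ge1 n (z : 'rV[X]_n.+1) : Omega z -> 1 <= vnorm z.
Proof. by move=> [z1 _]; rewrite -(vabs1 (X := X)) -z1 vnorm_ge. Qed.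

Lemma dot_le n (z : 'rV[X]_n.+1) (c : 'cV[X]_n.+1) M : 0 <= M -> (forall i, N (c i 0) <= M) ->
  N ((z *m c) 0 0) <= vnorm z * M.
Proof.
have v0 : 0 <= vnorm z by apply: le_trans (vabs_ge0 _) (vnorm_ge z 0).
move=> M0 h; rewrite mxE; apply: (un_sum_le vabs_un) => [|i _].
  by rewrite mulr_ge0.
by rewrite vabsM ler_pM ?vabs_ge0 ?vnorm_ge.
Qed.

Lemma dotZ n (z : 'rV[X]_n.+1) x (c : 'cV[X]_n.+1) :
  (z *m (x *: c)) 0 0 = x * (z *m c) 0 0.
Proof. by rewrite -scalemxAr mxE. Qed.
Lemma dotN n (z : 'rV[X]_n.+1) (c : 'cV[X]_n.+1) : (z *m - c) 0 0 = - (z *m c) 0 0.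
Proof. by rewrite mulmxN mxE. Qed.

(** Inverse of the splitting of z into z_r and [ztilde z]: the new entry z_r goes in front, at index
    [ord0]. *)
Definition rcons_row (n : nat) (y : X) (z : 'rV[X]_n.+1) : 'rV[X]_n.+2 :=
  \row_i (if unlift ord0 i is Some j then z 0 j else y).

Lemma rcons_row0 n y (z : 'rV[X]_n.+1) : rcons_row y z 0 ord0 = y.
Proof. by rewrite mxE unlift_none. Qed.
Lemma ztilde_rcons n y (z : 'rV[X]_n.+1) : ztilde (rcons_row y z) = z.
Proof. by apply/rowP => j; rewrite !mxE liftK. Qed.

Lemma dot_recl n (z : 'rV[X]_n.+2) (c : 'cV[X]_n.+2) :
  (z *m c) 0 0 = z 0 ord0 * c ord0 0 + (ztilde z *m row' ord0 c) 0 0.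
Proof.
rewrite mxE big_ord_recl mxE; congr (_ + _); apply: eq_bigr => i _.
by rewrite !mxE.
Qed.

Lemma Omega_ztilde n (z : 'rV[X]_n.+2) : Omega z -> Omega (ztilde z).
Proof.
move=> [z1 ind]; split.
  by rewrite mxE -z1; congr (z _ _); apply/val_inj.
move=> c Kc zc; pose c' : 'cV[X]_n.+2 := \col_i (if unlift ord0 i is Some j then c j 0 else 0).
have c'0 : c' = 0.
  apply: ind => [i|].
    by rewrite mxE; case: (unlift _ _) => [j|]; [exact: Kc|exact: Kinf0].
  apply/matrixP => i j; rewrite !ord1 dot_recl mxE unlift_none mulr0 add0r.
  suff -> : row' ord0 c' = c by rewrite zc !mxE.
  by apply/matrixP => k l; rewrite !mxE liftK ord1.
apply/matrixP => i j; have /matrixP/(_ (lift ord0 i) 0) := c'0.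
by rewrite !mxE liftK ord1.
Qed.

Lemma Omega_rcons n y (z : 'rV[X]_n.+1) : Omega z ->
  (forall c : 'cV[X]_n.+1, (forall i, Kinf (c i 0)) -> y <> (z *m c) 0 0) ->
  Omega (rcons_row y z).
Proof.
move=> [z1 ind] hy; split.
  rewrite mxE; case: unliftP => [j /(congr1 val) /=|/(congr1 val)//].
  by rewrite /bump /= add1n => -[jn]; rewrite -z1; congr (z _ _); exact/val_inj.
move=> c Kc /matrixP/(_ 0 0); rewrite dot_recl ztilde_rcons rcons_row0 [X in _ = X]mxE => h.
have Kc' i : Kinf ((row' ord0 c) i 0) by rewrite mxE.
have c0 : c ord0 0 = 0.
  apply/eqP; apply: contraT => c0; case: (hy (- (c ord0 0)^-1 *: row' ord0 c)).
    by move=> i; rewrite mxE; apply: KinfM => //; apply: KinfN; exact: KinfV.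
  rewrite -scalemxAr mxE; apply: (mulIf c0); rewrite mulrAC mulNr mulVf// mulN1r.
  by apply/eqP; rewrite -addr_eq0 h.
have := ind _ Kc'; move: h; rewrite c0 mulr0 add0r => h.
have -> : z *m row' ord0 c = 0 by apply/matrixP => i j; rewrite !ord1 h mxE.
move=> /(_ erefl)/matrixP h'; apply/matrixP => i j; rewrite ord1 mxE.
have [k ->|->] := unliftP ord0 i; last exact: c0.
by have := h' k 0; rewrite !mxE.
Qed.

Lemma exists_root_theta (k : nat) : (0 < k)%N -> exists y : X, y ^+ k = th.
Proof.
move=> k0; have /closed_rootP[y] : size ('X^k - th%:P : {poly X}) != 1%N.
  by rewrite size_XnsubC// eqSS -lt0n.
by rewrite rootE !hornerE subr_eq0 => /eqP yk; exists y.
Qed.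

(* The powers of a (n+2)-th root of theta have absolute values in distinct
   classes modulo the value group of K_oo, so they span a space of dimension
   n+2 and cannot all lie in the K_oo-span of n+1 elements. *)
Lemma exists_not_in_span n (z : 'rV[X]_n.+1) : exists y : X,
  forall c : 'cV[X]_n.+1, (forall i, Kinf (c i 0)) -> y <> (z *m c) 0 0.
Proof.
apply: contrapT => none.
have span y : exists c : 'cV[X]_n.+1, (forall i, Kinf (c i 0)) /\ y = (z *m c) 0 0.
  apply: contrapT => h; apply: none; exists y => c Kc yc; apply: h; by exists c.
have [y yth] := @exists_root_theta n.+2 isT.
have /choice[c hc] (i : 'I_n.+2) := span (y ^+ i).
have [|u [u0 Ku uC]] := @Kinf_dependent F R X n.+1 (\matrix_(i, j) c i j 0).
  by move=> i j; rewrite mxE; case: (hc i) => + _; exact.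
have uy : \sum_i u 0 i * y ^+ i = 0.
  rewrite (eq_bigr (fun i => \sum_j z 0 j * (u 0 i * c i j 0))); last first.
    move=> i _; rewrite {1}(hc i).2 mxE mulr_sumr; apply: eq_bigr => j _.
    by rewrite mulrCA.
  rewrite exchange_big /= big1// => j _; rewrite -mulr_sumr.
  have /matrixP/(_ 0 j) := uC; rewrite !mxE => h.
  by rewrite [X in _ * X](_ : _ = 0) ?mulr0// -[RHS]h; apply: eq_bigr => i _; rewrite mxE.
have Ny : N y ^+ n.+2 = q%:R by rewrite -vabsX yth vabs_theta.
have y0 : y != 0.
  by apply/eqP => y0; move: Ny; rewrite y0 vabs0 expr0n /= => /esym/eqP; rewrite (negPf qR_neq0).
have vald (i j : 'I_n.+2) : u 0 i != 0 -> u 0 j != 0 -> N (u 0 i * y ^+ i) = N (u 0 j * y ^+ j) -> i = j.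
  move=> ui uj; have [a ha] := Kinf_vabs (Ku i) ui; have [b hb] := Kinf_vabs (Ku j) uj.
  move=> /(congr1 (fun r => r ^+ n.+2)); rewrite !vabsM !vabsX ha hb !vabs_theta_int.
  rewrite !exprMn [N y ^+ i ^+ _]exprAC [N y ^+ j ^+ _]exprAC Ny !exprnP !exprz_exp.
  rewrite -!expfzDr ?qR_neq0//.
  have q1 : q%:R != 1 :> R by rewrite gt_eqF// qR_gt1.
  move=> /(@ieexprIz _ _ qR_gt0 q1) h.
  have := congr1 (fun t => (t %% n.+2%:Z)%Z) h; rewrite !modzMDl.
  by rewrite !modz_nat !modn_small// => -[ij]; apply/val_inj.
have [i0 ui0] : exists i, u 0 i != 0.
  apply: contrapT => h; case/eqP: u0; apply/rowP => i; rewrite mxE; apply/eqP.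
  by apply: contrapT => /negP ui; apply: h; exists i.
have [i ui hi] := @arg_maxP _ R _ i0 (fun i => u 0 i != 0) (fun i => N (u 0 i * y ^+ i)) ui0.
have ypos : 0 < N (u 0 i * y ^+ i) by rewrite vabs_gt0 mulf_neq0// expf_neq0.
have : N (u 0 i * y ^+ i) < N (u 0 i * y ^+ i); last by rewrite ltxx.
have uE : u 0 i * y ^+ i = - \sum_(j | j != i) u 0 j * y ^+ j.
  by apply/eqP; rewrite -addr_eq0; move: uy; rewrite (bigD1 i)//= => ->.
rewrite {1}uE vabsN; apply: vabs_sum_lt => // j ji.
have [->|uj] := eqVneq (u 0 j) 0; first by rewrite mul0r vabs0.
rewrite lt_neqAle; apply/andP; split; last exact: hi.
by apply: contraNneq ji => /(vald _ _ uj ui) ->.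
Qed.

Lemma Omega_theta_rcons n y (z : 'rV[X]_n.+1) k : Omega z ->
  (forall c : 'cV[X]_n.+1, (forall i, Kinf (c i 0)) -> y <> (z *m c) 0 0) ->
  Omega (rcons_row (th ^+ k * y) z).
Proof.
move=> Oz hy; apply: Omega_rcons => // c Kc yc; case: (hy ((th ^+ k)^-1 *: c)).
  by move=> i; rewrite mxE; apply: KinfM => //; apply: KinfV; exact: (Kinf_theta k).
by rewrite -scalemxAr mxE -yc mulKf// expf_neq0// theta_neq0.
Qed.

Lemma imag_last_le n (z : 'rV[X]_n.+2) (c : 'cV[X]_n.+1) : (forall i, Kinf (c i 0)) ->
  imag_last z <= N (z 0 ord0 - (ztilde z *m c) 0 0).
Proof.
move=> Kc; apply: ge_inf; last by exists c.
by exists 0 => _ [eta _ <-]; exact: vabs_ge0.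
Qed.

Lemma le_imag_last n (z : 'rV[X]_n.+2) M :
  (forall c : 'cV[X]_n.+1, (forall i, Kinf (c i 0)) ->
    M <= N (z 0 ord0 - (ztilde z *m c) 0 0)) -> M <= imag_last z.
Proof.
move=> h; apply: lb_le_inf.
  exists (N (z 0 ord0 - (ztilde z *m (0 : 'cV_n.+1)) 0 0)); exists 0 => // i.
  by rewrite mxE; exact: Kinf0.
by move=> _ [c Kc <-]; exact: h.
Qed.

(** The K_oo-span of \tilde z is stable under theta, so multiplying a y outside it by theta^k
    multiplies the distance to the span by q^k. *)
Lemma exists_large n (z : 'rV[X]_n.+1) M : Omega z ->
  exists y, Omega (rcons_row y z) /\ M < imag_last (rcons_row y z).
Proof.
move=> Oz; have [y hy] := exists_not_in_span z.
have Oy := Omega_rcons Oz hy; have i0 := imag_gt0 Oy.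
pose d := imag (rcons_row y z).
have [k hk] := @qRV_small F R (d / (`|M| + 1)) (divr_gt0 i0 (ltr_wpDl (normr_ge0 _) ltr01)).
exists (th ^+ k * y); split; first exact: Omega_theta_rcons.
apply: lt_le_trans (_ : q%:R ^+ k * d <= _).
  move: hk; rewrite ltr_pdivlMr ?ltr_wpDl// ltr_pdivrMl ?qRX_gt0//; apply: le_lt_trans.
  by apply: le_trans (ler_norm _) _; rewrite lerDl.
apply: le_imag_last => c Kc; rewrite rcons_row0 ztilde_rcons.
have tk : th ^+ k != 0 by rewrite expf_neq0// theta_neq0.
have -> : th ^+ k * y - (z *m c) 0 0 = th ^+ k * (y - (z *m ((th ^+ k)^-1 *: c)) 0 0).
  by rewrite dotZ mulrBr mulVKf.
rewrite vabsM vabsX vabs_theta; apply: ler_wpM2l; first by rewrite exprn_ge0 ?ler0n.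
pose c' : 'cV[X]_n.+2 := \col_i (if unlift ord0 i is Some j then - (th ^+ k)^-1 * c j 0 else 1).
have Kc' i : Kinf (c' i 0).
  rewrite mxE; case: (unlift _ _) => [j|]; last exact: Kinf1.
  by apply: KinfM => //; apply/KinfN/KinfV/(Kinf_theta k).
have := imag_le (rcons_row y z) ord0 Kc'; rewrite dot_recl ztilde_rcons rcons_row0.
have -> : c' ord0 0 = 1 by rewrite mxE unlift_none.
rewrite vabs1 !mulr1.
have -> : row' ord0 c' = - ((th ^+ k)^-1 *: c).
  by apply/colP => i; rewrite !mxE liftK mulNr.
by rewrite dotN.
Qed.

Lemma Omega_nonempty n : exists z : 'rV[X]_n.+1, Omega z.
Proof.
elim: n => [|n [z Oz]]; last by have [y [Oy _]] := exists_large 0 Oz; exists (rcons_row y z).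
exists (const_mx 1); split; first by rewrite mxE.
move=> c _ /matrixP/(_ 0 0); rewrite mxE big_ord_recl big_ord0 addr0 !mxE mul1r => c0.
by apply/matrixP => i j; rewrite !ord1 c0 mxE.
Qed.

End OmegaTheory.

(** * Exponential functions of lattices *)

Lemma ncvg_nlim (R : realType) (V : zmodType) (N : V -> R) (hN : ultranorm N)
  (I : Type) (G : set_system I) (FG : ProperFilter G) (u : I -> V) (l : V) :
  ncvg N G u l -> nlim N G u = l.
Proof.
move=> ul; rewrite /nlim; case: xgetP => [l' _ /= ul'|/(_ l)//].
apply/eqP; rewrite -subr_eq0; apply/eqP/(un_eq0_lt hN) => e e0.
move: ul ul' => /cvgrPdist_lt/(_ e e0) ul /cvgrPdist_lt/(_ e e0) ul'.
near G => i.
apply: (un_dist_lt hN (y := u i)).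
  have : `|0 - N (u i - l')| < e by near: i.
  by rewrite sub0r normrN ger0_norm ?(un_ge0 hN)// (unC hN).
have : `|0 - N (u i - l)| < e by near: i.
by rewrite sub0r normrN ger0_norm ?(un_ge0 hN).
Unshelve. all: by end_near. Qed.

(** * Additive polynomials attached to finite groups *)

Section AdditivePolynomial.
Context {K : fieldType} {I : finZmodType} (v : I -> K).
Context (vD : {morph v : i j / i + j}) (v_inj : injective v).

Let v0 : v 0 = 0.
Proof. by apply: (@addrI _ (v 0)); rewrite -vD !addr0. Qed.
Let vN i : v (- i) = - v i.
Proof. by apply: (@addrI _ (v i)); rewrite -vD !subrr. Qed.
Let vB i j : v (i - j) = v i - v j.
Proof. by rewrite vD vN. Qed.

Let vroots_uniq : uniq [seq v i | i : I].
Proof. by rewrite map_inj_uniq ?enum_uniq. Qed.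

Lemma poly_vanish (p : {poly K}) : (size p <= #|I|)%N -> (forall i, p.[v i] = 0) -> p = 0.
Proof.
move=> sp h; apply: (roots_geq_poly_eq0 (rs := [seq v i | i : I])) => //.
- by apply/allP => x /mapP[i _ ->]; rewrite rootE h.
- by rewrite size_map -cardE.
Qed.

Lemma size_sub_monic (p r : {poly K}) : p \is monic -> r \is monic -> size p = size r ->
  (size (p - r)%R <= (size p).-1)%N.
Proof.
move=> mp mr pr; apply/leq_sizeP => j; rewrite leq_eqVlt => /orP[/eqP <-|hj].
  by rewrite coefB {2}pr -!/(lead_coef _) (monicP mp) (monicP mr) subrr.
have hj' : (size p <= j)%N by case: (size p) hj.
by rewrite coefB !nth_default ?subr0// -pr.
Qed.

(** With P the monic polynomial of roots [v i], the polynomial P(X + y) - P(X) - P(y) has size at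
    most |I|, the leading terms cancelling, and vanishes at the |I| roots because translation by a
    root permutes them. *)
Lemma prod_root_additive x y :
  \prod_i (x + y - v i) = \prod_i (x - v i) + \prod_i (y - v i).
Proof.
pose P c : {poly K} := \prod_i ('X - (v i - c)%:P).
have PE c w : (P c).[w] = \prod_i (w + c - v i).
  rewrite horner_prod; apply: eq_bigr => i _; rewrite hornerXsubC opprB addrA.
  by [].
have sP c : size (P c) = #|I|.+1.
  by rewrite /P size_prod_XsubC /index_enum -enumT -cardE.
have mP c : P c \is monic by exact: monic_prod_XsubC.
have shift i w : \prod_j (w + v i - v j) = \prod_j (w - v j).
  rewrite (reindex_inj (addIr i)) /=; apply: eq_bigr => j _.
  by rewrite vD opprD addrACA subrr addr0.
have D0 : P y - P 0 - (\prod_i (y - v i))%:P = 0.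
  apply: poly_vanish => [|i].
    apply: leq_trans (size_polyD _ _) _; rewrite geq_max; apply/andP; split.
      have := size_sub_monic (mP y) (mP 0) (etrans (sP y) (esym (sP 0))).
      by rewrite sP.
    rewrite size_polyN; apply: leq_trans (size_polyC_leq1 _) _.
    by apply/card_gt0P; exists 0.
  rewrite !hornerE !PE.
  have -> : \prod_j (v i + y - v j) = \prod_j (y - v j).
    by rewrite -(shift i y); apply: eq_bigr => j _; rewrite (addrC y).
  have -> : \prod_j (v i + 0 - v j) = 0.
    by rewrite (bigD1 i) //= addr0 subrr mul0r.
  by rewrite subr0 subrr.
have := congr1 (fun p : {poly K} => p.[x]) D0; rewrite !hornerE !PE addr0 => /eqP.
by rewrite subr_eq0 subr_eq => /eqP ->; exact: addrC.
Qed.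

(** Logarithmic derivative of an additive polynomial: the derivative S has size at most |I| and
    takes the value \prod_(i != 0) v i at every root, hence is constant. *)
Lemma sum_inv_root w : (forall i, w != v i) ->
  \sum_i (w - v i)^-1 = (\prod_(i | i != 0) v i) / \prod_i (w - v i).
Proof.
move=> wv; pose S : {poly K} := \sum_i \prod_(j | j != i) ('X - (v j)%:P).
have SE x : S.[x] = \sum_i \prod_(j | j != i) (x - v j).
  by rewrite horner_sum; apply: eq_bigr => i _; rewrite horner_prod;
     apply: eq_bigr => j _; rewrite hornerXsubC.
have S0 : S - (\prod_(i | i != 0) v i)%:P = 0.
  apply: poly_vanish => [|i].
    apply: leq_trans (size_polyD _ _) _; rewrite geq_max; apply/andP; split.
      apply: leq_trans (size_sum _ _ _) _; apply/bigmax_leqP => i _.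
      rewrite -big_filter size_prod_XsubC.
      rewrite size_filter -sum1_count sum1_card cardC1 prednK//.
      by apply/card_gt0P; exists 0.
    rewrite size_polyN; apply: leq_trans (size_polyC_leq1 _) _.
    by apply/card_gt0P; exists 0.
  rewrite !hornerE SE (bigD1 i) //= [X in _ + X - _]big1 ?addr0; last first.
    by move=> j ji; rewrite (bigD1 i) /= ?subrr ?mul0r// eq_sym.
  apply/eqP; rewrite subr_eq0; apply/eqP; rewrite (reindex_inj (subrI i)) /=.
  apply: eq_big => [l|l _]; last by rewrite vB subKr.
  by rewrite -{2}(subr0 i) (inj_eq (subrI i)).
have := congr1 (fun p : {poly K} => p.[w]) S0; rewrite !hornerE SE => /eqP.
rewrite subr_eq0 => /eqP <-; rewrite mulr_suml; apply: eq_bigr => i _.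
have wi j : w - v j != 0 by rewrite subr_eq0.
rewrite [X in _ / X](bigD1 i) //= invfM mulrCA mulfV ?mulr1//.
by apply/prodf_neq0 => j _.
Qed.

End AdditivePolynomial.

(** * The lattice exponential as a limit of additive polynomials *)

Section LatticeExp.
Context {F : finFieldType} {R : realType} {X : valuedField F R}.
Context (hX : vcomplete X).
Local Notation q := #|F|.
Local Notation N := (@vabs F R X).
Local Notation A := {poly F}.
Context {n : nat} {z : 'rV[X]_n.+1} (Oz : Omega z).
Local Notation e_ := (lattice_exp (lattice z)).
Local Notation vv m := (zdot z (of_coefs m)).

(** Truncation of the exponential to a box of lattice points. A box is an F-vector space, so this is
    an F-linear polynomial, and identities of the exponential are limits of identities between
    polynomials. *)
Definition fexp (d : nat) (w : X) : X :=
  w * \prod_(a <- box n.+1 d | a != 0) (1 - w / zdot z a).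

Let vD d : {morph (fun m : 'M[F]_(n.+1, d) => vv m) : m m' / m + m'}.
Proof. by move=> m m'; rewrite of_coefsD zdotD. Qed.
Let v_inj d : injective (fun m : 'M[F]_(n.+1, d) => vv m).
Proof. by move=> m m' /(zdot_inj hX Oz)/of_coefs_inj. Qed.

Lemma of_coefs_eq0 s d (m : 'M[F]_(s, d)) : (of_coefs m == 0) = (m == 0).
Proof. by rewrite -(of_coefs0 s d) (inj_eq (@of_coefs_inj _ _ _)). Qed.

Lemma fexpE d w : fexp d w =
  (\prod_(m : 'M[F]_(n.+1, d)) (w - vv m)) / \prod_(m : 'M[F]_(n.+1, d) | m != 0) vv m.
Proof.
rewrite /fexp big_box [X in _ = X / _](bigD1 (0 : 'M[F]_(n.+1, d))) //= of_coefs0 zdot0 subr0 -mulrA.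
congr (_ * _).
have -> : \prod_(m : 'M[F]_(n.+1, d) | m != 0) vv m =
    \prod_(m : 'M[F]_(n.+1, d) | m != 0) - vv m.
  rewrite (reindex_inj oppr_inj) /=; apply: eq_big => [m|m _].
    by rewrite oppr_eq0.
  by rewrite of_coefsN zdotN.
rewrite -prodf_div; apply: eq_big => [m|m m0]; first by rewrite of_coefs_eq0.
have vm : vv m != 0 by rewrite (zdot_eq0 hX _ Oz).
by field; rewrite oppr_eq0 vm.
Qed.

Lemma fexpD d : {morph fexp d : w w' / w + w'}.
Proof.
by move=> w w'; rewrite !fexpE (prod_root_additive (@vD d) (@v_inj d)) mulrDl.
Qed.

Lemma fexp0 d : fexp d 0 = 0. Proof. by rewrite /fexp mul0r. Qed.

Lemma fexp_vemb d (c : F) w : fexp d (vemb X c * w) = vemb X c * fexp d w.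
Proof.
have [->|c0] := eqVneq c 0; first by rewrite rmorph0 !mul0r fexp0.
have vc : vemb X c != 0 by rewrite fmorph_eq0.
rewrite /fexp -mulrA; congr (_ * (_ * _)); rewrite !big_box.
rewrite (reindex_inj (scalerI c0)) /=; apply: eq_big => [m|m m0].
  by rewrite !of_coefs_eq0 scaler_eq0 (negPf c0).
have vm : vv m != 0.
  by move: m0; rewrite (zdot_eq0 hX _ Oz) !of_coefs_eq0 scaler_eq0 (negPf c0).
by rewrite of_coefsZ zdotZ AembC; field; rewrite ?vc ?vm.
Qed.

Lemma fexp_zdot d a : (cdeg a <= d)%N -> fexp d (zdot z a) = 0.
Proof.
move=> /of_coefs_surj[m ->]; rewrite fexpE (bigD1 m) //= subrr.
by rewrite !mul0r.
Qed.

Lemma fexp_neq0 d w : (forall a, w != zdot z a) -> fexp d w != 0.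
Proof.
move=> h; have w0 : w != 0 by rewrite -(zdot0 z).
rewrite mulf_neq0// prodf_seq_neq0; apply/allP => a _; apply/implyP => a0.
have za : zdot z a != 0 by rewrite (zdot_eq0 hX _ Oz).
by rewrite subr_eq0 eq_sym -(inj_eq (mulIf za)) mul1r divfK.
Qed.

Lemma sum_inv_fexp d w : (forall a, w != zdot z a) ->
  \sum_(a <- box n.+1 d) (w - zdot z a)^-1 = (fexp d w)^-1.
Proof.
move=> h; rewrite big_box /= (sum_inv_root (@vD d) (@v_inj d)); last by move=> m.
by rewrite fexpE invf_div.
Qed.

Lemma vabs_prod_sub1 (I : Type) (r : seq I) (P : pred I) (x : I -> X) (dl : R) :
  0 <= dl <= 1 -> (forall i, P i -> N (x i - 1) <= dl) ->
  N (\prod_(i <- r | P i) x i - 1) <= dl.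
Proof.
move=> /andP[d0 d1] h; elim/big_ind: _ => //; first by rewrite subrr vabs0.
move=> u u' hu hu'; rewrite -(subrK u' (u * u')) -addrA -{2}(mul1r u') -mulrBl.
apply: (unD_le vabs_un) => //; rewrite vabsM.
apply: le_trans (_ : dl * 1 <= _); last by rewrite mulr1.
apply: ler_pM => //; try exact: vabs_ge0.
rewrite -(subrK 1 u'); apply: (unD_le vabs_un); rewrite ?vabs1//.
exact: le_trans d1.
Qed.

Lemma zdot_ge_lt d a : (d < cdeg a)%N -> imag z * q%:R ^+ d <= N (zdot z a).
Proof.
move=> da; have a0 : a != 0.
  by apply: contraTneq da => ->; rewrite /cdeg big1// => i _; rewrite mxE size_poly0.
apply: le_trans (zdot_ge z a0); apply: (ler_wpM2l (ltW (imag_gt0 hX Oz))).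
by rewrite ler_eXn2l ?qR_gt1// -ltnS prednK// cdeg_gt0.
Qed.

(** Smallness of w relative to all lattice points outside the box: each omitted factor is then
    within dl of 1, which bounds the relative error of the truncated product. *)
Let small d w (dl : R) := 0 <= dl <= 1 /\ forall a, (d < cdeg a)%N -> N w <= dl * N (zdot z a).

Lemma small_mono d d' w dl : (d <= d')%N -> small d w dl -> small d' w dl.
Proof. by move=> dd [h1 h2]; split => // a da; apply: h2; exact: leq_ltn_trans da. Qed.

Lemma small_exists w (dl : R) : 0 < dl -> dl <= 1 -> exists d, small d w dl.
Proof.
move=> d0 d1; have i0 := imag_gt0 hX Oz.
have w1 : 0 < N w + 1 by rewrite ltr_wpDl ?vabs_ge0.
have [d hd] := @qRV_small F R (dl * imag z / (N w + 1)) (divr_gt0 (mulr_gt0 d0 i0) w1).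
exists d; split; first by rewrite ltW.
move=> a da; apply: le_trans (_ : dl * (imag z * q%:R ^+ d) <= _); last first.
  by apply: (ler_wpM2l (ltW d0)); exact: zdot_ge_lt.
move: hd; rewrite ltr_pdivlMr// ltr_pdivrMl ?qRX_gt0// [q%:R ^+ d * _]mulrC mulrA.
by move=> /ltW; apply: le_trans; rewrite lerDl.
Qed.

Lemma small_factor d w dl a : small d w dl -> (d < cdeg a)%N -> a != 0 ->
  N (1 - w / zdot z a - 1) <= dl.
Proof.
move=> [_ h] da a0; have za : 0 < N (zdot z a) by rewrite vabs_gt0 (zdot_eq0 hX _ Oz).
by rewrite addrC addKr vabsN vabsM vabsV ler_pdivrMr// h.
Qed.

Let fprod w (S : {fset X}) := \prod_(l <- S | (l \in lattice z) && (l != 0)) (1 - w / l).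

Let fprodE d w : fprod w ((zdot z) @` box n.+1 d)%fset = \prod_(a <- box n.+1 d | a != 0) (1 - w / zdot z a).
Proof.
rewrite /fprod big_mkcond big_imfset /=; last by move=> a b _ _; exact: zdot_inj.
rewrite [RHS]big_mkcond; apply: eq_bigr => a _; rewrite (zdot_eq0 hX _ Oz).
by rewrite (_ : zdot z a \in lattice z)//= inE; exact: zdot_lattice.
Qed.

Let fprod_close d w dl (S : {fset X}) : small d w dl ->
  ((zdot z) @` box n.+1 d `<=` S)%fset ->
  N (fprod w S - fprod w ((zdot z) @` box n.+1 d)%fset) <=
  dl * N (fprod w ((zdot z) @` box n.+1 d)%fset).
Proof.
move=> sm bS; set B := ((zdot z) @` box n.+1 d)%fset.
have -> : fprod w S = fprod w B *
    \prod_(l <- S | (l \notin B) && ((l \in lattice z) && (l != 0))) (1 - w / l).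
  rewrite /fprod big_mkcond (big_fset_split _ _ bS) /=; congr (_ * _).
    by rewrite [RHS]big_mkcond.
  by rewrite -big_mkcondr.
rewrite -{2}(mulr1 (fprod w B)) -mulrBr vabsM mulrC; apply: (ler_wpM2r (vabs_ge0 _)).
apply: vabs_prod_sub1; first by case: sm.
move=> l /and3P[lB ll l0]; move: ll; rewrite inE => -[a _ al].
rewrite -al; apply: (small_factor sm).
  rewrite ltnNge -in_box; apply: contraNN lB => aB; apply/imfsetP.
  by exists a => //; rewrite -al.
by rewrite -(zdot_eq0 hX _ Oz) [zdot z a]al.
Qed.

(** Finite sets are compared with the boxes: all products over sets containing a box agree with that
    of the box up to the relative error dl. Hence the limit exists, is the one chosen by [nlim], and
    inherits the bound. *)
Lemma lattice_exp_cvg w : exists p, e_ w = w * p /\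
  forall d dl, small d w dl ->
    N (p - \prod_(a <- box n.+1 d | a != 0) (1 - w / zdot z a)) <=
    dl * N (\prod_(a <- box n.+1 d | a != 0) (1 - w / zdot z a)).
Proof.
pose B d := ((zdot z) @` box n.+1 d)%fset.
have BB d d' : (d <= d')%N -> (B d `<=` B d')%fset.
  move=> dd; apply/fsubsetP => l /imfsetP[a /= aB ->]; apply/imfsetP; exists a => //=.
  by move: aB; rewrite !in_box => /leq_trans; apply.
have [d0 sm0] := small_exists w ltr01 (lexx 1).
set C := N (fprod w (B d0)) + 1.
have C0 : 0 < C by rewrite ltr_wpDl ?vabs_ge0.
have bound d : (d0 <= d)%N -> N (fprod w (B d)) <= C.
  move=> dd; rewrite -(subrK (fprod w (B d0)) (fprod w (B d))).
  apply: (unD_le vabs_un); last by rewrite lerDl.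
  apply: le_trans (fprod_close sm0 (BB _ _ dd)) _.
  by rewrite mul1r lerDl.
have tail (e : R) : 0 < e -> exists2 d, (d0 <= d)%N &
    forall S : {fset X}, (B d `<=` S)%fset -> N (fprod w S - fprod w (B d)) < e.
  move=> ep; pose dl := Num.min 1 (e / (C + C)).
  have dl0 : 0 < dl by rewrite lt_min ltr01 divr_gt0// addr_gt0.
  have dl1 : dl <= 1 by rewrite ge_min lexx.
  have [d hd] := small_exists w dl0 dl1; exists (maxn d0 d); first exact: leq_maxl.
  move=> S BS; have sm := small_mono (leq_maxr d0 d) hd.
  apply: le_lt_trans (fprod_close sm BS) _.
  apply: le_lt_trans (_ : dl * C < _).
    by apply: (ler_wpM2l (ltW dl0)); apply: bound; exact: leq_maxl.
  apply: le_lt_trans (_ : e / (C + C) * C < _).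
    by apply: (ler_wpM2r (ltW C0)); rewrite ge_min lexx orbT.
  rewrite mulrAC ltr_pdivrMr; last exact: addr_gt0.
  by rewrite (ltr_pM2l ep) ltrDl; exact: C0.
have [|p hp] := vabs_ucomplete hX (u := fun d => fprod w (B d)).
  move=> e /tail[d _ hd]; exists d => m k dm dk.
  apply: (un_dist_lt vabs_un (y := fprod w (B d))); first exact/hd/BB.
  by rewrite (unC vabs_un); exact/hd/BB.
exists p; split.
  have FF := @summability.totally_filter X.
  congr (_ * _); apply: (ncvg_nlim vabs_un).
  apply/cvgrPdist_lt => e e0; have [d dd hd] := tail _ e0.
  exists (B d) => // S /= BS; rewrite sub0r normrN ger0_norm ?vabs_ge0//.
  apply: (un_dist_lt vabs_un (hd _ BS)); have [d1 h1] := hp _ e0.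
  apply: (un_dist_lt vabs_un (y := fprod w (B (maxn d d1)))).
    rewrite (unC vabs_un); apply/hd/BB; exact: leq_maxl.
  by rewrite (unC vabs_un); apply: h1; exact: leq_maxr.
move=> d dl sm; rewrite -fprodE.
rewrite leNgt; apply/negP => lt.
have e0 : 0 < N (p - fprod w (B d)).
  by apply: le_lt_trans lt; rewrite mulr_ge0 ?vabs_ge0//; case: sm => /andP[].
have [d1 h1] := hp _ e0; have : N (p - fprod w (B d)) < N (p - fprod w (B d)); last by rewrite ltxx.
apply: (un_dist_lt vabs_un (h1 (maxn d d1) (leq_maxr _ _))).
apply: le_lt_trans lt; apply: fprod_close => //; apply: BB; exact: leq_maxl.
Qed.

Lemma lattice_exp_close d w dl : small d w dl -> N (e_ w - fexp d w) <= dl * N (fexp d w).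
Proof.
move=> sm; have [p [-> hp]] := lattice_exp_cvg w.
by rewrite /fexp -mulrBr !vabsM mulrCA ler_wpM2l ?vabs_ge0// hp.
Qed.

(** A relative error of at most 1/2 already forces equality of absolute values, so that estimates
    for finite products hold for the exponential. *)
Lemma vabs_lattice_exp w : exists d0, forall d, (d0 <= d)%N -> N (e_ w) = N (fexp d w).
Proof.
have h2 : 2^-1 <= 1 :> R by rewrite invf_le1 ?ler1n.
have h0 : 0 < 2^-1 :> R by rewrite invr_gt0.
have [d0 sm] := small_exists w h0 h2; exists d0 => d dd.
have := lattice_exp_close (small_mono dd sm).
have [->|f0] := eqVneq (fexp d w) 0.
  by rewrite subr0 vabs0 mulr0 => h; apply/eqP; rewrite eq_le h vabs_ge0.
move=> h; apply: (un_eq vabs_un); rewrite (unC vabs_un); apply: le_lt_trans h _.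
by rewrite gtr_pMl ?vabs_gt0// invf_lt1 ?ltr1n.
Qed.

Lemma fexp_lim w (e : R) : 0 < e ->
  exists d0, forall d, (d0 <= d)%N -> N (e_ w - fexp d w) < e.
Proof.
move=> e0; have [d1 h1] := vabs_lattice_exp w.
pose dl := Num.min 1 (e / (N (e_ w) + N (e_ w) + 1)).
have w0 : 0 < N (e_ w) + N (e_ w) + 1 by rewrite ltr_wpDl ?addr_ge0 ?vabs_ge0.
have dl0 : 0 < dl by rewrite lt_min ltr01 divr_gt0.
have dl1 : dl <= 1 by rewrite ge_min lexx.
have [d hd] := small_exists w dl0 dl1; exists (maxn d1 d) => k; rewrite geq_max => /andP[k1 k2].
apply: le_lt_trans (lattice_exp_close (small_mono k2 hd)) _; rewrite -h1//.
apply: le_lt_trans (_ : e / (N (e_ w) + N (e_ w) + 1) * N (e_ w) < _).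
  by rewrite ler_wpM2r ?vabs_ge0// ge_min lexx orbT.
rewrite mulrAC ltr_pdivrMr// ltr_pM2l// -addrA ltrDl.
by rewrite ltr_wpDl ?vabs_ge0.
Qed.

Lemma lattice_expD : {morph e_ : w w' / w + w'}.
Proof.
move=> w w'; apply/eqP; rewrite -subr_eq0; apply/eqP/(un_eq0_lt vabs_un) => e e0.
have [d0 h0] := fexp_lim (w + w') e0; have [d1 h1] := fexp_lim w e0.
have [d2 h2] := fexp_lim w' e0; pose d := maxn d0 (maxn d1 d2).
apply: (un_dist_lt vabs_un (y := fexp d (w + w'))); first by apply: h0; exact: leq_maxl.
rewrite (unC vabs_un) fexpD opprD addrACA; apply: (unD_lt vabs_un).
  by apply: h1; rewrite /d leq_max leq_max leqnn orbT.
by apply: h2; rewrite /d leq_max leq_max leqnn !orbT.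
Qed.

Lemma lattice_exp0 : e_ 0 = 0.
Proof. by apply: (@addrI _ (e_ 0)); rewrite -lattice_expD !addr0. Qed.
Lemma lattice_expN : {morph e_ : w / - w}.
Proof. by move=> w; apply: (@addrI _ (e_ w)); rewrite -lattice_expD !subrr lattice_exp0. Qed.
Lemma lattice_expB : {morph e_ : w w' / w - w'}.
Proof. by move=> w w'; rewrite lattice_expD lattice_expN. Qed.

Lemma lattice_exp_vemb (c : F) w : e_ (vemb X c * w) = vemb X c * e_ w.
Proof.
apply/eqP; rewrite -subr_eq0; apply/eqP/(un_eq0_lt vabs_un) => e e0.
have [d0 h0] := fexp_lim (vemb X c * w) e0; have [d1 h1] := fexp_lim w e0.
pose d := maxn d0 d1.
apply: (un_dist_lt vabs_un (y := fexp d (vemb X c * w))); first by apply: h0; exact: leq_maxl.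
rewrite fexp_vemb (unC vabs_un) -mulrBr vabsM; apply: le_lt_trans (h1 d (leq_maxr _ _)).
by rewrite ler_piMl ?vabs_ge0 ?vabs_vemb_le1.
Qed.

Lemma lattice_exp_zdot a : e_ (zdot z a) = 0.
Proof.
have [d0 h0] := vabs_lattice_exp (zdot z a); apply: (vabs_eq0 (v := X)).
by rewrite (h0 (maxn d0 (cdeg a)) (leq_maxl _ _)) fexp_zdot ?leq_maxr// vabs0.
Qed.

Lemma lattice_exp_neq0 w : (forall a, w != zdot z a) -> e_ w != 0.
Proof.
move=> h; have [d0 h0] := vabs_lattice_exp w.
by rewrite -vabs_eq0E (h0 d0)// vabs_eq0E fexp_neq0.
Qed.

Lemma lattice_exp_eq0 w : e_ w = 0 -> exists a, w = zdot z a.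
Proof.
move=> h; apply: contrapT => h'; have/eqP := h; apply/negP/lattice_exp_neq0 => a.
by apply/eqP => wa; apply: h'; exists a.
Qed.

Lemma null_inv_zdot w : nullfam N (fun a => (w - zdot z a)^-1).
Proof.
apply: null_cdeg => e e0; have i0 := imag_gt0 hX Oz.
have we : 0 < N w + e^-1 + 1 by rewrite ltr_wpDl// addr_ge0 ?vabs_ge0 ?invr_ge0 ?ltW.
have [d hd] := @qRV_small F R (imag z / (N w + e^-1 + 1)) (divr_gt0 i0 we).
exists d => a da; have big : N w + e^-1 < N (zdot z a).
  apply: lt_le_trans (zdot_ge_lt da).
  move: hd; rewrite ltr_pdivlMr// ltr_pdivrMl ?qRX_gt0// mulrC; apply: lt_trans.
  by rewrite ltrDl.
have wza : N (w - zdot z a) = N (zdot z a).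
  rewrite -[RHS]vabsN; apply: (un_eq vabs_un); rewrite opprB addKr !vabsN.
  by apply: lt_trans big; rewrite ltrDl invr_gt0.
rewrite vabsV wza invf_plt ?posrE//; last first.
  by apply: lt_trans big; rewrite ltr_wpDl ?vabs_ge0 ?invr_gt0.
by apply: le_lt_trans big; rewrite lerDr vabs_ge0.
Qed.

Lemma sums_cdeg (V : zmodType) (NV : V -> R) (hNV : ultranorm NV) s (x : 'cV[A]_s -> V) t l :
  sums NV x t ->
  (forall e, 0 < e -> exists d0, forall d, (d0 <= d)%N ->
     NV (l - \sum_(a <- box s d) x a) < e) -> t = l.
Proof.
move=> xt xl; apply/eqP; rewrite -subr_eq0; apply/eqP/(un_eq0_lt hNV) => e e0.
have [S [_ hS]] := xt _ e0; have [d0 h0] := xl _ e0.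
pose d := maxn d0 (\max_(a <- S) cdeg a).
apply: (un_dist_lt hNV (y := \sum_(a <- box s d) x a)).
  apply: (sums_tail hNV xt) => // a ab; apply: hS; apply: contraNN ab => aS.
  rewrite in_box /d leq_max; apply/orP; right.
  by apply: leq_bigmax_seq.
by rewrite (unC hNV); apply: h0; exact: leq_maxl.
Qed.

(** Limit of [sum_inv_fexp]: the exponential has derivative 1, so that its logarithmic derivative is
    1/e. *)
Lemma sums_inv_zdot w : (forall a, w != zdot z a) ->
  sums N (fun a => (w - zdot z a)^-1) (e_ w)^-1.
Proof.
move=> h; have [t ht] := null_sums vabs_un (vabs_ucomplete hX) (null_inv_zdot w).
suff -> : (e_ w)^-1 = t by [].
apply/esym/(sums_cdeg vabs_un ht) => e e0.
have ew := lattice_exp_neq0 h; have ew0 : 0 < N (e_ w) by rewrite vabs_gt0.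
have [d0 h0] := vabs_lattice_exp w.
have [d1 h1] := fexp_lim w (mulr_gt0 e0 (mulr_gt0 ew0 ew0)).
exists (maxn d0 d1) => d; rewrite geq_max => /andP[dd0 dd1].
rewrite sum_inv_fexp//; have fw := fexp_neq0 d h.
have -> : (e_ w)^-1 - (fexp d w)^-1 = (fexp d w - e_ w) / (e_ w * fexp d w).
  by field; rewrite ew fw.
rewrite vabsM vabsV vabsM -(h0 d)// ltr_pdivrMr ?mulr_gt0// (unC vabs_un).
exact: h1.
Qed.

Lemma fexp_compare d v w : w != 0 -> N v <= N w ->
  (forall a, N w <= N (w - zdot z a)) -> N (fexp d v) <= N v / N w * N (fexp d w).
Proof.
move=> w0 vw hw; have Nw : 0 < N w by rewrite vabs_gt0.
rewrite /fexp !vabsM mulrA divfK ?lt0r_neq0//; apply: (ler_wpM2l (vabs_ge0 _)).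
rewrite !vabs_prod; apply: ler_prod => a a0; rewrite vabs_ge0 /=.
have za0 : zdot z a != 0 by rewrite (zdot_eq0 hX _ Oz).
have za : 0 < N (zdot z a) by rewrite vabs_gt0.
have E u : N (1 - u / zdot z a) = N (u - zdot z a) / N (zdot z a).
  have -> : 1 - u / zdot z a = - ((u - zdot z a) / zdot z a) by field.
  by rewrite vabsN vabsM vabsV.
rewrite !E ler_pM2r ?invr_gt0//.
have zw : N (zdot z a) <= N (w - zdot z a).
  by rewrite -(subKr w (zdot z a)); apply: (unB_le vabs_un); rewrite subKr.
by apply: (unB_le vabs_un) => //; apply: le_trans (hw a).
Qed.

(* A point w that is closest to the origin among its translates by the lattice
   dominates the exponential on the disc of radius |w|. *)
Lemma lattice_exp_compare v w : w != 0 -> N v <= N w ->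
  (forall a, N w <= N (w - zdot z a)) -> N (e_ v) <= N v / N w * N (e_ w).
Proof.
move=> w0 vw hw; have [d0 h0] := vabs_lattice_exp v; have [d1 h1] := vabs_lattice_exp w.
rewrite (h0 (maxn d0 d1)) ?leq_maxl// (h1 (maxn d0 d1)) ?leq_maxr//.
exact: fexp_compare.
Qed.

(** For such a w the ultrametric inequality gives |zdot z a| <= |w - zdot z a|, so no factor of the
    product has absolute value below 1. *)
Lemma vabs_lattice_exp_ge w : (forall a, N w <= N (w - zdot z a)) -> N w <= N (e_ w).
Proof.
move=> hw; have [->|w0] := eqVneq w 0; first by rewrite vabs0 vabs_ge0.
have [d0 /(_ d0 (leqnn d0)) ->] := vabs_lattice_exp w; rewrite /fexp vabsM ler_peMr ?vabs_ge0//.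
rewrite vabs_prod; elim/big_ind: _ => //; first by move=> *; exact: mulr_ege1.
move=> a a0; have za0 : zdot z a != 0 by rewrite (zdot_eq0 hX _ Oz).
have za : 0 < N (zdot z a) by rewrite vabs_gt0.
have -> : 1 - w / zdot z a = - ((w - zdot z a) / zdot z a) by field.
rewrite vabsN vabsM vabsV ler_pdivlMr// mul1r.
have h : N (zdot z a) <= N (w - zdot z a).
  by rewrite -[in leLHS](subKr w (zdot z a)); apply: (unB_le vabs_un).
exact: h.
Qed.

(** Only lattice points of a finite box can be closer to w than 0 is, so the minimum is taken over a
    finite set. *)
Lemma exists_closest w : exists a, forall b, N (w - zdot z a) <= N (w - zdot z a - zdot z b).
Proof.
have i0 := imag_gt0 hX Oz.
have w1 : 0 < N w + 1 by rewrite ltr_wpDl ?vabs_ge0.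
have [d hd] := @qRV_small F R (imag z / (N w + 1)) (divr_gt0 i0 w1).
have far a : (d < cdeg a)%N -> N w <= N (w - zdot z a).
  move=> da; have : N w < N (zdot z a).
    apply: lt_le_trans (zdot_ge_lt da); move: hd.
    rewrite ltr_pdivlMr// ltr_pdivrMl ?qRX_gt0// mulrC; apply: lt_trans.
    by rewrite ltrDl.
  move=> h; rewrite leNgt; apply/negP => h'.
  suff : N (zdot z a) < N (zdot z a) by rewrite ltxx.
  by rewrite -{1}(subKr w (zdot z a)); apply: (unB_lt vabs_un) => //; exact: lt_trans h.
have [m _ hm] := @arg_minP _ R _ (0 : 'M[F]_(n.+1, d)) predT (fun m => N (w - vv m)) isT.
exists (of_coefs m) => b; rewrite -addrA -opprD -zdotD.
have [db|db] := leqP (cdeg (of_coefs m + b)) d.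
  by have [m' ->] := of_coefs_surj db; exact: hm.
apply: le_trans (far _ db); have := hm 0 isT.
by rewrite of_coefs0 zdot0 subr0.
Qed.

(** Below the shortest lattice vector every factor 1 - w / l has absolute value 1. *)
Lemma lattice_exp_small w : (forall a, a != 0 -> N w < N (zdot z a)) -> N (e_ w) = N w.
Proof.
move=> hw; have [d0 /(_ d0 (leqnn d0)) ->] := vabs_lattice_exp w; rewrite /fexp vabsM.
rewrite vabs_prod big1 ?mulr1// => a a0; rewrite -(vabs1 (X := X)).
have za0 : zdot z a != 0 by rewrite (zdot_eq0 hX _ Oz).
apply: (un_eq vabs_un); rewrite subKr vabs1 vabsM vabsV ltr_pdivrMr ?vabs_gt0// mul1r.
exact: hw.
Qed.

End LatticeExp.

(** * Regrouping modulo a polynomial, and power sums *)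

Section Regroup.
Context {F : finFieldType} {R : realType}.
Local Notation A := {poly F}.
Context {V : zmodType} {NV : V -> R} (hNV : ultranorm NV).

(** Entrywise Euclidean division by M: remainders have [(size M).-1] coefficients, so that the
    classes modulo M are indexed by matrices over F. *)
Lemma sums_mod s (M : A) (x : 'cV[A]_s -> V) t (y : 'M[F]_(s, (size M).-1) -> V) :
  M != 0 -> sums NV x t ->
  (forall m, sums NV (fun b => x (of_coefs m + M *: b)) (y m)) -> t = \sum_m y m.
Proof.
move=> M0 xt xy.
pose p (a : 'cV[A]_s) : 'M[F]_(s, (size M).-1) := \matrix_i poly_rV (a i 0 %% M).
have sM : size M = (size M).-1.+1 by rewrite prednK// size_poly_gt0.
have pE m b : p (of_coefs m + M *: b) = m.
  apply/row_matrixP => i; rewrite rowK !mxE modpD modp_mulr addr0.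
  by rewrite modp_small ?rVpolyK// [ltnRHS]sM ltnS size_poly.
have pK a : a = of_coefs (p a) + M *: (\col_i (a i 0 %/ M)).
  apply/matrixP => i j; rewrite !mxE ord1 rowK poly_rV_K.
    by rewrite mulrC addrC -divp_eq.
  by rewrite -ltnS -sM ltn_modp.
apply: (sums_uniq hNV) (sums_finType hNV y).
apply: (sums_regroup hNV (p := p) xt) => m.
apply: (sums_inj hNV (f := fun b => of_coefs m + M *: b)).
- by move=> b b' /addrI bb; apply/matrixP => i j; have /matrixP/(_ i j) := bb;
     rewrite !mxE => /(mulfI M0).
- move=> a ha; case: eqP => // pa; case: (ha (\col_i (a i 0 %/ M))).
  by rewrite -pa -pK.
- by apply: sums_ext (xy m) => b /=; rewrite pE eqxx.
Qed.

End Regroup.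

(** * Vanishing of power sums over F_q-spaces *)

Section PowerSums.
Context {F : finFieldType} {K : comNzRingType} (io : {rmorphism F -> K}).
Local Notation q := #|F|.

(** Scaling the variable by g multiplies the sum by g^e, which differs from 1 for some g because X^e
    - 1 has fewer than q - 1 roots; for e = 0 the sum is q = 0. *)
Lemma sum_expf (e : nat) : (e < q.-1)%N -> \sum_(c : F) c ^+ e = 0.
Proof.
move=> eq.
have [g g0 ge] : exists2 g : F, g != 0 & (e == 0%N) || (g ^+ e != 1).
  have [e0|e0] := posnP e; first by exists 1; rewrite ?oner_neq0// e0.
  apply: contrapT => h.
  have roots : all (root ('X^e - 1%:P : {poly F})) (enum (predC1 (0 : F))).
    apply/allP => c; rewrite mem_enum inE => c0; rewrite rootE !hornerE.
    rewrite subr_eq0; apply: contrapT => /negP ce; apply: h.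
    by exists c; rewrite ?ce ?orbT.
  have p0 : 'X^e - 1%:P != 0 :> {poly F} by rewrite -size_poly_gt0 size_XnsubC.
  have := max_poly_roots p0 roots (enum_uniq _).
  by rewrite size_XnsubC// ltnS -cardE cardC1 leqNgt eq.
case/orP: ge => [/eqP ->|ge].
  have -> : \sum_(c : F) c ^+ 0 = q%:R.
    by rewrite (eq_bigr (fun=> 1)) ?sumr_const// => c _; rewrite expr0.
  have [p p_pr pF] := finPcharP F.
  have /p_natP[[|m] mE] : p.-nat q.
    by have := pprimeChar_pgroup pF; rewrite /pgroup.pgroup cardsT.
    by have := q_gt1 (F := F); rewrite mE.
  by rewrite mE expnS natrM (pcharf0 pF) mul0r.
have : (g ^+ e - 1) * \sum_(c : F) c ^+ e = 0.
  rewrite mulrBl mul1r mulr_sumr [X in _ - X](reindex_inj (mulfI g0)) /=.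
  by rewrite -sumrB big1// => c _; rewrite exprMn subrr.
by move/eqP; rewrite mulf_eq0 subr_eq0 (negPf ge) => /eqP.
Qed.

Section Forms.
Context {I : finType}.
Implicit Types (c : {ffun I -> F}) (l : K * (I -> K)).

Definition affine l c : K := l.1 + \sum_i io (c i) * l.2 i.

(* Chevalley-Warning: a polynomial of degree less than (q-1)|I| sums to 0. *)
Lemma sum_prod_affine_monomial (L : seq (K * (I -> K))) (e : I -> nat) :
  (\sum_i e i + size L < #|I| * q.-1)%N ->
  \sum_(c : {ffun I -> F}) (\prod_i io (c i) ^+ e i) * \prod_(l <- L) affine l c = 0.
Proof.
elim: L e => [|l L IH] e he.
  rewrite addn0 in he.
  have [i ei] : exists i, (e i < q.-1)%N.
    apply: contrapT => h; move: he; rewrite ltnNge => /negP; apply.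
    rewrite -sum_nat_const; apply: leq_sum => i _; rewrite leqNgt.
    by apply/negP => ei; apply: h; exists i.
  rewrite (eq_bigr (fun c : {ffun I -> F} => \prod_i io (c i) ^+ e i)); last first.
    by move=> c _; rewrite big_nil mulr1.
  rewrite -(bigA_distr_bigA (fun i (c : F) => io c ^+ e i)) (bigD1 i)//=.
  rewrite (eq_bigr (fun c : F => io (c ^+ e i))); last by move=> c _; rewrite rmorphXn.
  by rewrite -rmorph_sum sum_expf// rmorph0 mul0r.
rewrite /= addnS in he.
pose e' i j := (e j + (j == i))%N.
have e'E i c : \prod_j io (c j) ^+ e' i j = io (c i) * \prod_j io (c j) ^+ e j.
  rewrite (eq_bigr (fun j => io (c j) ^+ e j * io (c j) ^+ (j == i))); last first.
    by move=> j _; rewrite exprD.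
  rewrite big_split /= mulrC (bigD1 i)//= eqxx expr1 big1 ?mulr1// => j /negPf ->.
  by rewrite expr0.
rewrite (eq_bigr (fun c : {ffun I -> F} => l.1 * ((\prod_i io (c i) ^+ e i) * \prod_(l <- L) affine l c)
   + \sum_i l.2 i * ((\prod_j io (c j) ^+ e' i j) * \prod_(l <- L) affine l c))); last first.
  move=> c _; rewrite big_cons {1}/affine mulrDl mulrDr mulrCA; congr (_ + _).
  rewrite mulr_suml mulr_sumr; apply: eq_bigr => i _; rewrite e'E.
  by rewrite !mulrA; congr (_ * _); rewrite -!mulrA mulrC -mulrA [in RHS]mulrC; ring.
rewrite big_split /= -mulr_sumr IH ?mulr0 ?add0r; last exact: ltnW.
rewrite exchange_big /= big1// => i _; rewrite -mulr_sumr IH ?mulr0//.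
have -> : (\sum_j e' i j = (\sum_j e j).+1)%N.
  rewrite big_split /= (bigD1 i (F := fun j => nat_of_bool (j == i)))//= eqxx.
  by rewrite [X in (_ + (_ + X))%N]big1 ?addn0 ?addn1// => j /negPf ->.
by rewrite addSn.
Qed.

Lemma sum_prod_affine (L : seq (K * (I -> K))) : (size L < #|I| * q.-1)%N ->
  \sum_(c : {ffun I -> F}) \prod_(l <- L) affine l c = 0.
Proof.
move=> sL; have := @sum_prod_affine_monomial L (fun=> 0%N).
rewrite sum_nat_const muln0 add0n => /(_ sL) h; rewrite -[RHS]h; apply: eq_bigr => c _.
by rewrite [X in _ = X * _]big1 ?mul1r// => i _; rewrite expr0.
Qed.

(** Factors lose their constant terms one at a time: each replacement changes the sum by a constant
    times a sum of products with one factor less, to which [sum_prod_affine] applies. *)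
Lemma sum_prod_affine_top (L : seq (K * (I -> K))) : (size L <= #|I| * q.-1)%N ->
  \sum_(c : {ffun I -> F}) \prod_(l <- L) affine l c =
  \sum_(c : {ffun I -> F}) \prod_(l <- L) affine (0, l.2) c.
Proof.
suff H L1 : (size L1 + size L <= #|I| * q.-1)%N ->
    \sum_(c : {ffun I -> F}) (\prod_(l <- L1) affine l c) * \prod_(l <- L) affine l c =
    \sum_(c : {ffun I -> F}) (\prod_(l <- L1) affine l c) * \prod_(l <- L) affine (0, l.2) c.
  move=> sL; have := H [::] sL; congr (_ = _);
    by apply: eq_bigr => c _; rewrite big_nil mul1r.
elim: L L1 => [|l L IH] L1 //= sL.
  by apply: eq_bigr => c _; rewrite !big_nil.
transitivity (\sum_(c : {ffun I -> F}) (\prod_(l <- (0, l.2) :: L1) affine l c) * \prod_(l <- L) affine l c).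
  rewrite -[RHS]addr0; have := @sum_prod_affine (L1 ++ L).
  rewrite size_cat => /(_ _)/(congr1 ( *%R l.1)); rewrite mulr0 => h.
  rewrite -[X in _ = _ + X]h; last by rewrite -addnS.
  rewrite mulr_sumr -big_split; apply: eq_bigr => c _; rewrite big_cat !big_cons /=.
  have -> : affine l c = l.1 + affine (0, l.2) c by rewrite /affine /= add0r.
  by ring.
rewrite IH /=; last by rewrite addSnnS.
by apply: eq_bigr => c _; rewrite !big_cons; ring.
Qed.

End Forms.

Section LinearForms.
Context {s d : nat} (L : 'M[F]_(s, d) -> K).
Context (LD : {morph L : m m' / m + m'}).
Context (LZ : forall c m, L (c *: m) = io c * L m).
Context (frob : forall k (x y : K), (x + y) ^+ (q ^ k) = x ^+ (q ^ k) + y ^+ (q ^ k)).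

(** The exponent q^k - 1 is \sum_(l < k) (q - 1) q^l, and (y + L m)^(q^l) is affine in the entries
    of m because the Frobenius is additive and fixes F: the power is a product of k (q - 1) affine
    forms in s d variables. *)
Let form (y : K) l : K * ('I_s * 'I_d -> K) :=
  (y ^+ (q ^ l), fun ij => L (delta_mx ij.1 ij.2) ^+ (q ^ l)).
Let forms (y : K) k := flatten [seq nseq q.-1 (form y l) | l <- iota 0 k].

Let size_forms y k : size (forms y k) = (k * q.-1)%N.
Proof.
rewrite size_flatten /shape -map_comp sumnE big_map.
rewrite (eq_bigr (fun=> q.-1)); last by move=> l _ /=; rewrite size_nseq.
by rewrite big_const_seq count_predT size_iota iter_addn_0 mulnC.
Qed.

Let mx (c : {ffun 'I_s * 'I_d -> F}) : 'M[F]_(s, d) := \matrix_(i, j) c (i, j).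

Let mx_bij : bijective mx.
Proof.
exists (fun m : 'M[F]_(s, d) => [ffun ij : 'I_s * 'I_d => m ij.1 ij.2]).
  by move=> c; apply/ffunP => -[i j]; rewrite !ffunE mxE.
by move=> m; apply/matrixP => i j; rewrite mxE ffunE.
Qed.

Let prod_forms y k c :
  \prod_(l <- forms y k) affine l c = \prod_(0 <= l < k) ((y + L (mx c)) ^+ (q ^ l)) ^+ q.-1.
Proof.
have L0 : L 0 = 0 by rewrite -(scale0r (0 : 'M[F]_(s, d))) LZ rmorph0 mul0r.
rewrite /forms big_flatten /= big_map /index_iota subn0; apply: eq_bigr => l _.
rewrite big_nseq iter_mulr_1; congr (_ ^+ _).
rewrite /affine /form /= frob; congr (_ + _).
have -> : mx c = \sum_ij c ij *: delta_mx ij.1 ij.2.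
  rewrite (matrix_sum_delta (mx c)) pair_big /=; apply: eq_bigr => -[i j] _ /=.
  by rewrite mxE.
have frob0 : (0 : K) ^+ (q ^ l) = 0 by rewrite expr0n eqn0Ngt expn_gt0 q_gt0.
rewrite (big_morph L LD L0) (big_morph (fun u => u ^+ (q ^ l)) (frob l) frob0).
apply: eq_bigr => ij _; rewrite LZ exprMn; congr (_ * _).
elim: l {frob0} => [|l IH]; first by rewrite expn0 expr1.
by rewrite expnSr exprM -IH -rmorphXn /= expf_card.
Qed.

Let prod_pow (y : K) k : \prod_(0 <= l < k) (y ^+ (q ^ l)) ^+ q.-1 = y ^+ (q ^ k).-1.
Proof.
elim: k => [|k IH]; first by rewrite big_geq// expn0 expr0.
rewrite big_nat_recr//= IH -exprM -exprD; congr (_ ^+ _).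
have := q_gt0 (F := F); have : (0 < q ^ k)%N by rewrite expn_gt0 q_gt0.
rewrite expnS; case: (q) => // p; case: (p.+1 ^ k)%N => // r _ _; lia.
Qed.

Lemma sum_linear_pow k y : (k < s * d)%N ->
  \sum_(m : 'M[F]_(s, d)) (y + L m) ^+ (q ^ k).-1 = 0.
Proof.
move=> ksd; rewrite (reindex mx) /=; last exact: onW_bij.
rewrite (eq_bigr (fun c => \prod_(l <- forms y k) affine l c)); last first.
  by move=> c _; rewrite prod_forms prod_pow.
rewrite sum_prod_affine// size_forms card_prod !card_ord ltn_pmul2r//.
by rewrite -ltnS prednK ?q_gt0 ?q_gt1.
Qed.

(** With exactly s d (q - 1) forms the sum need not vanish, but only the homogeneous parts of the
    forms contribute, and y occurs in the constant terms alone. *)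
Lemma sum_linear_pow_top y :
  \sum_(m : 'M[F]_(s, d)) (y + L m) ^+ (q ^ (s * d)).-1 =
  \sum_(m : 'M[F]_(s, d)) L m ^+ (q ^ (s * d)).-1.
Proof.
have E w : \sum_(m : 'M[F]_(s, d)) (w + L m) ^+ (q ^ (s * d)).-1 =
    \sum_(c : {ffun 'I_s * 'I_d -> F}) \prod_(l <- forms w (s * d)) affine l c.
  rewrite (reindex mx) /=; last exact: onW_bij.
  by apply: eq_bigr => c _; rewrite prod_forms prod_pow.
have T w : \sum_(c : {ffun 'I_s * 'I_d -> F}) \prod_(l <- forms w (s * d)) affine l c =
    \sum_(c : {ffun 'I_s * 'I_d -> F}) \prod_(l <- forms 0 (s * d)) affine (0, l.2) c.
  rewrite sum_prod_affine_top ?size_forms ?card_prod ?card_ord//; apply: eq_bigr => c _.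
  rewrite /forms !big_flatten /= !big_map; apply: eq_bigr => l _.
  by rewrite !big_nseq.
transitivity (\sum_(m : 'M[F]_(s, d)) (0 + L m) ^+ (q ^ (s * d)).-1).
  by rewrite !E !T.
by apply: eq_bigr => m _; rewrite add0r.
Qed.

End LinearForms.
End PowerSums.

(** * Anderson generating functions *)

Section Agf.
Context {F : finFieldType} {R : realType} {X : valuedField F R}.
Context (hX : vcomplete X).
Local Notation q := #|F|.
Local Notation N := (@vabs F R X).
Local Notation G := (@gauss_norm F R X).
Local Notation T := (tate X).
Local Notation th := (vtheta X).
Local Notation A := {poly F}.
Context {n : nat} {z : 'rV[X]_n.+1} (Oz : Omega z).
Local Notation e_ := (lattice_exp (lattice z)).

Lemma of_coefs_mod_inj s (M : A) (m m' : 'M[F]_(s, (size M).-1)) (b b' : 'cV[A]_s) :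
  M != 0 -> of_coefs m + M *: b = of_coefs m' + M *: b' -> m = m'.
Proof.
move=> M0; have sM : size M = (size M).-1.+1 by rewrite prednK// size_poly_gt0.
move=> mb; apply/row_matrixP => i; apply: (can_inj rVpolyK).
have := congr1 (fun a : 'cV[A]_s => a i 0 %% M) mb; rewrite /= !mxE !modpD !modp_mulr !addr0.
by rewrite !modp_small// [ltnRHS]sM ltnS size_poly.
Qed.

Lemma imag_le_zdot a : a != 0 -> imag z <= N (zdot z a).
Proof.
move=> a0; apply: le_trans (zdot_ge z a0).
by rewrite ler_peMr ?exprn_ege1 ?qR_ge1// ltW// imag_gt0.
Qed.

(** For large j the argument is shorter than all nonzero lattice vectors, where e preserves absolute
    values. *)
Lemma agf_decays w : decays (fun j => e_ (w / th ^+ j.+1)).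
Proof.
apply/decaysP => e e0; have i0 := imag_gt0 hX Oz.
have ei0 : 0 < Num.min e (imag z) by rewrite lt_min e0 i0.
have w1 : 0 < N w + 1 by rewrite ltr_wpDl ?vabs_ge0.
have [d hd] := @qRV_small F R (Num.min e (imag z) / (N w + 1)) (divr_gt0 ei0 w1).
exists d => j dj; have : N (w / th ^+ j.+1) < Num.min e (imag z).
  rewrite vabsM vabsV vabsX vabs_theta ltr_pdivrMr ?qRX_gt0//.
  move: hd; rewrite ltr_pdivlMr// ltr_pdivrMl ?qRX_gt0// => hd.
  apply: le_lt_trans (_ : _ <= N w + 1) _; first by rewrite lerDl.
  apply: lt_le_trans hd _; rewrite mulrC; apply: (ler_wpM2l (ltW ei0)).
  by rewrite ler_eXn2l ?qR_gt1// ltnW.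
rewrite lt_min => /andP[h1 h2]; rewrite (lattice_exp_small hX Oz)// => a a0.
exact: lt_le_trans h2 (imag_le_zdot a0).
Qed.

Definition agf w : T := Tate (agf_decays w).

Lemma agfD : {morph agf : w w' / w + w'}.
Proof. by move=> w w'; apply: tateP => j /=; rewrite mulrDl lattice_expD. Qed.

Lemma agf0 : agf 0 = 0.
Proof. by apply: (@addrI _ (agf 0)); rewrite -agfD !addr0. Qed.

Lemma agf_vemb (c : F) w : agf (vemb X c * w) = vemb X c *: agf w.
Proof. by apply: tateP => j; rewrite tcoefZ /= -mulrA lattice_exp_vemb. Qed.

(** Multiplication by theta shifts the coefficients, and the one reaching degree 0 is the value of e
    at a lattice point, hence 0. On the lattice, theta thus acts as t. *)
Lemma agf_theta a : agf (th * zdot z a) = chi 'X * agf (zdot z a).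
Proof.
apply: tateP => -[|j]; rewrite tcoefM.
  rewrite big_ord_recl big_ord0 tcoef_chi coefX rmorph0 mul0r addr0 /=.
  by rewrite expr1 mulrC mulKf ?theta_neq0// lattice_exp_zdot.
rewrite big_ord_recl big_ord_recl big1 ?addr0; last first.
  by move=> i _; rewrite tcoef_chi coefX /= rmorph0 mul0r.
rewrite !tcoef_chi !coefX rmorph0 mul0r add0r rmorph1 mul1r /= subSS subn0.
by rewrite [th ^+ j.+2]exprS -mulf_div divff ?theta_neq0// mul1r.
Qed.

Lemma agf_Aemb p a : agf (Aemb X p * zdot z a) = chi p * agf (zdot z a).
Proof.
elim/poly_ind: p => [|p c IH]; first by rewrite !rmorph0 !mul0r agf0.
rewrite !rmorphD !rmorphM /= AembX AembC chiC !mulrDl agfD agf_vemb mulr_algl.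
congr (_ + _); rewrite mulrAC [_ * th]mulrC -zdotZ agf_theta zdotZ IH.
by rewrite mulrCA mulrA.
Qed.

Lemma delta_zdot i : zdot z (delta_mx i 0) = z 0 i.
Proof.
rewrite zdotE (bigD1 i)//= mxE !eqxx rmorph1 mulr1 big1 ?addr0// => j ji.
by rewrite mxE (negPf ji) rmorph0 mulr0.
Qed.

Lemma agf_zdot a : agf (zdot z a) = \sum_i chi (a i 0) * agf (z 0 i).
Proof.
rewrite zdotE (big_morph agf agfD agf0); apply: eq_bigr => i _.
by rewrite mulrC -delta_zdot agf_Aemb.
Qed.

Lemma chi_sums (y : 'cV[A]_n.+1 -> X) : nullfam N y ->
  exists E : 'cV[T]_n.+1, forall i, sums G (fun a => y a *: chi (a i 0)) (E i 0).
Proof.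
move=> yn; have /choice[E hE] (i : 'I_n.+1) :
    exists E, sums G (fun a => y a *: chi (a i 0)) E.
  apply: (null_sums gauss_un (gauss_ucomplete (vabs_ucomplete hX))).
  move=> e /yn[S hS]; exists S => a /hS; apply: le_lt_trans.
  by rewrite gaussZ ler_piMr ?vabs_ge0 ?gauss_chi.
by exists (\col_i E i) => i; rewrite mxE.
Qed.

Lemma null_zdotX k : (0 < k)%N -> nullfam N (fun a => (zdot z a ^+ k)^-1).
Proof.
move=> k0 e e0; have e1 : 0 < Num.min e 1 by rewrite lt_min e0 ltr01.
have [S hS] := null_inv_zdot hX Oz 0 e1; exists S => a /hS.
rewrite sub0r invrN vabsN lt_min => /andP[h1 h2].
rewrite -exprVn vabsX; case: k k0 => // k _; apply: le_lt_trans h1.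
by rewrite exprS ler_piMr ?vabs_ge0// exprn_ile1 ?vabs_ge0// ltW.
Qed.

Lemma Eis_sums k i : (0 < k)%N ->
  sums G (fun a => (zdot z a ^+ k)^-1 *: chi (a i 0)) (Eis k z i 0).
Proof.
move=> k0; have [E hE] := chi_sums (null_zdotX k0).
suff -> : Eis k z i 0 = E i 0 by exact: hE.
rewrite mxE; apply: (sums_nsum gauss_un); apply: sums_ext (hE i) => a.
case: eqP => //= ->; rewrite zdot0 expr0n eqn0Ngt k0 invr0 scale0r//.
Qed.

Lemma Eis_itau k i : Eis (q ^ k) z i 0 = itau k (Eis 1 z i 0).
Proof.
apply: (sums_uniq gauss_un (Eis_sums i (qX_gt0 k))).
apply: sums_ext (sums_itau k (Eis_sums i (ltn0Sn 0))) => a.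
by rewrite itauZ itau_chi expr1 exprVn.
Qed.

(** The twist fixes chi, so that \sum_i chi(a_i) tau^k(agf(z_i)) is tau^k(agf(z a)); its coefficient
    of t^j depends on a modulo theta^(j+1) only. *)
Lemma agf_pairing k (y : 'cV[A]_n.+1 -> X) (E : 'cV[T]_n.+1) j :
  (forall i, sums G (fun a => y a *: chi (a i 0)) (E i 0)) ->
  sums N (fun a => y a * e_ (zdot z a / th ^+ j.+1) ^+ (q ^ k))
    (tcoef (\sum_i itau k (agf (z 0 i)) * E i 0) j).
Proof.
move=> yE.
have h : sums G (fun a => \sum_i itau k (agf (z 0 i)) * (y a *: chi (a i 0)))
    (\sum_i itau k (agf (z 0 i)) * E i 0).
  by apply: (sums_sum gauss_un) => i _; exact: sums_mull.
have := sums_tcoef j h.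
apply: sums_ext => a; rewrite (eq_bigr (fun i => y a *: itau k (chi (a i 0) * agf (z 0 i)))).
  by rewrite -scaler_sumr -rmorph_sum -agf_zdot tcoefZ tcoef_itau.
by move=> i _; rewrite rmorphM /= itau_chi -scalerAr mulrC.
Qed.

Local Notation tors M m := (e_ (zdot z (of_coefs m) / Aemb X M)).

(* Grouping the lattice points modulo M turns a sum of 1/(w - l), weighted by a
   function of l modulo M, into a sum over the M-torsion points. *)
Lemma sum_torsion (M : A) w (g : 'cV[A]_n.+1 -> X) (g0 : 'M[F]_(n.+1, (size M).-1) -> X) t :
  M != 0 -> sums N (fun a => (w - zdot z a)^-1 * g a) t ->
  (forall m b, g (of_coefs m + M *: b) = g0 m) ->
  (forall m, (forall b, w <> zdot z (of_coefs m + M *: b)) \/ g0 m = 0) ->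
  t = (Aemb X M)^-1 * \sum_m g0 m / (e_ (w / Aemb X M) - tors M m).
Proof.
move=> M0 st gg0 wg.
have AM0 : Aemb X M != 0 by rewrite Aemb_eq0.
rewrite mulr_sumr; apply: (sums_mod vabs_un M0 st) => m.
have [wm|g0m] := wg m; last first.
  rewrite g0m mul0r mulr0; apply: (sums_ext _ (sums0 vabs_un)) => b.
  by rewrite gg0 g0m mulr0.
have h b : w / Aemb X M - zdot z (of_coefs m) / Aemb X M != zdot z b.
  apply/eqP => wb; case: (wm b); rewrite zdotD zdotZ -wb.
  by field.
have := sums_mulX ((Aemb X M)^-1 * g0 m) (sums_inv_zdot hX Oz h).
rewrite (lattice_expB hX Oz) -mulrA; apply: sums_ext => b; rewrite gg0 zdotD zdotZ.
have -> : w - (zdot z (of_coefs m) + Aemb X M * zdot z b) =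
    Aemb X M * (w / Aemb X M - zdot z (of_coefs m) / Aemb X M - zdot z b) by field.
by rewrite invfM mulrAC.
Qed.

Lemma sum_torsion1 (M : A) w : M != 0 -> (forall a, w != zdot z a) ->
  \sum_(m : 'M[F]_(n.+1, (size M).-1)) (e_ (w / Aemb X M) - tors M m)^-1 =
  Aemb X M / e_ w.
Proof.
move=> M0 hw; have AM0 : Aemb X M != 0 by rewrite Aemb_eq0.
have := @sum_torsion M w (fun=> 1) (fun=> 1) (e_ w)^-1 M0.
rewrite (_ : (fun a => _) = fun a => (w - zdot z a)^-1); last first.
  by apply/funext => a; rewrite mulr1.
move=> /(_ (sums_inv_zdot hX Oz hw)) ->//; last first.
  by move=> m; left => b; apply/eqP.
by rewrite mulVKf//; apply: eq_bigr => m _; rewrite mul1r.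
Qed.

Lemma torsD (M : A) : {morph (fun m : 'M[F]_(n.+1, (size M).-1) => tors M m) : m m' / m + m'}.
Proof. by move=> m m'; rewrite of_coefsD zdotD mulrDl lattice_expD. Qed.

Lemma torsZ (M : A) c (m : 'M[F]_(n.+1, (size M).-1)) : tors M (c *: m) = vemb X c * tors M m.
Proof. by rewrite of_coefsZ zdotZ AembC -mulrA lattice_exp_vemb. Qed.

Lemma tors_eq0 (M : A) (m : 'M[F]_(n.+1, (size M).-1)) : M != 0 -> (tors M m == 0) = (m == 0).
Proof.
move=> M0; apply/eqP/eqP => [|->]; last by rewrite of_coefs0 zdot0 mul0r lattice_exp0.
have AM0 : Aemb X M != 0 by rewrite Aemb_eq0.
move=> /(lattice_exp_eq0 hX Oz)[b] /(congr1 (fun u => u * Aemb X M)).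
rewrite divfK// mulrC -zdotZ => /(zdot_inj hX Oz) mb.
by apply: (@of_coefs_mod_inj _ M _ _ (- b) 0 M0); rewrite of_coefs0 scaler0 mb scalerN subrr addr0.
Qed.

Lemma sizeXn_pred j : (size ('X^(j.+1) : A)).-1 = j.+1. Proof. by rewrite size_polyXn. Qed.
Lemma Xn_neq0 j : 'X^(j.+1) != 0 :> A. Proof. by rewrite -size_poly_gt0 size_polyXn. Qed.
Lemma AembXn j : Aemb X 'X^(j.+1) = th ^+ j.+1. Proof. by rewrite rmorphXn /= AembX. Qed.

Lemma agf_mod (M : A) (m : 'M[F]_(n.+1, (size M).-1)) b : M != 0 ->
  e_ (zdot z (of_coefs m + M *: b) / Aemb X M) = tors M m.
Proof.
move=> M0; have AM0 : Aemb X M != 0 by rewrite Aemb_eq0.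
rewrite zdotD zdotZ mulrDl [Aemb X M * _]mulrC mulfK//.
by rewrite lattice_expD// lattice_exp_zdot// addr0.
Qed.

Lemma tors_pow_sum (M : A) k : M != 0 -> (k < n.+1 * (size M).-1)%N -> forall y,
  \sum_(m : 'M[F]_(n.+1, (size M).-1)) (y - tors M m) ^+ (q ^ k).-1 = 0.
Proof.
move=> M0 k0 y.
rewrite -[RHS](sum_linear_pow (@torsD M) (@torsZ M) (@frobD _ _ X) y k0).
rewrite (reindex_inj oppr_inj) /=.
by apply: eq_bigr => m _; rewrite of_coefsN zdotN mulNr lattice_expN// opprK.
Qed.

Lemma tors_pow_top (M : A) y :
  \sum_(m : 'M[F]_(n.+1, (size M).-1)) (y - tors M m) ^+ (q ^ (n.+1 * (size M).-1)).-1 =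
  \sum_(m : 'M[F]_(n.+1, (size M).-1)) tors M m ^+ (q ^ (n.+1 * (size M).-1)).-1.
Proof.
rewrite -[RHS](sum_linear_pow_top (@torsD M) (@torsZ M) (@frobD _ _ X) y).
rewrite (reindex_inj oppr_inj) /=.
by apply: eq_bigr => m _; rewrite of_coefsN zdotN mulNr lattice_expN// opprK.
Qed.

Lemma card_mx_eq0 (M : A) : (0 < (size M).-1)%N -> \sum_(m : 'M[F]_(n.+1, (size M).-1)) (1 : X) = 0.
Proof.
move=> M0; rewrite sumr_const card_mx natrX q_eq0 expr0n.
by rewrite muln_eq0 /= eqn0Ngt M0.
Qed.

(** A power sum over the space of theta-torsion points, of dimension r = n.+1 over F_q; q^r - 1 is
    the first exponent of the form q^k - 1 to which [sum_linear_pow] does not apply. *)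
Definition kappa : X :=
  th^-1 * \sum_(m : 'M[F]_(n.+1, (size ('X^1 : A)).-1)) tors 'X^1 m ^+ (q ^ n.+1).-1.

Lemma inv_theta_sub_decays : decays (fun j => - th ^- j.+1).
Proof.
apply/decaysP => e e0; have [d hd] := @qRV_small F R e e0; exists d => j dj.
rewrite vabsN vabsV vabsX vabs_theta; apply: le_lt_trans hd.
by rewrite lef_pV2 ?posrE ?qRX_gt0// ler_eXn2l ?qR_gt1// ltnW.
Qed.

Definition inv_t_sub_theta : T := Tate inv_theta_sub_decays.

Lemma expf_divr (x : X) k : (1 < k)%N -> x ^+ k / x = x ^+ k.-1.
Proof.
case: k => // -[//|k] _; have [->|x0] := eqVneq x 0; first by rewrite !expr0n /= mul0r.
by rewrite exprS mulrAC divff// mul1r.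
Qed.

Lemma qX_gt1 k : (0 < k)%N -> (1 < q ^ k)%N.
Proof. by move=> k0; rewrite -(exp1n k) ltn_exp2r// q_gt1. Qed.

Lemma tors_pow_sum0 (M : A) k : M != 0 -> (k < n.+1 * (size M).-1)%N ->
  \sum_(m : 'M[F]_(n.+1, (size M).-1)) tors M m ^+ (q ^ k).-1 = 0.
Proof.
move=> M0 k0; rewrite -[RHS](tors_pow_sum M0 k0 0) (reindex_inj oppr_inj) /=.
by apply: eq_bigr => m _; rewrite of_coefsN zdotN mulNr lattice_expN// sub0r.
Qed.

(** This is [sum_torsion] at w = 0. The class m = 0 contains the pole, but its numerator is 0, and 0
    / 0 is read as 0. *)
Lemma tcoef_agf_Eis k j : tcoef (\sum_i itau k (agf (z 0 i)) * Eis 1 z i 0) j =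
  th ^- j.+1 * \sum_(m : 'M[F]_(n.+1, (size ('X^(j.+1) : A)).-1))
     tors 'X^(j.+1) m ^+ (q ^ k) / tors 'X^(j.+1) m.
Proof.
set t := tcoef _ j.
have st : sums N (fun a => (0 - zdot z a)^-1 * e_ (zdot z a / Aemb X 'X^(j.+1)) ^+ (q ^ k)) (- t).
  rewrite -mulN1r; have := agf_pairing k j (fun i => Eis_sums i (ltn0Sn 0)).
  move=> /(@sums_mulX _ _ _ _ _ _ (-1)); apply: sums_ext => a.
  by rewrite AembXn sub0r invrN !mulNr mul1r expr1.
have H1 (m : 'M[F]_(n.+1, (size ('X^(j.+1) : A)).-1)) b :
    e_ (zdot z (of_coefs m + 'X^(j.+1) *: b) / Aemb X 'X^(j.+1)) ^+ (q ^ k) =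
    tors 'X^(j.+1) m ^+ (q ^ k) by rewrite (agf_mod _ _ (Xn_neq0 j)).
have H2 (m : 'M[F]_(n.+1, (size ('X^(j.+1) : A)).-1)) :
    (forall b, 0 <> zdot z (of_coefs m + 'X^(j.+1) *: b)) \/ tors 'X^(j.+1) m ^+ (q ^ k) = 0.
  have [->|m0] := eqVneq m 0; [right|left => b /esym/eqP].
    by rewrite of_coefs0 zdot0 mul0r lattice_exp0// expr0n eqn0Ngt qX_gt0.
  rewrite (zdot_eq0 hX _ Oz) => /eqP mb; case/eqP: m0.
  by apply: (@of_coefs_mod_inj _ _ _ _ b 0 (Xn_neq0 j)); rewrite mb of_coefs0 scaler0 addr0.
have := sum_torsion (Xn_neq0 j) st H1 H2; rewrite mul0r lattice_exp0// => /eqP.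
rewrite eqr_oppLR -mulrN -sumrN AembXn => /eqP ->; congr (_ * _).
by apply: eq_bigr => m _; rewrite sub0r invrN mulrN opprK.
Qed.

(** Each nonzero torsion point contributes 1, and their number is -1 in X. *)
Lemma agf_Eis0 : \sum_i agf (z 0 i) * Eis 1 z i 0 = inv_t_sub_theta.
Proof.
apply: tateP => j; rewrite (tcoef_agf_Eis 0) /= -mulrN1; congr (_ * _).
have := card_mx_eq0 (M := 'X^(j.+1)); rewrite {1}sizeXn_pred => /(_ isT).
rewrite (bigD1 0) //= => /eqP; rewrite addrC addr_eq0 => /eqP <-.
rewrite (bigD1 0) //= of_coefs0 zdot0 mul0r lattice_exp0// expn0 expr1 mul0r add0r.
by apply: eq_bigr => m m0; rewrite ?expn0 ?expr1 divff// tors_eq0// Xn_neq0.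
Qed.

Lemma agf_Eis_lt k : (0 < k < n.+1)%N -> \sum_i itau k (agf (z 0 i)) * Eis 1 z i 0 = 0.
Proof.
move=> /andP[k0 kn]; apply: tateP => j; rewrite tcoef_agf_Eis tcoef0.
rewrite (eq_bigr _ (fun m _ => expf_divr _ (qX_gt1 k0))) tors_pow_sum0 ?mulr0 ?Xn_neq0//.
by rewrite sizeXn_pred (leq_trans kn)// leq_pmulr.
Qed.

(** The theta^(j+1)-torsion has dimension (n + 1)(j + 1), which exceeds n + 1 for j > 0: only the
    constant coefficient survives. *)
Lemma agf_Eis_top : \sum_i itau n.+1 (agf (z 0 i)) * Eis 1 z i 0 = kappa%:A.
Proof.
apply: tateP => j; rewrite tcoef_agf_Eis tcoefA.
rewrite (eq_bigr _ (fun m _ => expf_divr _ (qX_gt1 (ltn0Sn n)))).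
case: j => [|j] /=; first by rewrite /kappa expr1.
rewrite tors_pow_sum0 ?mulr0 ?Xn_neq0//.
by rewrite sizeXn_pred mulnS -[ltnLHS]addn0 ltn_add2l muln_gt0.
Qed.

(** As y^(q^k) - x^(q^k) = (y - x)^(q^k), the quotient x^(q^k) / (y - x) is y^(q^k) / (y - x) - (y -
    x)^(q^k - 1). The first part is summed by the logarithmic derivative; the second gives 0, or
    [kappa] at t^0 when k = r. *)
Lemma agf_series k w (E : 'cV[T]_n.+1) : (k <= n.+1)%N -> (forall a, w != zdot z a) ->
  (forall i, sums G (fun a => (w - zdot z a)^-1 *: chi (a i 0)) (E i 0)) ->
  \sum_i itau k (agf (z 0 i)) * E i 0 =
  (e_ w)^-1 *: itau k (agf w) - (if k == n.+1 then kappa%:A else 0).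
Proof.
move=> kn hw hE; apply: tateP => j; set M : A := 'X^(j.+1).
have M0 : M != 0 := Xn_neq0 j; have AM0 : Aemb X M != 0 by rewrite Aemb_eq0.
have := agf_pairing k j hE; set t := tcoef _ j => st.
have H1 (m : 'M[F]_(n.+1, (size M).-1)) b :
    e_ (zdot z (of_coefs m + M *: b) / th ^+ j.+1) ^+ (q ^ k) = tors M m ^+ (q ^ k).
  by rewrite -AembXn (agf_mod _ _ M0).
have H2 (m : 'M[F]_(n.+1, (size M).-1)) :
    (forall b, w <> zdot z (of_coefs m + M *: b)) \/ tors M m ^+ (q ^ k) = 0.
  by left => b; apply/eqP.
rewrite (sum_torsion M0 st H1 H2); set y := e_ (w / Aemb X M).
have yx m : y - tors M m != 0.
  rewrite -lattice_expB//; apply: lattice_exp_neq0 => // b.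
  have := hw (of_coefs m + M *: b); apply: contraNneq => wb.
  by apply/eqP; rewrite zdotD zdotZ -wb; field.
have E1 (m : 'M[F]_(n.+1, (size M).-1)) : tors M m ^+ (q ^ k) / (y - tors M m) =
    y ^+ (q ^ k) * (y - tors M m)^-1 - (y - tors M m) ^+ (q ^ k).-1.
  rewrite -[tors M m ^+ _](subKr (y ^+ (q ^ k))) -frobB mulrBl; congr (_ - _).
  have [k0|k0] := posnP k; first by rewrite k0 expn0 expr1 expr0 divff.
  by rewrite expf_divr// qX_gt1.
rewrite (eq_bigr _ (fun m _ => E1 m)) sumrB -mulr_sumr sum_torsion1//.
have ew := lattice_exp_neq0 hX Oz hw.
set S := \sum_m _; have -> : (Aemb X M)^-1 * (y ^+ (q ^ k) * (Aemb X M / e_ w) - S) =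
    (e_ w)^-1 * y ^+ (q ^ k) - (Aemb X M)^-1 * S by field; rewrite AM0 ew.
rewrite tcoefB tcoefZ tcoef_itau /= -AembXn -/M -/y; congr (_ - _); rewrite {}/S.
have [kE|kN] := eqVneq k n.+1; last first.
  rewrite tors_pow_sum ?mulr0 ?tcoef0//.
  have {}kn : (k < n.+1)%N by rewrite ltn_neqAle kN.
  by rewrite sizeXn_pred (leq_trans kn)// leq_pmulr.
rewrite tcoefA; case: j @M M0 AM0 @t st H1 H2 @y yx E1 => [|j] M M0 AM0 t st H1 H2 y yx E1 /=.
  have sM : (n.+1 * (size M).-1 = n.+1)%N by rewrite sizeXn_pred muln1.
  have := tors_pow_top M y; rewrite sM kE => ->.
  by rewrite /kappa; congr (_ * _); rewrite AembXn expr1.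
rewrite tors_pow_sum ?mulr0//.
by rewrite kE sizeXn_pred mulnS -[ltnLHS]addn0 ltn_add2l muln_gt0.
Qed.

End Agf.
Arguments kappa {F R X n} z.

(** * The determinant of the Eisenstein matrix is a unit *)

Section Determinant.
Context {F : finFieldType} {R : realType} {X : valuedField F R}.
Context (hX : vcomplete X).
Local Notation q := #|F|.
Local Notation N := (@vabs F R X).
Local Notation T := (tate X).
Local Notation th := (vtheta X).
Local Notation A := {poly F}.
Local Notation P0 := (@inv_t_sub_theta F R X).

Lemma inv_t_sub_thetaE : P0 * (chi 'X - th%:A) = 1.
Proof.
rewrite mulrC; apply: tateP => j; rewrite mulrBl tcoefB mulr_algl tcoefZ tcoefM tcoef1.
case: j => [|j].
  rewrite big_ord_recl big_ord0 tcoef_chi coefX rmorph0 mul0r !add0r /= expr1.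
  by rewrite mulrN opprK divff// theta_neq0.
rewrite big_ord_recl big_ord_recl big1 ?addr0; last first.
  by move=> i _; rewrite tcoef_chi coefX /= rmorph0 mul0r.
rewrite !tcoef_chi !coefX rmorph0 mul0r add0r rmorph1 mul1r /= subSS subn0.
by rewrite [th ^+ j.+2]exprS mulrN opprK invfM mulVKf ?theta_neq0// addNr.
Qed.

Lemma unit_inv_t_sub_theta : is_unit P0.
Proof. by exists (chi 'X - th%:A); exact: inv_t_sub_thetaE. Qed.

(* The coefficients of f all have the same absolute value or vanish; taking the
   last nonzero one and the last coefficient of maximal size of the inverse, f
   cannot have a nonzero coefficient of positive degree. *)
Lemma unit_tau_eigen (f : T) (x : X) : is_unit f -> tau f = x *: f -> exists c, f = c%:A.
Proof.
move=> [g fg] fx.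
have fE i : tcoef f i != 0 -> N (tcoef f i) ^+ q.-1 = N x.
  move=> fi; have h : tcoef f i ^+ q = x * tcoef f i by rewrite -tcoef_tau fx.
  apply: (mulIf (lt0r_neq0 (vabs_neq0 fi))).
  by rewrite -exprSr prednK ?q_gt0// -vabsX h vabsM.
have f0 : exists i, tcoef f i != 0.
  apply: contrapT => h; have /eqP := oner_neq0 T; apply; rewrite -fg.
  apply: tateP => i; rewrite tcoefM tcoef0 big1// => j _.
  suff -> : tcoef f j = 0 by rewrite mul0r.
  by apply/eqP; apply: contrapT => /negP fj; apply: h; exists j.
have g0 : exists i, tcoef g i != 0.
  apply: contrapT => h; have /eqP := oner_neq0 T; apply; rewrite -fg.
  apply: tateP => i; rewrite tcoefM tcoef0 big1// => j _.
  suff -> : tcoef g (i - j) = 0 by rewrite mulr0.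
  by apply/eqP; apply: contrapT => /negP fj; apply: h; exists (i - j)%N.
have last_max (h : T) : (exists i, tcoef h i != 0) -> exists i,
    [/\ tcoef h i != 0, forall j, N (tcoef h j) <= N (tcoef h i)
      & forall j, (i < j)%N -> N (tcoef h j) < N (tcoef h i)].
  move=> [i0 hi0]; have [n0 hn0] := proj1 (decaysP _) (tcoef_decays h) _ (vabs_neq0 hi0).
  have i0n : (i0 < n0)%N by rewrite ltnNge; apply/negP => /hn0; rewrite ltxx.
  have [i _ hi] := @arg_maxP _ R _ (Ordinal i0n) predT (fun i : 'I_n0 => N (tcoef h i)) isT.
  pose P j := [&& (j < n0)%N & N (tcoef h j) == N (tcoef h i)].
  have exP : exists j, P j by exists i; rewrite /P ltn_ord eqxx.
  have ubP j : P j -> (j <= n0)%N by move=> /andP[/ltnW].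
  have [k /andP[kn /eqP hk] maxk] := ex_maxnP exP ubP.
  have le j : N (tcoef h j) <= N (tcoef h k).
    rewrite hk; have [jn|nj] := ltnP j n0; first exact: (hi (Ordinal jn)).
    apply: le_trans (ltW (hn0 _ nj)) _; exact: (hi (Ordinal i0n)).
  exists k; split => //.
    rewrite -vabs_gt0; apply: lt_le_trans (vabs_neq0 hi0) _; exact: le.
  move=> j kj; rewrite lt_neqAle le andbT; apply/negP => /eqP jk.
  have [jn|nj] := ltnP j n0.
    have : (j <= k)%N by apply: maxk; rewrite /P jn jk hk eqxx.
    by rewrite leqNgt kj.
  have := hn0 _ nj; rewrite jk => /lt_le_trans/(_ (le i0)).
  by rewrite ltxx.
have [i [fi _ hi]] := last_max f f0; have [k [gk hk1 hk2]] := last_max g g0.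
have fj0 j : (i < j)%N -> tcoef f j = 0.
  move=> /hi lt; apply/eqP; apply: contrapT => /negP fj.
  have := ltrXn2r q.-1 (vabs_ge0 _) lt; rewrite (fE j)// (fE i)// ltxx.
  by have := q_gt1 (F := F); case: (q) => [|[|p]].
have f_le : forall j, N (tcoef f j) <= N (tcoef f i).
  move=> j; have [->|fj] := eqVneq (tcoef f j) 0; first by rewrite vabs0 vabs_ge0.
  rewrite leNgt; apply/negP => lt; have := ltrXn2r q.-1 (vabs_ge0 _) lt.
  rewrite (fE j)// (fE i)// ltxx.
  by have := q_gt1 (F := F); case: (q) => [|[|p]].
have i0 : i = 0%N.
  apply/eqP; rewrite eqn0Ngt; apply/negP => i0.
  have : tcoef (f * g) (i + k) = 0.
    by rewrite fg tcoef1 addn_eq0 eqn0Ngt i0.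
  have ik : (i < (i + k).+1)%N by rewrite ltnS leq_addr.
  rewrite tcoefM (bigD1 (Ordinal ik)) //= addKn => /eqP; rewrite addr_eq0 => /eqP h.
  have fgk : 0 < N (tcoef f i * tcoef g k) by rewrite vabs_gt0 mulf_neq0.
  have : N (tcoef f i * tcoef g k) < N (tcoef f i * tcoef g k); last by rewrite ltxx.
  rewrite {1}h vabsN; apply: vabs_sum_lt => // j ji.
  have [ij|ij|ij] := ltngtP i j.
  - by rewrite fj0// mul0r vabs0.
  - rewrite !vabsM; apply: le_lt_trans (_ : N (tcoef f i) * N (tcoef g (i + k - j)) < _).
      by apply: (ler_wpM2r (vabs_ge0 _)); exact: f_le.
    rewrite ltr_pM2l ?vabs_gt0//; apply: hk2.
    by have := ltn_ord j; lia.
  - by case/eqP: ji; apply/val_inj.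
exists (tcoef f 0); apply: tateP => j; rewrite tcoefA; case: eqP => [->//|/eqP j0].
by apply: fj0; rewrite i0 lt0n.
Qed.

Context {n : nat} {z : 'rV[X]_n.+1} (Oz : Omega z).
Local Notation agf := (agf hX Oz).

Definition agf_mx : 'M[T]_n.+1 := \matrix_(k, i) itau k (agf (z 0 i)).

Lemma Xi_itau i j : Xi z i j = itau j (Eis 1 z i 0).
Proof. by rewrite [LHS]mxE (Eis_itau hX Oz). Qed.

Lemma Xi_Xi_tau : Xi z = Xi_tau z.
Proof. by apply/matrixP => i j; rewrite Xi_itau [RHS]mxE. Qed.

Lemma agf_mul k j : (j <= k)%N -> \sum_i itau k (agf (z 0 i)) * itau j (Eis 1 z i 0) =
  itau j (\sum_i itau (k - j) (agf (z 0 i)) * Eis 1 z i 0).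
Proof.
move=> jk; rewrite rmorph_sum; apply: eq_bigr => i _.
by rewrite rmorphM /= -itauD subnKC.
Qed.

Let C : T := \prod_(i < n) itau i.+1 P0.

Lemma det_agf_Xi : \det agf_mx * \det (Xi z) = \prod_(i < n.+1) itau i P0.
Proof.
rewrite -det_mulmx -det_tr det_trig; last first.
  apply/is_trig_mxP => i j ij; rewrite !mxE.
  rewrite (eq_bigr (fun l => itau j (agf (z 0 l)) * itau i (Eis 1 z l 0))); last first.
    by move=> l _; rewrite Xi_itau mxE.
  by rewrite agf_mul 1?ltnW// agf_Eis_lt ?rmorph0// subn_gt0 ij (leq_ltn_trans (leq_subr _ _)).
apply: eq_bigr => i _; rewrite !mxE.
rewrite (eq_bigr (fun l => itau i (agf (z 0 l)) * itau i (Eis 1 z l 0))); last first.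
  by move=> l _; rewrite Xi_itau mxE.
by rewrite agf_mul// subnn agf_Eis0.
Qed.

Lemma unit_det_Xi : is_unit (\det (Xi z)).
Proof.
apply: (@is_unitMl _ _ _ _ (\det agf_mx)); rewrite mulrC det_agf_Xi.
by apply: is_unit_prod => i _; apply: is_unit_tau; exact: unit_inv_t_sub_theta.
Qed.

Lemma unit_det_agf : is_unit (\det agf_mx).
Proof.
apply: (@is_unitMl _ _ _ _ (\det (Xi z))); rewrite det_agf_Xi.
by apply: is_unit_prod => i _; apply: is_unit_tau; exact: unit_inv_t_sub_theta.
Qed.

Lemma tau_agf_Eis (k : 'I_n.+1) :
  \sum_i itau k.+1 (agf (z 0 i)) * Eis 1 z i 0 = if k == ord_max then (kappa z)%:A else 0.
Proof.
case: eqP => [->|kn]; first exact: agf_Eis_top.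
apply: agf_Eis_lt => /=; rewrite ltnS ltn_neqAle -ltnS ltn_ord andbT.
by apply/eqP => kn'; apply: kn; apply/val_inj.
Qed.

(** After one twist the units move just above the diagonal and kappa appears in the lower left
    corner, alone in its column. Expansion along this column leaves a triangular minor and the sign
    (-1)^n of the corner. *)
Lemma det_tau_agf_Xi :
  tau (\det agf_mx) * \det (Xi z) = ((-1) ^+ n * kappa z) *: C.
Proof.
rewrite -det_map_mx -det_mulmx; set Q := _ *m _.
have QE (k j : 'I_n.+1) : Q k j = \sum_i itau k.+1 (agf (z 0 i)) * itau j (Eis 1 z i 0).
  by rewrite mxE; apply: eq_bigr => i _; rewrite Xi_itau !mxE.
have Qz (k j : 'I_n.+1) : (0 < j <= k)%N -> Q k j = 0.
  move=> /andP[j0 jk]; rewrite QE agf_mul ?leqW// agf_Eis_lt ?rmorph0//.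
  by have := ltn_ord k; lia.
rewrite (expand_det_col Q 0) (bigD1 ord_max) //= big1 ?addr0; last first.
  by move=> k kn; rewrite QE /= (tau_agf_Eis k) (negPf kn) mul0r.
rewrite QE /= (tau_agf_Eis ord_max) eqxx /cofactor addn0.
rewrite -det_tr det_trig; last first.
  apply/is_trig_mxP => i j ij; rewrite 3!mxE Qz//=.
  by rewrite /bump leq0n [(n <= j)%N]leqNgt ltn_ord /= add1n add0n.
rewrite mulr_algl; move: (kappa z) => kz; rewrite [_ * kz]mulrC -scalerA; congr (_ *: _).
rewrite -!(signr_odd _ n) scaler_sign -mulr_sign; congr (_ * _).
apply: eq_bigr => i _; rewrite 3!mxE QE.
have -> : (lift ord_max i : 'I_n.+1) = i :> nat by rewrite /= /bump leqNgt ltn_ord.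
have -> : (lift ord0 i : 'I_n.+1) = i.+1 :> nat by [].
by rewrite agf_mul// subnn agf_Eis0.
Qed.

(* Uniform in z up to the scalar, so that ratios of determinants at two points
   are eigenvectors of tau. *)
Lemma tau_det_Xi :
  ((-1) ^+ n * kappa z) *: tau (\det (Xi z)) = itau n.+1 P0 * \det (Xi z).
Proof.
have uC : is_unit C by apply: is_unit_prod => i _; apply: is_unit_tau; exact: unit_inv_t_sub_theta.
apply: (is_unit_mulI uC); rewrite -scalerAr scalerAl -det_tau_agf_Xi.
rewrite mulrAC -rmorphM det_agf_Xi rmorph_prod big_ord_recr /= mulrA.
by congr (_ * _ * _).
Qed.

(** The right-hand side of [tau_det_Xi] is a unit, so its left-hand side cannot vanish. *)
Lemma kappa_neq0 : kappa z != 0.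
Proof.
apply/eqP => k0; have := tau_det_Xi; rewrite k0 mulr0 scale0r => /esym/eqP; apply/negP.
apply: is_unit_neq0; apply: is_unitM unit_det_Xi.
by apply: is_unit_tau; exact: unit_inv_t_sub_theta.
Qed.

End Determinant.

Section Ratio.
Context {F : finFieldType} {R : realType} {X : valuedField F R}.
Context (hX : vcomplete X).
Local Notation T := (tate X).

(** Comparing [tau_det_Xi] at z and at z0 eliminates the common factor tau^(n+1)(1/(t - theta)) and
    leaves the eigenvalue kappa z0 / kappa z. *)
Lemma det_Xi_ratio n (z z0 : 'rV[X]_n.+1) (nu : T) : Omega z -> Omega z0 ->
  nu * \det (Xi z0) = 1 -> exists c, nu * \det (Xi z) = c%:A.
Proof.
move=> Oz Oz0 nuD; apply: (@unit_tau_eigen _ _ _ _ (kappa z0 / kappa z)).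
  by apply: is_unitM; [exists (\det (Xi z0))|exact: unit_det_Xi].
have s0 : (-1) ^+ n != 0 :> X by rewrite expf_neq0// oppr_eq0 oner_neq0.
have kz := kappa_neq0 hX Oz; have kz0 := kappa_neq0 hX Oz0.
have h := tau_det_Xi hX Oz; have h0 := tau_det_Xi hX Oz0.
set P := itau n.+1 _ in h h0; set D := \det (Xi z) in h *; set D0 := \det (Xi z0) in h0 nuD.
have tauP : tau nu * P = ((-1) ^+ n * kappa z0) *: nu.
  rewrite -[LHS]mulr1 -nuD mulrCA -!mulrA -h0 -!scalerAr; congr (_ *: _).
  by rewrite -rmorphM /= nuD rmorph1 mulr1.
apply: (scalerI (mulf_neq0 s0 kz)); rewrite rmorphM /= scalerAr h mulrA tauP.
by rewrite scalerA -scalerAl; congr (_ *: _); field.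
Qed.

End Ratio.

(* The interpolation series sum_a chi(a)/(w - za), multiplied by e(w), is the
   additive function G of w extending za |-> chi(a), and
   tau(G) - G = e * E_1. *)
Section Interpolation.
Context {F : finFieldType} {R : realType} {X : valuedField F R}.
Context (hX : vcomplete X).
Local Notation G := (@gauss_norm F R X).
Local Notation T := (tate X).
Context {n : nat} {z : 'rV[X]_n.+1} (Oz : Omega z).
Local Notation e_ := (lattice_exp (lattice z)).
Local Notation agf := (agf hX Oz).

Lemma exists_interpolation : exists I : X -> 'cV[T]_n.+1,
  [/\ {morph I : w w' / w + w'},
      forall a i, I (zdot z a) i 0 = chi (a i 0),
      forall w, (forall a, w != zdot z a) -> forall i,
        sums G (fun a => (w - zdot z a)^-1 *: chi (a i 0)) ((e_ w)^-1 *: I w i 0)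
    & forall w, (forall a, w != zdot z a) -> forall i,
        tau (I w i 0) = I w i 0 + e_ w *: Eis 1 z i 0].
Proof.
have [W' WW] := unit_det_agf hX Oz; set M := agf_mx hX Oz in WW.
(* Inverse matrix of M, W' being the inverse of its determinant. Up to the factor e(w), [I w] solves
   the linear system formed by [agf_series] for 0 <= k < r. *)
pose M' := W' *: \adj M.
have M'M : M' *m M = 1%:M.
  by rewrite -scalemxAl mul_adj_mx scale_scalar_mx mulrC WW.
pose v w : 'cV[T]_n.+1 := \col_k itau k (agf w).
pose I w := M' *m v w.
have MI w : M *m I w = v w.
  by rewrite mulmxA -scalemxAr mul_mx_adj scale_scalar_mx mulrC WW mul1mx.
have vD : {morph v : w w' / w + w'}.
  by move=> w w'; apply/matrixP => i j; rewrite !mxE agfD raddfD.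
have series w : (forall a, w != zdot z a) -> forall i,
    sums G (fun a => (w - zdot z a)^-1 *: chi (a i 0)) ((e_ w)^-1 *: I w i 0).
  move=> hw; have [E hE] := chi_sums hX (null_inv_zdot hX Oz w).
  have ME : M *m E = (e_ w)^-1%:A *: v w.
    apply/matrixP => k j; rewrite !mxE ord1 mulr_algl -[RHS]subr0.
    have := agf_series hX Oz (ltnW (ltn_ord k)) hw hE; rewrite ltn_eqF// => <-.
    by apply: eq_bigr => i _; rewrite mxE.
  have IE i : (e_ w)^-1 *: I w i 0 = E i 0.
    have -> : E = M' *m ((e_ w)^-1%:A *: v w) by rewrite -ME mulmxA M'M mul1mx.
    by rewrite -scalemxAr [RHS]mxE mulr_algl.
  by move=> i; rewrite IE; exact: hE.
exists I; split => //.
- by move=> w w'; rewrite /I vD mulmxDr.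
- move=> a i; have -> : I (zdot z a) = M' *m (M *m \col_i chi (a i 0)).
    congr (_ *m _); apply/matrixP => k j; rewrite !mxE (agf_zdot hX Oz) rmorph_sum.
    by apply: eq_bigr => l _; rewrite !mxE rmorphM /= itau_chi mulrC.
  by rewrite mulmxA M'M mul1mx mxE.
- move=> w hw i; have ew := lattice_exp_neq0 hX Oz hw.
  have tM'M : map_mx (@tau F R X) M' *m map_mx (@tau F R X) M = 1%:M.
    by rewrite -map_mxM M'M map_mx1.
  (* Row k of tau(M) brings in [agf_series] with exponent k + 1, whose term kappa, present in the
     last row only, is matched by that of [tau_agf_Eis]; the invertibility of tau(M) then gives the
     relation. *)
  have h : map_mx (@tau F R X) M *m (map_mx (@tau F R X) (I w) - I w -
      (e_ w)%:A *: \col_i Eis 1 z i 0) = 0.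
    rewrite !mulmxBr -map_mxM MI; apply/matrixP => k j; rewrite ord1 -scalemxAr.
    rewrite !mxE mulr_algl.
    have -> : \sum_l map_mx (@tau F R X) M k l * I w l 0 =
        itau k.+1 (agf w) - e_ w *: (if k == ord_max then (kappa z)%:A else 0).
      have := agf_series hX Oz (E := (e_ w)^-1%:A *: I w) (ltn_ord k) hw.
      rewrite (_ : (k.+1 == n.+1) = (k == ord_max)) // => H.
      have {}H := H _; rewrite -[LHS]scale1r -(divff ew) -scalerA.
      rewrite -[X in X - _]scale1r -[in X in X - _](divff ew) -[X in X - _]scalerA -scalerBr.
      congr (_ *: _); rewrite -H; last by move=> l; rewrite mxE mulr_algl; exact: series.
      by rewrite scaler_sumr; apply: eq_bigr => l _; rewrite !mxE mulr_algl scalerAr.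
    have -> : \sum_l map_mx (@tau F R X) M k l * (\col_i Eis 1 z i 0) l 0 =
        if k == ord_max then (kappa z)%:A else 0.
      by rewrite -(tau_agf_Eis hX Oz); apply: eq_bigr => l _; rewrite !mxE.
    by rewrite opprB addrCA subrr addr0 subrr.
  have /matrixP/(_ i 0) : map_mx (@tau F R X) (I w) - I w - (e_ w)%:A *: \col_i Eis 1 z i 0 = 0.
    by rewrite -[LHS]mul1mx -tM'M -mulmxA h mulmx0.
  rewrite !mxE mulr_algl => /eqP; rewrite -addrA -opprD subr_eq0 => /eqP.
  by [].
Qed.

End Interpolation.

(** * Bounded holomorphic functions *)

Section BoundedHolomorphic.
Context {F : finFieldType} {R : realType} {X : valuedField F R}.
Context (hX : vcomplete X).
Local Notation q := #|F|.
Local Notation N := (@vabs F R X).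
Local Notation G := (@gauss_norm F R X).
Local Notation T := (tate X).
Local Notation A := {poly F}.
Context {n : nat}.
Implicit Types (z : 'rV[X]_n.+1) (f g r : 'rV[X]_n.+1 -> T) (D : set 'rV[X]_n.+1).

Lemma Omega_Omega m z : Omega_ m z -> Omega z. Proof. by case. Qed.

Lemma Omega_imag m z : Omega_ m z -> q%:R ^- m <= imag z.
Proof.
move=> [Oz h]; apply: le_trans h; apply: ler_peMr; last exact: vnorm_ge1.
by rewrite invr_ge0 exprn_ge0 ?ler0n.
Qed.

Lemma Omega_vnorm m z : Omega_ m z -> vnorm z <= q%:R ^+ m.
Proof.
move=> [Oz h]; have := le_trans h (imag_le1 Oz).
by rewrite ler_pdivrMl ?qRX_gt0// mulr1.
Qed.

Lemma Omega_ex z : Omega z -> exists m, Omega_ m z.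
Proof.
move=> Oz; have i0 := imag_gt0 hX Oz; have v1 := vnorm_ge1 Oz.
have v0 : 0 < vnorm z by apply: lt_le_trans v1.
have [m hm] := @qRV_small F R (imag z / vnorm z) (divr_gt0 i0 v0).
by exists m; split => //; move: hm; rewrite ltr_pdivlMr// => /ltW.
Qed.

Lemma Omega_dot_ge m z (c : 'cV[X]_n.+1) i : Omega_ m z -> (forall i, Kinf (c i 0)) ->
  q%:R ^- m * N (c i 0) <= N ((z *m c) 0 0).
Proof.
move=> Oz Kc; apply: le_trans (imag_le z i Kc).
by apply: (ler_wpM2r (vabs_ge0 _)); exact: Omega_imag.
Qed.

Definition rational_on D f := exists P Q : mpoly.mpoly n.+1 T, forall z, D z ->
  exists w, T_eval Q z * w = 1 /\ f z = T_eval P z * w.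

Lemma T_evalD (P Q : mpoly.mpoly n.+1 T) z : T_eval (P + Q) z = T_eval P z + T_eval Q z.
Proof. exact: mpoly.mevalD. Qed.
Lemma T_evalM (P Q : mpoly.mpoly n.+1 T) z : T_eval (P * Q) z = T_eval P z * T_eval Q z.
Proof. exact: rmorphM. Qed.
Lemma T_evalC (c : T) z : T_eval (mpoly.mpolyC n.+1 c) z = c.
Proof. exact: mpoly.mevalC. Qed.
Lemma T_evalX i z : T_eval (mpoly.mpolyX T (mpoly.mnm1 i)) z = (z 0 i)%:A.
Proof. exact: mpoly.mevalXU. Qed.

Lemma rational_cst D (c : T) : rational_on D (fun=> c).
Proof.
exists (mpoly.mpolyC _ c), (mpoly.mpolyC _ 1) => z _; exists 1.
by rewrite !T_evalC !mulr1.
Qed.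

Lemma rational_coord D i : rational_on D (fun z => (z 0 i)%:A).
Proof.
exists (mpoly.mpolyX T (mpoly.mnm1 i)), (mpoly.mpolyC _ 1) => z _; exists 1.
by rewrite T_evalX T_evalC !mulr1.
Qed.

Lemma rationalD D f g : rational_on D f -> rational_on D g -> rational_on D (fun z => f z + g z).
Proof.
move=> [P [Q h]] [P' [Q' h']]; exists (P * Q' + P' * Q), (Q * Q') => z Dz.
have [w [Qw ->]] := h z Dz; have [w' [Qw' ->]] := h' z Dz; exists (w * w').
rewrite T_evalD !T_evalM mulrACA Qw Qw' mulr1; split => //.
rewrite mulrDl mulrACA Qw' mulr1; congr (_ + _).
by rewrite [w * w']mulrC mulrACA Qw mulr1.
Qed.

Lemma rationalM D f g : rational_on D f -> rational_on D g -> rational_on D (fun z => f z * g z).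
Proof.
move=> [P [Q h]] [P' [Q' h']]; exists (P * P'), (Q * Q') => z Dz.
have [w [Qw ->]] := h z Dz; have [w' [Qw' ->]] := h' z Dz; exists (w * w').
by rewrite !T_evalM [X in X = 1]mulrACA Qw Qw' mulr1 mulrACA.
Qed.

Lemma rationalV D f g : rational_on D f -> (forall z, D z -> f z * g z = 1) -> rational_on D g.
Proof.
move=> [P [Q h]] fg; exists Q, P => z Dz; have [w [Qw fE]] := h z Dz.
exists (w * g z); rewrite mulrA -fE fg//; split => //.
by rewrite mulrA Qw mul1r.
Qed.

Lemma rational_ext D f g : (forall z, D z -> f z = g z) -> rational_on D f -> rational_on D g.
Proof.
move=> fg [P [Q h]]; exists P, Q => z Dz; have [w [Qw fE]] := h z Dz.
by exists w; rewrite -fg.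
Qed.

Lemma rational_sum D (I : Type) (s : seq I) (f : I -> 'rV[X]_n.+1 -> T) :
  (forall i, rational_on D (f i)) -> rational_on D (fun z => \sum_(i <- s) f i z).
Proof.
move=> h; elim: s => [|i s IH].
  by apply: rational_ext (rational_cst D 0) => z _; rewrite big_nil.
by apply: rational_ext (rationalD (h i) IH) => z _; rewrite big_cons.
Qed.

Lemma rational_prod D (I : Type) (s : seq I) (P : pred I) (f : I -> 'rV[X]_n.+1 -> T) :
  (forall i, P i -> rational_on D (f i)) -> rational_on D (fun z => \prod_(i <- s | P i) f i z).
Proof.
move=> h; elim: s => [|i s IH].
  by apply: rational_ext (rational_cst D 1) => z _; rewrite big_nil.
case: (boolP (P i)) => Pi.
  by apply: rational_ext (rationalM (h i Pi) IH) => z _; rewrite big_cons Pi.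
by apply: rational_ext IH => z _; rewrite big_cons (negPf Pi).
Qed.

(** The twist acts on the coefficients and turns z_i into z_i^q, so that polynomials, and with them
    rational functions, are stable under it. *)
Lemma T_eval_tau (P : mpoly.mpoly n.+1 T) : exists P', forall z, T_eval P' z = tau (T_eval P z).
Proof.
elim/mpoly.mpolyind: P => [|c m p _ _ [p' hp]].
  by exists 0 => z; rewrite /T_eval !mpoly.meval0 rmorph0.
exists (mpoly.mpolyC _ (tau c) *
   \prod_i mpoly.mpolyX T (mpoly.mnm1 i) ^+ (q * m i) + p') => z.
rewrite !T_evalD hp rmorphD /= T_evalM T_evalC; congr (_ + _).
rewrite [in RHS]/T_eval mpoly.mevalZ mpoly.mevalX rmorphM /=; congr (_ * _).
rewrite /T_eval !rmorph_prod; apply: eq_bigr => i _.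
rewrite !rmorphXn /= mpoly.mevalXU exprM; congr (_ ^+ _).
by rewrite tauZ rmorph1 exprZn expr1n.
Qed.

Lemma rational_tau D f : rational_on D f -> rational_on D (fun z => tau (f z)).
Proof.
move=> [P [Q h]]; have [P' hP] := T_eval_tau P; have [Q' hQ] := T_eval_tau Q.
exists P', Q' => z Dz; have [w [Qw fE]] := h z Dz; exists (tau w).
by rewrite hP hQ fE -!rmorphM /= Qw rmorph1.
Qed.

Definition bounded_on D f := exists C : R, forall z, D z -> G (f z) <= C.

(** Boundedness on each [Omega_ m] is added to uniform approximability because the error of a
    product is estimated through the size of its factors. *)
Definition bholomorphic f := forall m, bounded_on (Omega_ m) f /\
  forall e : R, 0 < e -> exists2 r, rational_on (Omega_ m) r &
    forall z, Omega_ m z -> G (f z - r z) < e.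

Lemma bholomorphic_holomorphic f : bholomorphic f -> holomorphic f.
Proof.
move=> hf m e e0; have [r [P [Q h]] fr] := (hf m).2 _ e0; exists P, Q => z Oz.
by have [w [Qw rE]] := h z Oz; exists w => //; rewrite -rE fr.
Qed.

Lemma bholomorphic_ext f g : (forall z, Omega z -> f z = g z) ->
  bholomorphic f -> bholomorphic g.
Proof.
move=> fg hf m; have [[C hC] h] := hf m; split.
  by exists C => z Oz; rewrite -fg ?hC//; exact: Omega_Omega Oz.
move=> e /h[r hr fr]; exists r => // z Oz; rewrite -fg ?fr//; exact: Omega_Omega Oz.
Qed.

Lemma bholomorphic_rational f : (forall m, bounded_on (Omega_ m) f) ->
  (forall m, rational_on (Omega_ m) f) -> bholomorphic f.
Proof.
move=> bf rf m; split => // e e0; exists f => // z _.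
by rewrite subrr (un0 gauss_un).
Qed.

Lemma bholomorphic_cst (c : T) : bholomorphic (fun=> c).
Proof.
by apply: bholomorphic_rational => m; [exists (G c)|exact: rational_cst].
Qed.

Lemma bholomorphicD f g : bholomorphic f -> bholomorphic g ->
  bholomorphic (fun z => f z + g z).
Proof.
move=> hf hg m; have [[C hC] h] := hf m; have [[C' hC'] h'] := hg m; split.
  exists (Num.max C C') => z Oz; apply: (unD_le gauss_un).
    by rewrite le_max hC.
  by rewrite le_max hC' ?orbT.
move=> e e0; have [r hr fr] := h _ e0; have [r' hr' gr] := h' _ e0.
exists (fun z => r z + r' z) => [|z Oz]; first exact: rationalD.
by rewrite opprD addrACA; apply: (unD_lt gauss_un); auto.
Qed.

Lemma bholomorphicM f g : bholomorphic f -> bholomorphic g ->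
  bholomorphic (fun z => f z * g z).
Proof.
move=> hf hg m; have [[C hC] h] := hf m; have [[C' hC'] h'] := hg m.
pose K := Num.max 1 (Num.max C C').
have K0 : 0 < K by rewrite lt_max ltr01.
have fK z : Omega_ m z -> G (f z) <= K by move=> Oz; rewrite !le_max hC ?orbT.
have gK z : Omega_ m z -> G (g z) <= K by move=> Oz; rewrite !le_max hC' ?orbT.
split.
  exists (K * K) => z Oz; apply: le_trans (gaussM _ _) _.
  by apply: ler_pM; rewrite ?gauss_ge0 ?fK ?gK.
move=> e e0; pose d := Num.min 1 (e / K).
have d0 : 0 < d by rewrite lt_min ltr01 divr_gt0.
have [r hr fr] := h _ d0; have [r' hr' gr] := h' _ d0.
have dK : d * K <= e by rewrite -ler_pdivlMr// ge_min lexx orbT.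
exists (fun z => r z * r' z) => [|z Oz]; first exact: rationalM.
have -> : f z * g z - r z * r' z = (f z - r z) * g z + r z * (g z - r' z).
  by rewrite mulrBl mulrBr addrA subrK.
have lt1 : G (f z - r z) < d by exact: fr.
have lt2 : G (g z - r' z) < d by exact: gr.
have rK : G (r z) <= K.
  rewrite -(subKr (f z) (r z)); apply: (unB_le gauss_un); first exact: fK.
  by apply: ltW; apply: lt_le_trans lt1 _; rewrite ge_min le_max lexx.
apply: (unD_lt gauss_un); apply: le_lt_trans (gaussM _ _) _; apply: lt_le_trans dK.
  apply: le_lt_trans (_ : G (f z - r z) * K < _).
    by apply: (ler_wpM2l (gauss_ge0 _)); exact: gK.
  by rewrite ltr_pM2r.
rewrite [ltRHS]mulrC; apply: le_lt_trans (_ : K * G (g z - r' z) < _).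
  by apply: (ler_wpM2r (gauss_ge0 _)).
by rewrite ltr_pM2l.
Qed.

Lemma bholomorphicZ (c : X) f : bholomorphic f -> bholomorphic (fun z => c *: f z).
Proof.
move=> /(bholomorphicM (bholomorphic_cst c%:A)); apply: bholomorphic_ext => z _.
by rewrite mulr_algl.
Qed.

Lemma bholomorphicN f : bholomorphic f -> bholomorphic (fun z => - f z).
Proof.
by move=> /(bholomorphicZ (-1)); apply: bholomorphic_ext => z _; rewrite scaleN1r.
Qed.

Lemma bholomorphicB f g : bholomorphic f -> bholomorphic g ->
  bholomorphic (fun z => f z - g z).
Proof. by move=> hf hg; apply: bholomorphicD => //; exact: bholomorphicN. Qed.

Lemma bholomorphic_sum (I : Type) (s : seq I) (P : pred I) (f : I -> 'rV[X]_n.+1 -> T) :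
  (forall i, P i -> bholomorphic (f i)) -> bholomorphic (fun z => \sum_(i <- s | P i) f i z).
Proof.
move=> h; elim: s => [|i s IH].
  by apply: bholomorphic_ext (bholomorphic_cst 0) => z _; rewrite big_nil.
case: (boolP (P i)) => Pi.
  by apply: bholomorphic_ext (bholomorphicD (h i Pi) IH) => z _; rewrite big_cons Pi.
by apply: bholomorphic_ext IH => z _; rewrite big_cons (negPf Pi).
Qed.

Lemma bholomorphic_prod (I : Type) (s : seq I) (P : pred I) (f : I -> 'rV[X]_n.+1 -> T) :
  (forall i, P i -> bholomorphic (f i)) -> bholomorphic (fun z => \prod_(i <- s | P i) f i z).
Proof.
move=> h; elim: s => [|i s IH].
  by apply: bholomorphic_ext (bholomorphic_cst 1) => z _; rewrite big_nil.
case: (boolP (P i)) => Pi.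
  by apply: bholomorphic_ext (bholomorphicM (h i Pi) IH) => z _; rewrite big_cons Pi.
by apply: bholomorphic_ext IH => z _; rewrite big_cons (negPf Pi).
Qed.

Lemma bholomorphicX f k : bholomorphic f -> bholomorphic (fun z => f z ^+ k).
Proof.
move=> hf; apply: bholomorphic_ext (@bholomorphic_prod _ (iota 0 k) predT (fun=> f) (fun _ _ => hf)).
by move=> z _; rewrite big_const_seq count_predT size_iota iter_mulr_1.
Qed.

Lemma bholomorphic_det k (f : 'rV[X]_n.+1 -> 'M[T]_k) :
  (forall i j, bholomorphic (fun z => f z i j)) -> bholomorphic (fun z => \det (f z)).
Proof.
move=> h; apply: bholomorphic_sum => s _; apply: bholomorphicM.
  exact: bholomorphic_cst.
by apply: bholomorphic_prod => i _; exact: h.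
Qed.

Lemma bholomorphic_tau f : bholomorphic f -> bholomorphic (fun z => tau (f z)).
Proof.
move=> hf m; have [[C hC] h] := hf m; split.
  exists (C ^+ q) => z Oz; apply: le_trans (gauss_tau _) _.
  by rewrite lerXn2r ?nnegrE ?gauss_ge0 ?hC// (le_trans (gauss_ge0 _) (hC _ Oz)).
move=> e e0; have e1 : 0 < Num.min e 1 by rewrite lt_min e0 ltr01.
have [r hr fr] := h _ e1; exists (fun z => tau (r z)); first exact: rational_tau.
move=> z Oz; have := fr z Oz; rewrite lt_min -rmorphB /= => /andP[he h1].
apply: le_lt_trans (gauss_tau _) _; apply: le_lt_trans he.
have := q_gt0 (F := F); case: (q) => // k _.
by rewrite exprS ler_piMr ?gauss_ge0// exprn_ile1 ?gauss_ge0 ?ltW.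
Qed.

Lemma bholomorphic_itau k f : bholomorphic f -> bholomorphic (fun z => itau k (f z)).
Proof. by move=> hf; elim: k => [//|k IH]; exact: bholomorphic_tau. Qed.

Lemma bholomorphic_lim f : (forall m (e : R), 0 < e -> exists2 g, bholomorphic g &
    forall z, Omega_ m z -> G (f z - g z) < e) -> bholomorphic f.
Proof.
move=> h m; split.
  have [g hg fg] := h m 1 ltr01; have [[C hC] _] := hg m.
  exists (Num.max 1 C) => z Oz; rewrite -(subrK (g z) (f z)).
  by apply: (unD_le gauss_un); rewrite le_max ?hC ?orbT// ltW ?fg.
move=> e e0; have [g hg fg] := h m e e0; have [r hr gr] := (hg m).2 _ e0.
exists r => // z Oz; apply: (un_dist_lt gauss_un (fg z Oz)); exact: gr.
Qed.

Definition uniformly_null (I : choiceType) (x : I -> 'rV[X]_n.+1 -> T) :=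
  forall m (e : R), 0 < e -> exists S : {fset I}, forall i, i \notin S ->
    forall z, Omega_ m z -> G (x i z) < e.

Lemma bholomorphic_sums (I : choiceType) (x : I -> 'rV[X]_n.+1 -> T) f :
  (forall i, bholomorphic (x i)) -> uniformly_null x ->
  (forall z, Omega z -> sums G (x^~ z) (f z)) -> bholomorphic f.
Proof.
move=> hx ux xf; apply: bholomorphic_lim => m e e0; have [S hS] := ux m e e0.
exists (fun z => \sum_(i <- S) x i z); first exact: bholomorphic_sum.
move=> z Oz; apply: (sums_tail gauss_un (xf z (Omega_Omega Oz))) => // i iS.
exact: hS.
Qed.

Lemma uniformly_null_sums (I : choiceType) (x : I -> 'rV[X]_n.+1 -> T) :
  uniformly_null x -> exists f, forall z, Omega z -> sums G (x^~ z) (f z).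
Proof.
move=> ux; have /choice[f hf] (z : 'rV[X]_n.+1) : exists t, Omega z -> sums G (x^~ z) t.
  have [Oz|nOz] := pselect (Omega z); last by exists 0.
  have [m Om] := Omega_ex Oz.
  have [|t ht] := null_sums gauss_un (gauss_ucomplete (vabs_ucomplete hX)) (x := x^~ z).
    by move=> e /(ux m)[S hS]; exists S => i /hS; exact.
  by exists t.
by exists f.
Qed.

Lemma rational_dot D (c : 'cV[X]_n.+1) : rational_on D (fun z => ((z *m c) 0 0)%:A).
Proof.
apply: (@rational_ext _ (fun z => \sum_i (c i 0)%:A * (z 0 i)%:A)); last first.
  by apply: rational_sum => i; apply: rationalM; [exact: rational_cst|exact: rational_coord].
move=> z _; rewrite mxE scaler_suml; apply: eq_bigr => i _.
by rewrite mulr_algl scalerA mulrC.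
Qed.

Lemma algM (x y : X) : (x * y)%:A = x%:A * y%:A :> T.
Proof. by rewrite mulr_algl scalerA. Qed.

Lemma algV (x : X) : x != 0 -> x%:A * x^-1%:A = 1 :> T.
Proof. by move=> x0; rewrite -algM divff// scale1r. Qed.

Lemma algB (x y : X) : (x - y)%:A = x%:A - y%:A :> T.
Proof. exact: scalerBl. Qed.

Lemma dot_sub_zdot z (c : 'cV[X]_n.+1) a :
  (z *m (c - map_mx (Aemb X) a)) 0 0 = (z *m c) 0 0 - zdot z a.
Proof. by rewrite mulmxBr mxE; congr (_ + _); rewrite mxE. Qed.

Lemma rational_dot_zdot D (c : 'cV[X]_n.+1) a :
  rational_on D (fun z => ((z *m c) 0 0 - zdot z a)%:A).
Proof.
apply: rational_ext (rational_dot D (c - map_mx (Aemb X) a)) => z _.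
by rewrite dot_sub_zdot.
Qed.

Lemma rational_zdot D a : rational_on D (fun z => (zdot z a)%:A).
Proof. exact: rational_dot. Qed.

Lemma zdot_inv_bound m z a : Omega_ m z -> N (zdot z a)^-1 <= q%:R ^+ m / q%:R ^+ (cdeg a).-1.
Proof.
move=> Oz; have [->|a0] := eqVneq a 0.
  by rewrite zdot0 invr0 vabs0 divr_ge0 ?exprn_ge0 ?ler0n.
rewrite vabsV -invf_div lef_pV2 ?posrE ?divr_gt0 ?qRX_gt0//; last first.
  by rewrite vabs_gt0 (zdot_eq0 hX _ (Omega_Omega Oz)).
apply: le_trans (zdot_ge z a0); rewrite mulrC.
by apply: (ler_wpM2r _ (Omega_imag Oz)); rewrite exprn_ge0 ?ler0n.
Qed.

Lemma vabsVX (x : X) k : N (x ^+ k)^-1 = N x^-1 ^+ k.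
Proof. by rewrite -exprVn vabsX. Qed.

Lemma cdeg_small (C e : R) : 0 <= C -> 0 < e ->
  exists d, forall s (a : 'cV[A]_s), (d < cdeg a)%N -> C / q%:R ^+ (cdeg a).-1 < e.
Proof.
move=> C0 e0; have C1 : 0 < C + 1 by rewrite ltr_wpDl.
have [d hd] := @qRV_small F R (e / (C + 1)) (divr_gt0 e0 C1); exists d => s a da.
apply: le_lt_trans (_ : C / q%:R ^+ d < _).
  apply: (ler_wpM2l C0); rewrite lef_pV2 ?posrE ?qRX_gt0// ler_eXn2l ?qR_gt1//.
  by rewrite -ltnS prednK// (leq_ltn_trans _ da).
move: hd; rewrite ltr_pdivlMr// mulrC; apply: le_lt_trans.
by rewrite ler_wpM2r ?invr_ge0 ?exprn_ge0 ?ler0n// lerDl.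
Qed.

Lemma chi_mx0 s i : chi ((0 : 'cV[A]_s) i 0) = 0 :> T.
Proof. by rewrite mxE rmorph0. Qed.

Lemma bholomorphic_Eis k i : (0 < k)%N -> bholomorphic (fun z => Eis k z i 0).
Proof.
move=> k0; have dec (x : R) : 0 <= x <= 1 -> x ^+ k <= x.
  by case: k k0 => // k _ /andP[x0 x1]; rewrite exprS ler_piMr// exprn_ile1.
apply: (@bholomorphic_sums _ (fun a z => (zdot z a ^+ k)^-1 *: chi (a i 0))).
- move=> a; have [->|a0] := eqVneq a 0.
    apply: bholomorphic_ext (bholomorphic_cst 0) => z _.
    by rewrite chi_mx0 scaler0.
  apply: bholomorphic_rational => m.
    exists ((q%:R ^+ m / q%:R ^+ (cdeg a).-1) ^+ k) => z Oz.
    rewrite gaussZ; apply: le_trans (_ : N (zdot z a ^+ k)^-1 <= _).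
      by rewrite ler_piMr ?vabs_ge0 ?gauss_chi.
    rewrite vabsVX lerXn2r ?nnegrE ?vabs_ge0 ?divr_ge0 ?exprn_ge0 ?ler0n//.
    exact: zdot_inv_bound.
  have rz : rational_on (Omega_ m) (fun z => ((zdot z a) ^-1)%:A).
    apply: rationalV (rational_zdot _ a) _ => z Oz; apply: algV.
    by rewrite (zdot_eq0 hX _ (Omega_Omega Oz)).
  have rzk : rational_on (Omega_ m) (fun z => \prod_(j < k) ((zdot z a) ^-1)%:A).
    exact: rational_prod.
  apply: rational_ext (rationalM rzk (rational_cst _ (chi (a i 0)))) => z _.
  by rewrite prodr_const card_ord exprZn expr1n mulr_algl exprVn.
- move=> m e e0; have e1 : 0 < Num.min e 1 by rewrite lt_min e0 ltr01.
  have [d hd] := @cdeg_small (q%:R ^+ m) _ (exprn_ge0 _ (ler0n _ _)) e1.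
  exists (box n.+1 d) => a; rewrite in_box -ltnNge => da z Oz.
  have := le_lt_trans (zdot_inv_bound a Oz) (hd _ _ da); rewrite lt_min => /andP[h1 h2].
  rewrite gaussZ; apply: le_lt_trans h1; apply: le_trans (_ : N (zdot z a ^+ k)^-1 <= _).
    by rewrite ler_piMr ?vabs_ge0 ?gauss_chi.
  by rewrite vabsVX dec// vabs_ge0 ltW.
- by move=> z Oz; exact: Eis_sums.
Qed.

Lemma fexp_rational D d (c : 'cV[X]_n.+1) : (forall z, D z -> Omega z) ->
  rational_on D (fun z => (fexp (z := z) d ((z *m c) 0 0))%:A).
Proof.
move=> DO; apply: (@rational_ext _ (fun z => ((z *m c) 0 0)%:A *
    \prod_(a <- box n.+1 d | a != 0) (1 - ((z *m c) 0 0)%:A * (zdot z a)^-1%:A))); last first.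
  apply: rationalM; first exact: rational_dot.
  apply: rational_prod => a a0; apply: rational_ext
    (rationalD (rational_cst _ 1) (rationalM (rational_cst _ (-1))
      (rationalM (rational_dot _ c) _))) => [z _|]; first by rewrite mulN1r.
  apply: rationalV (rational_zdot _ a) _ => z Dz; apply: algV.
  by rewrite (zdot_eq0 hX _ (DO _ Dz)).
move=> z _; rewrite /fexp algM; congr (_ * _).
rewrite [RHS](_ : _ = in_alg T (\prod_(a <- box n.+1 d | a != 0) (1 - (z *m c) 0 0 / zdot z a)))//.
rewrite rmorph_prod; apply: eq_bigr => a _ /=.
by rewrite algB algM scale1r.
Qed.

Lemma fexp_bound m d : exists2 C : R, 0 <= C & forall z (c : 'cV[X]_n.+1), Omega_ m z ->
  (forall i, N (c i 0) <= 1) -> N (fexp (z := z) d ((z *m c) 0 0)) <= C.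
Proof.
pose K : R := q%:R ^+ m * q%:R ^+ m; have K1 : 1 <= K by rewrite mulr_ege1// exprn_ege1 ?qR_ge1.
have K0 : 0 <= K := le_trans ler01 K1.
exists (K * \prod_(a <- box (F := F) n.+1 d | a != 0) K) => [|z c Oz hc].
  by rewrite mulr_ge0// prodr_ge0.
have wK : N ((z *m c) 0 0) <= q%:R ^+ m.
  apply: le_trans (dot_le z ler01 hc) _; rewrite mulr1; exact: Omega_vnorm.
rewrite /fexp vabsM; apply: ler_pM; rewrite ?vabs_ge0//.
  apply: le_trans wK _; apply: ler_peMr; first by rewrite exprn_ge0 ?ler0n.
  by rewrite exprn_ege1 ?qR_ge1.
rewrite vabs_prod; apply: ler_prod => a a0; rewrite vabs_ge0 /=.
apply: (unB_le vabs_un); first by rewrite vabs1.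
rewrite vabsM; apply: ler_pM; rewrite ?vabs_ge0//.
apply: le_trans (zdot_inv_bound a Oz) _; rewrite ler_pdivrMr ?qRX_gt0//.
by apply: ler_peMr; rewrite ?exprn_ge0 ?ler0n ?exprn_ege1 ?qR_ge1.
Qed.

(** On [Omega_ m] one has |z| <= q^m |z|_Im, so lattice points off the box of size m + d have
    absolute value at least q^d |z|, while the argument is at most |z|: the bound is uniform in z
    and c. *)
Lemma fexp_error m z (c : 'cV[X]_n.+1) d : Omega_ m z -> (forall i, N (c i 0) <= 1) ->
  N (lattice_exp (lattice z) ((z *m c) 0 0) - fexp (z := z) (m + d) ((z *m c) 0 0)) <=
  q%:R ^- d * N (fexp (z := z) (m + d) ((z *m c) 0 0)).
Proof.
move=> Oz hc; apply: (lattice_exp_close hX (Omega_Omega Oz)); split.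
  by rewrite invr_ge0 exprn_ge0 ?ler0n//= invf_le1 ?qRX_gt0// exprn_ege1 ?qR_ge1.
move=> a da; apply: le_trans (dot_le z ler01 hc) _; rewrite mulr1.
rewrite ler_pdivlMl ?qRX_gt0//; apply: le_trans (zdot_ge_lt hX (Omega_Omega Oz) da).
case: Oz => Oz; rewrite ler_pdivrMl ?qRX_gt0// => h.
rewrite exprD mulrA [leRHS]mulrC; apply: ler_wpM2l; first by rewrite exprn_ge0 ?ler0n.
by rewrite mulrC.
Qed.

Lemma fexp_error' m z (c : 'cV[X]_n.+1) d : Omega_ m z -> (forall i, N (c i 0) <= 1) ->
  N (fexp (z := z) (m + d.+1) ((z *m c) 0 0)) <= N (lattice_exp (lattice z) ((z *m c) 0 0)).
Proof.
move=> Oz hc; have := fexp_error d.+1 Oz hc.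
set f := fexp _ _; set e := lattice_exp _ _ => h; rewrite leNgt; apply/negP => lt.
have f0 : 0 < N f by apply: le_lt_trans lt; exact: vabs_ge0.
have : N f <= q%:R ^- d.+1 * N f.
  apply: le_trans h; rewrite (unC vabs_un); rewrite -[leLHS](@un_eq _ _ _ vabs_un f (f - e)).
    by rewrite lexx.
  by rewrite subKr.
by rewrite ler_pMl// leNgt invf_lt1 ?qRX_gt0// exprn_egt1 ?qR_gt1.
Qed.

Lemma lattice_exp_bound m : exists2 C : R, 0 <= C & forall z (c : 'cV[X]_n.+1), Omega_ m z ->
  (forall i, N (c i 0) <= 1) -> N (lattice_exp (lattice z) ((z *m c) 0 0)) <= C.
Proof.
have [C C0 hC] := fexp_bound m m; exists C => // z c Oz hc.
have := fexp_error 0 Oz hc; rewrite addn0 expr0 invr1 mul1r => h.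
rewrite -(subrK (fexp (z := z) m ((z *m c) 0 0)) (lattice_exp _ _)).
by apply: (unD_le vabs_un); [apply: le_trans h _|]; exact: hC.
Qed.

Lemma bholomorphic_lattice_exp (c : 'cV[X]_n.+1) : (forall i, N (c i 0) <= 1) ->
  bholomorphic (fun z => (lattice_exp (lattice z) ((z *m c) 0 0))%:A).
Proof.
move=> hc; apply: bholomorphic_lim => m e e0; have [C C0 hC] := lattice_exp_bound m.
have C1 : 0 < C + 1 by rewrite ltr_wpDl.
have [d hd] := @qRV_small F R (e / (C + 1)) (divr_gt0 e0 C1).
exists (fun z => (fexp (z := z) (m + d.+1) ((z *m c) 0 0))%:A) => [|z Oz].
  apply: bholomorphic_rational => k; last first.
    by apply: fexp_rational => z; exact: Omega_Omega.
  have [C' _ hC'] := fexp_bound k (m + d.+1); exists C' => z Oz.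
  by rewrite gaussA hC'.
rewrite -algB gaussA; apply: le_lt_trans (fexp_error _ Oz hc) _.
apply: le_lt_trans (_ : q%:R ^- d * C < _).
  apply: ler_pM; rewrite ?vabs_ge0 ?invr_ge0 ?exprn_ge0 ?ler0n//.
    by rewrite lef_pV2 ?posrE ?qRX_gt0// ler_eXn2l ?qR_gt1.
  exact: le_trans (fexp_error' _ Oz hc) (hC z c Oz hc).
move: hd; rewrite ltr_pdivlMr//; apply: le_lt_trans.
by apply: ler_wpM2l; rewrite ?invr_ge0 ?exprn_ge0 ?ler0n// lerDl.
Qed.

(** A nonzero vector with entries of absolute value below 1 is not a polynomial vector, nonzero
    polynomials having absolute value at least 1; independence of z does the rest. *)
Lemma small_not_lattice z (c : 'cV[X]_n.+1) a : Omega z -> (forall i, Kinf (c i 0)) ->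
  (forall i, N (c i 0) < 1) -> c != 0 -> (z *m c) 0 0 != zdot z a.
Proof.
move=> Oz Kc c1 c0; rewrite -subr_eq0.
have -> : (z *m c) 0 0 - zdot z a = (z *m (c - map_mx (Aemb X) a)) 0 0.
  by rewrite dot_sub_zdot.
have Kca i : Kinf ((c - map_mx (Aemb X) a) i 0).
  by rewrite !mxE; apply: KinfD => //; apply: KinfN; exact: Kinf_Aemb.
have [i ci] : exists i, (c - map_mx (Aemb X) a) i 0 != 0.
  apply: contrapT => h; case/eqP: c0; apply/matrixP => i j; rewrite ord1 mxE.
  have := c1 i; have [->//|ci] := eqVneq (c i 0) 0.
  have : (c - map_mx (Aemb X) a) i 0 = 0.
    by apply/eqP; apply: contrapT => /negP hi; apply: h; exists i.
  rewrite !mxE => /eqP; rewrite subr_eq0 => /eqP cE; rewrite cE ltNge vabs_Aemb_ge1//.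
  by rewrite -(Aemb_eq0 (X := X)) -cE.
rewrite -vabs_gt0; apply: lt_le_trans (imag_le z i Kca).
by rewrite mulr_gt0 ?vabs_gt0// imag_gt0.
Qed.

Lemma dist_lattice_ge m z (c : 'cV[X]_n.+1) a : Omega_ m z -> (forall i, Kinf (c i 0)) ->
  (forall i, N (c i 0) < 1) -> a != 0 ->
  q%:R ^- m * q%:R ^+ (cdeg a).-1 <= N ((z *m c) 0 0 - zdot z a).
Proof.
move=> Oz Kc c1 a0; have [i ai] := cdeg_max a0.
have ai0 : a i 0 != 0 by rewrite -size_poly_gt0 -ai cdeg_gt0.
have -> : (z *m c) 0 0 - zdot z a = (z *m (c - map_mx (Aemb X) a)) 0 0.
  by rewrite dot_sub_zdot.
have Kca j : Kinf ((c - map_mx (Aemb X) a) j 0).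
  by rewrite !mxE; apply: KinfD => //; apply: KinfN; exact: Kinf_Aemb.
have := Omega_dot_ge i Oz Kca; rewrite !mxE.
have -> : N (c i 0 - Aemb X (a i 0)) = q%:R ^+ (cdeg a).-1; last by [].
rewrite ai -(vabs_Aemb (X := X))// -[RHS]vabsN; apply: (un_eq vabs_un).
rewrite opprB addKr !vabsN; apply: lt_le_trans (c1 i) _; exact: vabs_Aemb_ge1.
Qed.

(* The values at torsion points of the interpolating functions of
   [exists_interpolation] are bounded holomorphic in the lattice; the lattice
   point 0 does not contribute, whence a bound uniform in c. *)
Lemma bholomorphic_interpolation (i : 'I_n.+1) : exists g : 'cV[X]_n.+1 -> 'rV[X]_n.+1 -> T,
  (forall c : 'cV[X]_n.+1, (forall j, Kinf (c j 0)) -> (forall j, N (c j 0) < 1) ->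
    [/\ bholomorphic (g c),
        forall m z, Omega_ m z -> G (g c z) <= q%:R ^+ m
      & forall z, Omega z ->
          sums G (fun a => ((z *m c) 0 0 - zdot z a)^-1 *: chi (a i 0)) (g c z)]).
Proof.
suff /choice[g hg] (c : 'cV[X]_n.+1) : exists g : 'rV[X]_n.+1 -> T,
  (forall j, Kinf (c j 0)) -> (forall j, N (c j 0) < 1) ->
    [/\ bholomorphic g, forall m z, Omega_ m z -> G (g z) <= q%:R ^+ m
      & forall z, Omega z ->
          sums G (fun a => ((z *m c) 0 0 - zdot z a)^-1 *: chi (a i 0)) (g z)].
  by exists g.
have [[Kc c1]|nc] := pselect ((forall j, Kinf (c j 0)) /\ (forall j, N (c j 0) < 1)); last first.
  by exists (fun=> 0) => Kc c1; case: nc.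
pose x a z : T := ((z *m c) 0 0 - zdot z a)^-1 *: chi (a i 0).
have xb m z a : Omega_ m z -> G (x a z) <= q%:R ^+ m / q%:R ^+ (cdeg a).-1.
  move=> Oz; rewrite /x; have [->|a0] := eqVneq a 0.
    rewrite chi_mx0 scaler0 (un0 gauss_un).
    by rewrite divr_ge0 ?exprn_ge0 ?ler0n.
  rewrite gaussZ; apply: le_trans (_ : N ((z *m c) 0 0 - zdot z a)^-1 <= _).
    by rewrite ler_piMr ?vabs_ge0 ?gauss_chi.
  have h := dist_lattice_ge Oz Kc c1 a0.
  have p0 : 0 < q%:R ^- m * q%:R ^+ (cdeg a).-1 :> R by rewrite mulr_gt0 ?invr_gt0 ?qRX_gt0.
  rewrite vabsV -[leRHS]invrK invf_div mulrC lef_pV2 ?posrE//.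
  exact: lt_le_trans h.
have xun : uniformly_null x.
  move=> m e e0; have [d hd] := @cdeg_small (q%:R ^+ m) _ (exprn_ge0 _ (ler0n _ _)) e0.
  exists (box n.+1 d) => a; rewrite in_box -ltnNge => da z Oz.
  exact: le_lt_trans (xb _ _ _ Oz) (hd _ _ da).
have [g hg] := uniformly_null_sums xun; exists g => _ _; split => //.
- apply: bholomorphic_sums xun hg => a; have [->|a0] := eqVneq a 0.
    apply: bholomorphic_ext (bholomorphic_cst 0) => z _.
    by rewrite /x chi_mx0 scaler0.
  apply: bholomorphic_rational => m.
    by exists (q%:R ^+ m / q%:R ^+ (cdeg a).-1) => z; exact: xb.
  have rz : rational_on (Omega_ m) (fun z => ((z *m c) 0 0 - zdot z a)^-1%:A).
    apply: rationalV (rational_dot_zdot _ c a) _ => z Oz; apply: algV.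
    rewrite -vabs_gt0; apply: lt_le_trans (dist_lattice_ge Oz Kc c1 a0).
    by rewrite mulr_gt0 ?invr_gt0 ?qRX_gt0.
  apply: rational_ext (rationalM rz (rational_cst _ (chi (a i 0)))) => z _.
  by rewrite mulr_algl.
- move=> m z Oz; apply: (sums_le gauss_un _ (hg z (Omega_Omega Oz))).
    by rewrite exprn_ge0 ?ler0n.
  move=> a; apply: le_trans (xb _ _ _ Oz) _; rewrite ler_pdivrMr ?qRX_gt0//.
  by apply: ler_peMr; rewrite ?exprn_ge0 ?ler0n ?exprn_ege1 ?qR_ge1.
Qed.

End BoundedHolomorphic.

(** * Expansions at infinity *)

Section NatSums.
Context {R : realType} {V : zmodType} {N : V -> R} (hN : ultranorm N).

Lemma sum_iota (x : nat -> V) k : \sum_(i <- iota 0 k) x i = \sum_(i < k) x i.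
Proof. by rewrite -(big_mkord xpredT x) /index_iota subn0. Qed.

Lemma sums_nat (x : nat -> V) s :
  (forall e : R, 0 < e -> exists k : nat, N (s - \sum_(i < k) x i) < e /\
     forall i, (k <= i)%N -> N (x i) < e) -> sums N x s.
Proof.
move=> h e /h[k [h1 h2]]; exists [fset i in iota 0 k]%fset; split.
  rewrite (perm_big (iota 0 k)) /=; first by rewrite sum_iota.
  by apply: uniq_perm; rewrite ?fset_uniq ?iota_uniq// => i; rewrite !inE.
by move=> i; rewrite !inE mem_iota add0n /= -leqNgt => /h2.
Qed.

Lemma sums_nat_lim (x : nat -> V) s : sums N x s -> forall e : R, 0 < e ->
  exists k0 : nat, forall k, (k0 <= k)%N -> N (s - \sum_(i < k) x i) < e.
Proof.
move=> xs e e0; have [S [_ hS]] := xs e e0.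
exists (\max_(i <- S) i).+1 => k hk.
have := @sums_tail _ _ _ hN _ x s [fset i in iota 0 k]%fset e xs e0.
rewrite (perm_big (iota 0 k)) /=; last first.
  by apply: uniq_perm; rewrite ?fset_uniq ?iota_uniq// => i; rewrite !inE.
rewrite sum_iota; apply => i.
rewrite !inE mem_iota add0n /= -leqNgt => ki; apply: hS; apply/negP => iS.
have := leq_trans hk ki; rewrite ltnNge; case/negP.
exact: (leq_bigmax_seq (F := id)).
Qed.

Lemma ncvg_sums (x : nat -> V) s : ncvg N \oo (fun k => \sum_(i < k) x i) s -> sums N x s.
Proof.
move=> /cvgrPdist_lt h; apply: sums_nat => e e0; have [k0 _ hk] := h e e0.
have hk' k : (k0 <= k)%N -> N (s - \sum_(i < k) x i) < e.
  by move=> /hk /=; rewrite sub0r normrN ger0_norm ?(un_ge0 hN)// (unC hN).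
exists k0; split; first exact: hk'.
move=> i ki; have -> : x i = (s - \sum_(j < i) x j) - (s - \sum_(j < i.+1) x j).
  rewrite big_ord_recr /= opprB [\sum_(_ < _) _ + x i]addrC.
  by rewrite addrA [s - _ + _]addrCA subrK addrK.
by apply: (unB_lt hN); apply: hk' => //; exact: leqW.
Qed.

Lemma sums_ncvg (x : nat -> V) s : sums N x s -> ncvg N \oo (fun k => \sum_(i < k) x i) s.
Proof.
move=> xs; apply/cvgrPdist_lt => e e0; have [k0 h] := sums_nat_lim xs e0.
by exists k0 => // k /h /=; rewrite sub0r normrN ger0_norm ?(un_ge0 hN)// (unC hN).
Qed.

End NatSums.

Lemma expr_small (R : realType) (t e : R) : 0 <= t -> t < 1 -> 0 < e ->
  exists k0 : nat, forall k, (k0 <= k)%N -> t ^+ k < e.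
Proof.
move=> t0 t1 e0; have t1' : `|t| < 1 by rewrite ger0_norm.
have /cvgrPdist_lt/(_ e e0)[k0 _ h] := cvg_expr t1'; exists k0 => k /h /=.
by rewrite sub0r normrN ger0_norm// exprn_ge0.
Qed.

Section Products.
Context {F : finFieldType} {R : realType} {X : valuedField F R}.
Context (hX : vcomplete X).
Local Notation N := (@vabs F R X).
Local Notation G := (@gauss_norm F R X).
Local Notation T := (tate X).

Lemma sums_geometric (t : X) : N t < 1 -> sums N (fun i => t ^+ i) (1 - t)^-1.
Proof.
move=> t1; have Nt : N (1 - t) = 1.
  by rewrite -(vabs1 (X := X)); apply: (un_eq vabs_un); rewrite subKr vabs1.
have t1' : 1 - t != 0 by rewrite -vabs_eq0E Nt oner_neq0.
apply: sums_nat => e e0; have [k hk] := expr_small (vabs_ge0 t) t1 e0.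
exists k; split; last by move=> i /hk; rewrite vabsX.
have -> : (1 - t)^-1 - \sum_(i < k) t ^+ i = t ^+ k / (1 - t).
  apply: (mulfI t1'); rewrite mulrBr divff// mulrCA divff// mulr1.
  have := subrXX 1 t k; rewrite expr1n => h.
  have -> : \sum_(i < k) t ^+ i = \sum_(i < k) 1 ^+ (k.-1 - i) * t ^+ i.
    by apply: eq_bigr => i _; rewrite expr1n mul1r.
  by rewrite -h subKr.
by rewrite vabsM vabsV Nt invr1 mulr1 vabsX hk.
Qed.

Lemma nullfam_bounded (V : zmodType) (NV : V -> R) (hN : ultranorm NV) (I : choiceType)
  (x : I -> V) : nullfam NV x -> exists2 C : R, 0 < C & forall i, NV (x i) <= C.
Proof.
move=> /(_ 1 ltr01)[S hS]; exists (1 + \sum_(i <- S) NV (x i)).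
  by rewrite ltr_pwDl// sumr_ge0// => i _; exact: un_ge0.
move=> i; case: (boolP (i \in S)) => [iS|/hS/ltW h].
  rewrite (big_fsetD1 i)//= addrCA lerDl addr_ge0 ?ler01 ?sumr_ge0// => j _.
  exact: un_ge0.
by apply: le_trans h _; rewrite lerDl sumr_ge0// => j _; exact: un_ge0.
Qed.

(** Off a product of two finite sets, one of the factors is small while the other stays bounded. *)
Lemma null_mul_pair (I J : choiceType) (x : I -> R) (y : J -> R) (V : zmodType) (NV : V -> R)
   (w : I * J -> V) (Cx Cy : R) :
  0 < Cx -> 0 < Cy -> (forall i, 0 <= x i <= Cx) -> (forall j, 0 <= y j <= Cy) ->
  (forall e : R, 0 < e -> exists S : {fset I}, forall i, i \notin S -> x i < e) ->
  (forall e : R, 0 < e -> exists S : {fset J}, forall j, j \notin S -> y j < e) ->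
  (forall i j, NV (w (i, j)) <= x i * y j) -> nullfam NV w.
Proof.
move=> Cx0 Cy0 hx hy nx ny hw e e0.
have [S hS] := nx _ (divr_gt0 e0 Cy0); have [S' hS'] := ny _ (divr_gt0 e0 Cx0).
exists (S `*` S')%fset => -[i j]; rewrite in_fsetM /= negb_and => h.
apply: le_lt_trans (hw i j) _.
have /andP[x0 xC] := hx i; have /andP[y0 yC] := hy j.
case/orP: h => [/hS|/hS'] h.
  apply: le_lt_trans (_ : x i * Cy < _); first by apply: (ler_wpM2l x0).
  by rewrite -ltr_pdivlMr.
apply: le_lt_trans (_ : Cx * y j < _); first by apply: (ler_wpM2r y0).
by rewrite mulrC -ltr_pdivlMr.
Qed.

Lemma sums_prod_pair (I J : choiceType) (x : I -> T) (y : J -> T) s t :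
  sums G x s -> sums G y t -> sums G (fun p : I * J => x p.1 * y p.2) (s * t).
Proof.
move=> xs yt; have [Cx Cx0 hCx] := nullfam_bounded gauss_un (sums_null xs).
have [Cy Cy0 hCy] := nullfam_bounded gauss_un (sums_null yt).
have nl : nullfam G (fun p : I * J => x p.1 * y p.2).
  apply: (@null_mul_pair _ _ (G \o x) (G \o y) _ _ _ Cx Cy) => //.
  - by move=> i; rewrite gauss_ge0 /=.
  - by move=> i; rewrite gauss_ge0 /=.
  - exact: sums_null xs.
  - exact: sums_null yt.
  - by move=> i j; exact: gaussM.
have [v hv] := null_sums gauss_un (gauss_ucomplete (vabs_ucomplete hX)) nl.
have xt : sums G (fun i => x i * t) v.
  apply: (sums_regroup gauss_un (p := fst) hv) => i.
  apply: (sums_inj gauss_un (f := fun j => (i, j))) => [j j' []//|[i' j] h|].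
    by case: eqP => // /= ii; case: (h j); rewrite ii.
  by apply: sums_ext (sums_mull (x i) yt) => j /=; rewrite eqxx.
have := sums_mull t xs; rewrite mulrC => st.
by rewrite (sums_uniq gauss_un st (sums_ext (fun i => mulrC _ _) xt)).
Qed.

Lemma sums_cauchy (x y : nat -> T) s t : sums G x s -> sums G y t ->
  sums G (fun k => \sum_(i < k.+1) x i * y (k - i)%N) (s * t).
Proof.
move=> xs yt; apply: (sums_regroup gauss_un (p := fun p => (p.1 + p.2)%N) (sums_prod_pair xs yt)) => k.
apply: (sums_inj gauss_un (f := fun i : 'I_k.+1 => (nat_of_ord i, (k - i)%N))).
- by move=> i i' [] ii _; apply/val_inj.
- move=> [i j] h; case: eqP => //= ijk.
  have ik : (i < k.+1)%N by rewrite ltnS -ijk leq_addr.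
  by case: (h (Ordinal ik)) => /=; rewrite -ijk addKn.
apply: sums_ext (sums_finType gauss_un (fun i : 'I_k.+1 => x i * y (k - i)%N)) => i /=.
by rewrite subnKC ?eqxx// -ltnS.
Qed.

End Products.

Section UExpansion.
Context {F : finFieldType} {R : realType} {X : valuedField F R}.
Context (hX : vcomplete X).
Local Notation q := #|F|.
Local Notation N := (@vabs F R X).
Local Notation G := (@gauss_norm F R X).
Local Notation T := (tate X).
Local Notation th := (vtheta X).
Local Notation A := {poly F}.
Context {lam : X} (hlam : lam ^+ (q - 1) = - th).
Local Notation ppi := (pitilde lam).

(** All partial products have absolute value 1 and form a Cauchy sequence, so the limit exists and
    has absolute value 1 as well. *)
Lemma pitilde_neq0 : ppi != 0.
Proof.
have lam0 : lam != 0.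
  apply/eqP => l0; move: hlam; rewrite l0 expr0n subn_eq0 leqNgt q_gt1 /= => /esym/eqP.
  by rewrite oppr_eq0 (negPf theta_neq0).
rewrite /pitilde !mulf_neq0// ?theta_neq0//.
pose x j : X := (1 - th ^ (1 - (q ^ j)%N%:Z))^-1.
have small j : (0 < j)%N -> N (th ^ (1 - (q ^ j)%N%:Z)) <= q%:R ^- j.
  move=> j0; rewrite expfzDr ?theta_neq0// expr1z -exprnN vabsM vabsV vabsX vabs_theta.
  rewrite ler_pdivrMr ?qRX_gt0// ler_pdivlMl ?qRX_gt0// -exprSr.
  by rewrite ler_eXn2l ?qR_gt1// ltn_expl ?q_gt1.
have q1 j : (0 < j)%N -> q%:R ^- j < 1 :> R.
  by move=> j0; rewrite invf_lt1 ?qRX_gt0// exprn_egt1 ?qR_gt1// -lt0n.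
have N1 j : (0 < j)%N -> N (1 - th ^ (1 - (q ^ j)%N%:Z)) = 1.
  move=> j0; rewrite -(vabs1 (X := X)); apply: (un_eq vabs_un).
  by rewrite subKr vabs1; apply: le_lt_trans (small j j0) (q1 j j0).
have Nx j : (0 < j)%N -> N (x j) = 1 by move=> j0; rewrite /x vabsV N1// invr1.
have x1 j : (0 < j)%N -> N (x j - 1) <= q%:R ^- j.
  move=> j0; have nz : 1 - th ^ (1 - (q ^ j)%N%:Z) != 0.
    by rewrite -vabs_eq0E N1// oner_neq0.
  have -> : x j - 1 = th ^ (1 - (q ^ j)%N%:Z) * x j.
    by rewrite /x; set t := th ^ _ in nz *; field.
  by rewrite vabsM Nx// mulr1 small.
pose p m := \prod_(1 <= j < m) x j.
have Np m : N (p m) = 1.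
  by rewrite vabs_prod big_nat big1// => j /andP[j1 _]; exact: Nx.
have step m k : (m <= k)%N -> (0 < m)%N -> N (p k - p m) <= q%:R ^- m.
  elim: k => [|k IH]; first by rewrite leqn0 => /eqP ->.
  rewrite leq_eqVlt => /orP[/eqP -> _|].
    by rewrite subrr vabs0 invr_ge0 exprn_ge0 ?ler0n.
  rewrite ltnS => mk m0; apply: (un_dist_le vabs_un (y := p k)); last exact: IH.
  have k0 : (0 < k)%N := leq_trans m0 mk.
  rewrite /p big_nat_recr//= -{2}[\prod_(1 <= j < k) x j]mulr1 -mulrBr vabsM -/(p k) Np mul1r.
  apply: le_trans (x1 k k0) _.
  by rewrite lef_pV2 ?posrE ?qRX_gt0// ler_eXn2l ?qR_gt1.
have [|l hl] := vabs_ucomplete hX (u := p).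
  move=> e e0; have [d hd] := @qRV_small F R e e0; exists d.+1 => m k dm dk.
  have dd : q%:R ^- d.+1 < e.
    apply: le_lt_trans hd; by rewrite lef_pV2 ?posrE ?qRX_gt0// ler_eXn2l ?qR_gt1.
  apply: (un_dist_lt vabs_un (y := p d.+1)); last rewrite (unC vabs_un);
    by apply: le_lt_trans (step _ _ _ _) dd.
have -> : nlim N \oo (fun m => \prod_(1 <= j < m) (1 - th ^ (1 - (q ^ j)%N%:Z))^-1) = l.
  apply: (ncvg_nlim vabs_un); apply/cvgrPdist_lt => e /hl[k0 h]; exists k0 => // k /h /=.
  by rewrite sub0r normrN ger0_norm ?vabs_ge0// (unC vabs_un).
have [k0 h] := hl 1 ltr01; rewrite -vabs_eq0E.
have -> : N l = 1; last exact: oner_neq0.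
rewrite -(Np k0); apply: (un_eq vabs_un); rewrite Np (unC vabs_un); exact: h.
Qed.

Context {n : nat}.
Implicit Types (z : 'rV[X]_n.+2) (y : 'rV[X]_n.+1).

(** The region given by B = 1 in [u_expansion]. There every combination of \tilde z with
    coefficients of absolute value at most 1 is smaller than the distance from z_r to the span. *)
Definition near_infinity z := Omega z /\ vnorm (ztilde z) < imag_last z.

Local Notation XX z := (lattice_exp (lattice (ztilde z)) (z 0 ord0)).
Local Notation u_ z := (upar lam z).

Lemma near_infinity_vnorm z : near_infinity z -> 0 < vnorm (ztilde z) /\ 0 < imag_last z.
Proof.
move=> [Oz h]; have v1 := vnorm_ge1 (Omega_ztilde Oz).
by split; [|apply: lt_trans h]; apply: lt_le_trans v1.
Qed.

Lemma imag_last_zdot z a : imag_last z <= N (z 0 ord0 - zdot (ztilde z) a).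
Proof. by apply: imag_last_le => i; rewrite mxE; exact: Kinf_Aemb. Qed.

(** Replacing z_r by its closest lattice translate w keeps the value of e and the lower bound by
    [imag_last z], and makes [lattice_exp_compare] applicable. *)
Lemma near_infinity_closest z : near_infinity z -> exists w,
  [/\ XX z = lattice_exp (lattice (ztilde z)) w, imag_last z <= N w
    & forall a, N w <= N (w - zdot (ztilde z) a)].
Proof.
move=> [Oz _]; have Ozt := Omega_ztilde Oz.
have [a ha] := exists_closest hX Ozt (z 0 ord0).
exists (z 0 ord0 - zdot (ztilde z) a); split => //; last exact: imag_last_zdot.
by rewrite lattice_expB// lattice_exp_zdot// subr0.
Qed.

Lemma vabs_lattice_exp_near_infinity z : near_infinity z -> imag_last z <= N (XX z).
Proof.
move=> hz; have [w [-> h1 h2]] := near_infinity_closest hz.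
by apply: le_trans h1 _; apply: vabs_lattice_exp_ge => //; apply: Omega_ztilde; case: hz.
Qed.

Lemma lattice_exp_near_infinity_neq0 z : near_infinity z -> XX z != 0.
Proof.
move=> hz; rewrite -vabs_gt0; apply: lt_le_trans (vabs_lattice_exp_near_infinity hz).
by case: (near_infinity_vnorm hz).
Qed.

Lemma upar_neq0 z : near_infinity z -> u_ z != 0.
Proof.
by move=> hz; rewrite mulf_neq0// invr_eq0 ?pitilde_neq0// lattice_exp_near_infinity_neq0.
Qed.

Lemma torsion_ratio z (c : 'cV[X]_n.+1) : near_infinity z -> (forall i, N (c i 0) <= 1) ->
  N (lattice_exp (lattice (ztilde z)) ((ztilde z *m c) 0 0)) <=
  vnorm (ztilde z) / imag_last z * N (XX z).
Proof.
move=> hz hc; have [v0 i0] := near_infinity_vnorm hz.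
have [w [-> h1 h2]] := near_infinity_closest hz.
have Nv : N ((ztilde z *m c) 0 0) <= vnorm (ztilde z).
  by apply: le_trans (dot_le _ ler01 hc) _; rewrite mulr1.
have Nw : 0 < N w := lt_le_trans i0 h1.
have vw : N ((ztilde z *m c) 0 0) <= N w.
  by apply: le_trans Nv (le_trans (ltW _) h1); case: hz.
have w0 : w != 0 by rewrite -vabs_gt0.
have Ozt : Omega (ztilde z) by apply: Omega_ztilde; case: hz.
apply: le_trans (lattice_exp_compare hX Ozt w0 vw h2) _.
apply: (ler_wpM2r (vabs_ge0 _)); apply: ler_pM; rewrite ?vabs_ge0 ?invr_ge0 ?vabs_ge0//.
by rewrite lef_pV2 ?posrE.
Qed.

Lemma torsion_ratio_lt1 z : near_infinity z -> 0 <= vnorm (ztilde z) / imag_last z < 1.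
Proof.
move=> hz; have [v0 i0] := near_infinity_vnorm hz.
by rewrite divr_ge0 ?ltW//= ltr_pdivrMr// mul1r; case: hz.
Qed.

Lemma near_infinity_not_lattice z (c : 'cV[X]_n.+1) a : near_infinity z ->
  (forall i, Kinf (c i 0)) -> z 0 ord0 + (ztilde z *m c) 0 0 != zdot (ztilde z) a.
Proof.
move=> hz Kc; have [_ i0] := near_infinity_vnorm hz.
have Kca i : Kinf ((map_mx (Aemb X) a - c) i 0).
  by rewrite !mxE; apply: KinfD; [exact: Kinf_Aemb|exact: KinfN].
rewrite -subr_eq0 -vabs_gt0; apply: lt_le_trans i0 (le_trans (imag_last_le z Kca) _).
rewrite le_eqVlt; apply/orP; left; apply/eqP; congr (N _).
by rewrite mulmxBr [X in _ - X]mxE [X in _ - (_ + X)]mxE opprB addrA.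
Qed.

(** Starting at exponent 0 and allowing only bounded holomorphic coefficients makes the notion
    stable under products. It is used for functions divided by u, where h is the coefficient of
    u. *)
Definition has_uexp (f : 'rV[X]_n.+2 -> T) (h : 'rV[X]_n.+1 -> T) := exists fs,
  [/\ forall i, bholomorphic (fs i),
      forall z, near_infinity z -> sums G (fun i => u_ z ^+ i *: fs i (ztilde z)) (f z)
    & forall y, Omega y -> fs 0%N y = h y].

Lemma has_uexp_ext f f' h h' : (forall z, near_infinity z -> f z = f' z) ->
  (forall y, Omega y -> h y = h' y) -> has_uexp f h -> has_uexp f' h'.
Proof.
move=> ff hh [fs [h1 h2 h3]]; exists fs; split => // [z hz|y Oy].
  by rewrite -ff//; exact: h2.
by rewrite -hh//; exact: h3.
Qed.

Lemma has_uexp_cst h : bholomorphic h -> has_uexp (fun z => h (ztilde z)) h.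
Proof.
move=> hh; exists (fun i => if i == 0%N then h else fun=> 0); split => //.
  by move=> i; case: ifP => _ //; exact: bholomorphic_cst.
move=> z _; have := @sums_fset _ _ _ gauss_un _
   (fun i => u_ z ^+ i *: (if i == 0%N then h else fun=> 0) (ztilde z)) [fset 0%N]%fset.
rewrite big_seq_fset1 expr0 scale1r; apply => i; rewrite inE => /negPf ->.
by rewrite scaler0.
Qed.

Lemma has_uexp_upar : has_uexp (fun z => (u_ z)%:A) (fun=> 0).
Proof.
exists (fun i => if i == 1%N then fun=> 1 else fun=> 0); split => //.
  by move=> i; case: ifP => _; exact: bholomorphic_cst.
move=> z _; have := @sums_fset _ _ _ gauss_un _
   (fun i => u_ z ^+ i *: (if i == 1%N then fun=> 1 else fun=> 0) (ztilde z)) [fset 1%N]%fset.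
rewrite big_seq_fset1 expr1; apply => i; rewrite inE => /negPf ->.
by rewrite scaler0.
Qed.

Lemma has_uexpD f f' h h' : has_uexp f h -> has_uexp f' h' ->
  has_uexp (fun z => f z + f' z) (fun y => h y + h' y).
Proof.
move=> [fs [a1 a2 a3]] [gs [b1 b2 b3]]; exists (fun i y => fs i y + gs i y); split.
- by move=> i; exact: bholomorphicD.
- move=> z hz; apply: sums_ext (sumsD gauss_un (a2 z hz) (b2 z hz)) => i.
  by rewrite scalerDr.
- by move=> y Oy; rewrite a3// b3.
Qed.

Lemma has_uexpM f f' h h' : has_uexp f h -> has_uexp f' h' ->
  has_uexp (fun z => f z * f' z) (fun y => h y * h' y).
Proof.
move=> [fs [a1 a2 a3]] [gs [b1 b2 b3]].
exists (fun k y => \sum_(i < k.+1) fs i y * gs (k - i)%N y); split.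
- by move=> k; apply: bholomorphic_sum => i _; exact: bholomorphicM.
- move=> z hz; apply: sums_ext (sums_cauchy hX (a2 z hz) (b2 z hz)) => k.
  rewrite scaler_sumr; apply: eq_bigr => i _.
  rewrite -scalerAl -scalerAr scalerA -exprD subnKC// -ltnS//.
- by move=> y Oy; rewrite big_ord_recl big_ord0 addr0 a3// b3.
Qed.

Lemma has_uexp_sum (I : Type) (s : seq I) (P : pred I) f h :
  (forall i, P i -> has_uexp (f i) (h i)) ->
  has_uexp (fun z => \sum_(i <- s | P i) f i z) (fun y => \sum_(i <- s | P i) h i y).
Proof.
move=> H; elim: s => [|i s IH].
  by apply: has_uexp_ext (has_uexp_cst (bholomorphic_cst 0)) => *; rewrite big_nil.
case: (boolP (P i)) => Pi.
  by apply: has_uexp_ext (has_uexpD (H i Pi) IH) => *; rewrite big_cons Pi.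
by apply: has_uexp_ext IH => *; rewrite big_cons (negPf Pi).
Qed.

Lemma has_uexp_prod (I : Type) (s : seq I) (P : pred I) f h :
  (forall i, P i -> has_uexp (f i) (h i)) ->
  has_uexp (fun z => \prod_(i <- s | P i) f i z) (fun y => \prod_(i <- s | P i) h i y).
Proof.
move=> H; elim: s => [|i s IH].
  by apply: has_uexp_ext (has_uexp_cst (bholomorphic_cst 1)) => *; rewrite big_nil.
case: (boolP (P i)) => Pi.
  by apply: has_uexp_ext (has_uexpM (H i Pi) IH) => *; rewrite big_cons Pi.
by apply: has_uexp_ext IH => *; rewrite big_cons (negPf Pi).
Qed.

Lemma has_uexp_upar_pow k f h : (0 < k)%N -> has_uexp f h ->
  has_uexp (fun z => u_ z ^+ k *: f z) (fun=> 0).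
Proof.
move=> k0 hf; have hk := @has_uexp_prod _ (iota 0 k) predT _ _ (fun _ _ => has_uexp_upar).
apply: has_uexp_ext (has_uexpM hk hf) => [z hz|y Oy].
  rewrite big_const_seq count_predT size_iota iter_mulr_1 exprZn expr1n.
  by rewrite mulr_algl.
by rewrite big_const_seq count_predT size_iota iter_mulr_1 expr0n eqn0Ngt k0 mul0r.
Qed.

Lemma has_uexpZ (c : X) f h : has_uexp f h ->
  has_uexp (fun z => c *: f z) (fun y => c *: h y).
Proof.
move=> hf; apply: has_uexp_ext (has_uexpM (has_uexp_cst (bholomorphic_cst c%:A)) hf) => *;
by rewrite mulr_algl.
Qed.

Lemma has_uexpN f h : has_uexp f h -> has_uexp (fun z => - f z) (fun y => - h y).
Proof. by move=> /(has_uexpZ (-1)); apply: has_uexp_ext => *; rewrite scaleN1r. Qed.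

Lemma has_uexp_det k (f : 'rV[X]_n.+2 -> 'M[T]_k) (h : 'rV[X]_n.+1 -> 'M[T]_k) :
  (forall i j, has_uexp (fun z => f z i j) (fun y => h y i j)) ->
  has_uexp (fun z => \det (f z)) (fun y => \det (h y)).
Proof.
move=> H; apply: has_uexp_sum => s _; apply: has_uexpM.
  exact: (has_uexp_cst (bholomorphic_cst _)).
by apply: has_uexp_prod => i _; exact: H.
Qed.

(** As tau(u^i f_i) = u^(q i) tau(f_i), only exponents divisible by q occur. *)
Lemma has_uexp_tau f h : has_uexp f h -> has_uexp (fun z => tau (f z)) (fun y => tau (h y)).
Proof.
move=> [fs [a1 a2 a3]].
exists (fun k y => if (q %| k)%N then tau (fs (k %/ q)%N y) else 0); split.
- move=> k; case: (boolP (q %| k)%N) => qk; last exact: bholomorphic_cst.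
  by apply: bholomorphic_tau.
- move=> z hz; apply: (sums_inj gauss_un (f := fun i => (i * q)%N)).
  + by move=> i j /eqP; rewrite eqn_pmul2r ?q_gt0// => /eqP.
  + move=> k hk; case: ifP => qk; last by rewrite scaler0.
    by case: (hk (k %/ q)%N); rewrite divnK.
  apply: sums_ext (sums_tau (a2 z hz)) => i /=.
  by rewrite tauZ dvdn_mull// mulnK ?q_gt0// exprM.
- by move=> y Oy; rewrite dvdn0 div0n a3.
Qed.

Lemma has_uexp_itau k f h : has_uexp f h ->
  has_uexp (fun z => itau k (f z)) (fun y => itau k (h y)).
Proof. by move=> hf; elim: k => //= k; exact: has_uexp_tau. Qed.

End UExpansion.
Arguments has_uexp {F R X} lam {n} f h.

(** * Contribution of torsion points to the Eisenstein series at infinity *)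

Section TorsionSeries.
Context {F : finFieldType} {R : realType} {X : valuedField F R}.
Context (hX : vcomplete X).
Local Notation q := #|F|.
Local Notation N := (@vabs F R X).
Local Notation G := (@gauss_norm F R X).
Local Notation T := (tate X).
Local Notation th := (vtheta X).
Local Notation A := {poly F}.
Context {lam : X} (hlam : lam ^+ (q - 1) = - th).
Local Notation ppi := (pitilde lam).
Context {n : nat}.
Implicit Types (z : 'rV[X]_n.+2) (y : 'rV[X]_n.+1).
Local Notation XX z := (lattice_exp (lattice (ztilde z)) (z 0 ord0)).
Local Notation u_ z := (upar lam z).
Local Notation idx a := 'M[F]_(n.+1, (size (a : A)).-1).

(** Coordinates m / a of an a-torsion point modulo the lattice; m being reduced modulo a, they have
    absolute value below 1. For a = 0 the convention 1 / 0 = 0 gives the zero column. *)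
Definition torsion_col (a : A) (m : idx a) : 'cV[X]_n.+1 :=
  (Aemb X a)^-1 *: map_mx (Aemb X) (of_coefs m).

Definition torsion_exp (a : A) (m : idx a) y : X :=
  lattice_exp (lattice y) ((y *m torsion_col m) 0 0).

Lemma torsion_col_Kinf a (m : idx a) i : Kinf (torsion_col m i 0).
Proof. by rewrite !mxE; apply: KinfM; [apply/KinfV/Kinf_Aemb|exact: Kinf_Aemb]. Qed.

Lemma torsion_col_lt1 a (m : idx a) i : N (torsion_col m i 0) < 1.
Proof.
rewrite mxE [X in _ * X]mxE vabsM; have [a0|a0] := eqVneq a 0.
  have -> : (Aemb X a)^-1 = 0 by rewrite a0 rmorph0 invr0.
  by rewrite vabs0 mul0r.
have Na : 0 < N (Aemb X a) by rewrite vabs_gt0 Aemb_eq0.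
rewrite vabsV mulrC ltr_pdivrMr// mul1r [ltRHS]vabs_Aemb//; apply: vabs_Aemb_lt.
by rewrite mxE size_poly.
Qed.

Lemma torsion_col_dot a (m : idx a) y :
  (y *m torsion_col m) 0 0 = zdot y (of_coefs m) / Aemb X a.
Proof. by rewrite dotZ mulrC. Qed.

Lemma inv_Aemb_bound (a : A) : N (Aemb X a)^-1 <= q%:R / q%:R ^+ size a.
Proof.
have [->|a0] := eqVneq a 0.
  by rewrite rmorph0 invr0 vabs0 divr_ge0 ?exprn_ge0 ?ler0n.
rewrite vabsV vabs_Aemb// -{2}[size a]prednK ?size_poly_gt0// exprS invfM.
by rewrite mulrA divff ?qR_neq0// mul1r.
Qed.

Lemma inv_Aemb_small (C e : R) : 0 <= C -> 0 < e ->
  exists S : {fset A}, forall a, a \notin S -> N (Aemb X a)^-1 * C < e.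
Proof.
move=> C0 e0; have C1 : 0 < C * q%:R + 1 by rewrite ltr_wpDl// mulr_ge0 ?ler0n.
have [d hd] := @qRV_small F R (e / (C * q%:R + 1)) (divr_gt0 e0 C1).
exists (pbox d) => a; rewrite in_pbox -ltnNge => da.
apply: le_lt_trans (_ : q%:R / q%:R ^+ size a * C < _).
  by apply: (ler_wpM2r C0); exact: inv_Aemb_bound.
move: hd; rewrite ltr_pdivlMr// mulrC; apply: le_lt_trans.
rewrite mulrAC [q%:R * C]mulrC; apply: ler_pM; rewrite ?mulr_ge0 ?invr_ge0 ?exprn_ge0 ?ler0n//.
  by rewrite lerDl.
by rewrite lef_pV2 ?posrE ?qRX_gt0// ler_eXn2l ?qR_gt1// ltnW.
Qed.

Lemma torsion_exp_bound M : exists2 C : R, 1 <= C & forall a (m : idx a) y, Omega_ M y ->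
  N (torsion_exp m y) <= C.
Proof.
have [C C0 hC] := lattice_exp_bound hX (n := n) M; exists (Num.max 1 C).
  by rewrite le_max lexx.
move=> a m y Oy; rewrite le_max; apply/orP; right; apply: hC => // i.
exact: ltW (torsion_col_lt1 m i).
Qed.

Lemma bholomorphic_torsion_exp a (m : idx a) : bholomorphic (fun y => (torsion_exp m y)%:A).
Proof.
by apply: (bholomorphic_lattice_exp hX) => i; exact: ltW (torsion_col_lt1 m i).
Qed.

(** Geometric series: 1/(e(z_r) + x) = \sum_i (-x)^i (pitilde u)^(i+1), with |x| bounded uniformly
    over all torsion points. The factor 1/a makes the sums over a converge, and after division by u
    the term i = 0 does not involve x. *)
Lemma has_uexp_torsion (Y : forall a, idx a -> 'rV[X]_n.+1 -> T) (f : 'rV[X]_n.+2 -> T) :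
  (forall a (m : idx a), bholomorphic (Y a m)) ->
  (forall M, exists2 C : R, 0 <= C & forall a (m : idx a) y, Omega_ M y -> G (Y a m y) <= C) ->
  (forall z, near_infinity z -> sums G (fun a => (Aemb X a)^-1 *:
     \sum_(m : idx a) (XX z + torsion_exp m (ztilde z))^-1 *: Y a m (ztilde z)) (f z)) ->
  exists2 h, has_uexp lam (fun z => (u_ z)^-1 *: f z) h &
    forall y, Omega y ->
      sums G (fun a => (Aemb X a)^-1 *: \sum_(m : idx a) Y a m y) (ppi^-1 *: h y).
Proof.
move=> hY bY hf.
pose t (i : nat) (a : A) y : T := (Aemb X a)^-1 *:
  \sum_(m : idx a) (- torsion_exp m y) ^+ i *: Y a m y.
have tb i M : exists2 C : R, 0 <= C & forall a y, Omega_ M y -> G (t i a y) <= N (Aemb X a)^-1 * C.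
  have [C C0 hC] := bY M; have [B B1 hB] := torsion_exp_bound M.
  exists (B ^+ i * C); first by rewrite mulr_ge0// exprn_ge0// (le_trans ler01).
  move=> a y Oy; rewrite gaussZ; apply: (ler_wpM2l (vabs_ge0 _)).
  apply: (un_sum_le gauss_un) => [|m _].
    by rewrite mulr_ge0// exprn_ge0// (le_trans ler01).
  rewrite gaussZ; apply: ler_pM; rewrite ?vabs_ge0 ?gauss_ge0 ?hC//.
  by rewrite vabsX vabsN lerXn2r ?nnegrE ?vabs_ge0 ?hB// (le_trans ler01).
have tn i : uniformly_null (t i).
  move=> M e e0; have [C C0 hC] := tb i M; have [S hS] := inv_Aemb_small C0 e0.
  by exists S => a /hS h z /hC; move=> /(_ a) /le_lt_trans; apply.
have /choice[s hs] (i : nat) : exists s, forall y, Omega y -> sums G ((t i)^~ y) (s y).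
  exact: (uniformly_null_sums hX (tn i)).
have th' i a : bholomorphic (t i a).
  apply: bholomorphicZ; apply: bholomorphic_sum => m _.
  apply: bholomorphic_ext (bholomorphicM (bholomorphicX i (bholomorphicN (bholomorphic_torsion_exp m))) (hY a m)).
  by move=> y _; rewrite -scaleNr exprZn expr1n mulr_algl.
exists (fun y => ppi *: s 0%N y); last first.
  move=> y Oy; rewrite scalerA mulVf ?(pitilde_neq0 hX hlam)// scale1r.
  apply: sums_ext (hs 0%N y Oy) => a; congr (_ *: _).
  by apply: eq_bigr => m _; rewrite expr0 scale1r.
exists (fun i y => ppi ^+ i.+1 *: s i y); split => //.
  move=> i; apply: bholomorphicZ; apply: (bholomorphic_sums (th' i) (tn i)).
  exact: hs.
move=> z hz; have Oz : Omega (ztilde z) by apply: Omega_ztilde; case: hz.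
have [M OM] := Omega_ex hX Oz; have [C C0 hC] := bY M.
pose rho := vnorm (ztilde z) / imag_last z.
have /andP[rho0 rho1] := torsion_ratio_lt1 hz.
have X0 := lattice_exp_near_infinity_neq0 hX hz.
have NX : 0 < N (XX z) by rewrite vabs_gt0.
have p0 := pitilde_neq0 hX hlam.
have uE : u_ z = ppi^-1 / XX z by [].
have xr a (m : idx a) : N (torsion_exp m (ztilde z) / XX z) <= rho.
  rewrite vabsM vabsV ler_pdivrMr//; apply: (torsion_ratio hX hz) => i.
  exact: ltW (torsion_col_lt1 m i).
(* All terms of all series as one null family on pairs: summed over i first it gives f / u, summed
   over a first it gives the expansion in powers of u. *)
pose w (p : A * nat) : T := u_ z ^+ p.2 *: (ppi ^+ p.2.+1 *: t p.2 p.1 (ztilde z)).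
have wE a i : w (a, i) = (Aemb X a)^-1 *: (ppi *:
    \sum_(m : idx a) (- (torsion_exp m (ztilde z) / XX z)) ^+ i *: Y a m (ztilde z)).
  rewrite /w /t /= !scaler_sumr; apply: eq_bigr => m _; rewrite !scalerA; congr (_ *: _).
  rewrite uE; move: (torsion_exp m _) (XX z) ppi (Aemb X a)^-1 X0 p0 => t' x p c x0 p0.
  rewrite -mulNr !exprMn !exprVn exprS.
  have := expf_neq0 i x0; have := expf_neq0 i p0.
  move: (x ^+ i) (p ^+ i) (_ ^+ i) => xi pi ti pi_neq0 xi_neq0.
  by field; rewrite xi_neq0 pi_neq0.
have wb a i : G (w (a, i)) <= (N (Aemb X a)^-1 * (N ppi * C + 1)) * rho ^+ i.
  rewrite wE !gaussZ -mulrA; apply: (ler_wpM2l (vabs_ge0 _)).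
  apply: le_trans (_ : N ppi * (rho ^+ i * C) <= _).
    apply: (ler_wpM2l (vabs_ge0 _)); apply: (un_sum_le gauss_un) => [|m _].
      by rewrite mulr_ge0// exprn_ge0.
    rewrite gaussZ; apply: ler_pM; rewrite ?vabs_ge0 ?gauss_ge0 ?hC//.
    by rewrite vabsX vabsN lerXn2r ?nnegrE ?vabs_ge0.
  rewrite mulrCA mulrC; apply: (ler_wpM2r (exprn_ge0 _ rho0)).
  by rewrite lerDl.
have K0 : 0 < N ppi * C + 1 by rewrite ltr_wpDl// mulr_ge0 ?vabs_ge0.
have [v hv] : exists v, sums G w v.
  apply: (null_sums gauss_un (gauss_ucomplete (vabs_ucomplete hX))).
  apply: (@null_mul_pair R _ _ (fun a => N (Aemb X a)^-1 * (N ppi * C + 1))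
    (fun i => rho ^+ i) _ G w (N ppi * C + 1) 1) => //.
  - move=> a; apply/andP; split; first by rewrite mulr_ge0 ?vabs_ge0 ?(ltW K0).
    apply: ler_piMl; first exact: ltW.
    have [->|a0] := eqVneq a 0; first by rewrite rmorph0 invr0 vabs0.
    by rewrite vabsV invf_le1 ?vabs_Aemb_ge1// vabs_gt0 Aemb_eq0.
  - by move=> i; rewrite exprn_ge0//= exprn_ile1// ltW.
  - by move=> e; exact: (inv_Aemb_small (ltW K0)).
  - move=> e e0; have [k hk] := expr_small rho0 rho1 e0.
    exists [fset i in iota 0 k]%fset => i.
    by rewrite !inE mem_iota add0n /= -leqNgt => /hk.
have v1 : sums G (fun a => (u_ z)^-1 *: ((Aemb X a)^-1 *:
     \sum_(m : idx a) (XX z + torsion_exp m (ztilde z))^-1 *: Y a m (ztilde z))) v.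
  apply: (sums_regroup gauss_un (p := fst) hv) => a.
  apply: (sums_inj gauss_un (f := fun i => (a, i))) => [i i' []//|[a' i] h|].
    by case: eqP => //= aa; case: (h i); rewrite aa.
  have geo (m : idx a) : sums G
      (fun i => (- (torsion_exp m (ztilde z) / XX z)) ^+ i *: Y a m (ztilde z))
      ((1 - - (torsion_exp m (ztilde z) / XX z))^-1 *: Y a m (ztilde z)).
    apply: sums_scalel; apply: sums_geometric; rewrite vabsN.
    exact: le_lt_trans (xr a m) rho1.
  have geoS : sums G (fun i => \sum_(m : idx a)
        (- (torsion_exp m (ztilde z) / XX z)) ^+ i *: Y a m (ztilde z))
      (\sum_(m : idx a) (1 - - (torsion_exp m (ztilde z) / XX z))^-1 *: Y a m (ztilde z)).
    by apply: (sums_sum gauss_un) => m _; exact: geo.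
  suff E : (Aemb X a)^-1 *: (ppi *: \sum_(m : idx a)
        (1 - - (torsion_exp m (ztilde z) / XX z))^-1 *: Y a m (ztilde z)) =
      (u_ z)^-1 *: ((Aemb X a)^-1 *:
        \sum_(m : idx a) (XX z + torsion_exp m (ztilde z))^-1 *: Y a m (ztilde z)).
    have := sums_scale (Aemb X a)^-1 (sums_scale ppi geoS); rewrite E.
    by apply: sums_ext => i /=; rewrite eqxx wE.
  rewrite !scaler_sumr; apply: eq_bigr => m _; rewrite !scalerA; congr (_ *: _).
  have xX : XX z + torsion_exp m (ztilde z) != 0.
    apply/eqP => xX0; have := xr a m.
    have -> : torsion_exp m (ztilde z) = - XX z by apply/eqP; rewrite -addr_eq0 addrC xX0.
    by rewrite mulNr divff// vabsN vabs1 => /le_lt_trans/(_ rho1); rewrite ltxx.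
  rewrite uE; move: (XX z) (torsion_exp m _) (Aemb X a)^-1 ppi X0 p0 xX => x t' c p x0 p0 xt.
  by field; rewrite xt x0 p0 oner_neq0.
have -> : (u_ z)^-1 *: f z = v.
  by apply: (sums_uniq gauss_un _ v1); apply: sums_scale; exact: hf.
apply: (sums_regroup gauss_un (p := snd) hv) => i.
apply: (sums_inj gauss_un (f := fun a => (a, i))) => [a a' []//|[a i'] h|].
  by case: eqP => //= ii; case: (h a); rewrite ii.
have := sums_scale (u_ z ^+ i) (sums_scale (ppi ^+ i.+1) (hs i _ Oz)).
by apply: sums_ext => a /=; rewrite eqxx.
Qed.

Definition cons_col (a : A) (b : 'cV[A]_n.+1) : 'cV[A]_n.+2 :=
  \col_i (if unlift ord0 i is Some j then b j 0 else a).

Lemma cons_col0 a b : cons_col a b ord0 0 = a.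
Proof. by rewrite mxE unlift_none. Qed.
Lemma cons_colS a b j : cons_col a b (lift ord0 j) 0 = b j 0.
Proof. by rewrite mxE liftK. Qed.
Lemma cons_col_eta (c : 'cV[A]_n.+2) : c = cons_col (c ord0 0) (row' ord0 c).
Proof.
apply/matrixP => i k; rewrite ord1 mxE; case: unliftP => [j ->|->//].
by rewrite mxE.
Qed.
Lemma zdot_cons_col z a b : zdot z (cons_col a b) = Aemb X a * z 0 ord0 + zdot (ztilde z) b.
Proof.
rewrite /zdot dot_recl [X in _ * X]mxE cons_col0 mulrC; congr (_ + (_ *m _) _ _).
by apply/matrixP => i k; rewrite !mxE ord1 liftK.
Qed.

Lemma sums_cons_col (x : 'cV[A]_n.+2 -> T) (s : T) (y : A -> T) :
  sums G x s -> (forall a, sums G (fun b => x (cons_col a b)) (y a)) -> sums G y s.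
Proof.
move=> xs xy; apply: (sums_regroup gauss_un (p := fun c : 'cV[A]_n.+2 => c ord0 0) xs) => a.
apply: (sums_inj gauss_un (f := cons_col a)).
- move=> b b' /matrixP bb; apply/matrixP => i j; have := bb (lift ord0 i) 0.
  by rewrite !cons_colS ord1.
- by move=> c hc; case: eqP => // ca; case: (hc (row' ord0 c)); rewrite -ca -cons_col_eta.
- by apply: sums_ext (xy a) => b /=; rewrite cons_col0 eqxx.
Qed.

Lemma sums_opp (V : zmodType) (NV : V -> R) (W : zmodType)
  (x : W -> V) s : sums NV x s -> sums NV (fun w => x (- w)) s.
Proof.
move=> xs; have := sums_sub (f := fun w : W => - w) (@oppr_inj W) _ xs; apply => w hw.
by case: (hw (- w)); rewrite opprK.
Qed.

Lemma null_inv_zdotD y w : Omega y -> nullfam N (fun b => (w + zdot y b)^-1).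
Proof.
move=> Oy e /(null_inv_zdot hX Oy w)[S hS].
exists (-%R @` S)%fset => b bS; rewrite -[zdot y b]opprK -zdotN; apply: hS.
by apply: contraNN bS => bS; apply/imfsetP; exists (- b) => //=; rewrite opprK.
Qed.

Lemma sums_null_chi y (k : 'cV[A]_n.+1 -> A) (w : X) : Omega y ->
  exists t, sums G (fun b => (w + zdot y b)^-1 *: chi (k b)) t.
Proof.
move=> Oy; apply: (null_sums gauss_un (gauss_ucomplete (vabs_ucomplete hX))).
move=> e /(null_inv_zdotD w Oy)[S hS]; exists S => b /hS; apply: le_lt_trans.
by rewrite gaussZ ler_piMr ?vabs_ge0 ?gauss_chi.
Qed.

(* For a fixed first coordinate a, the lattice points are grouped by their
   other coordinates modulo a. *)
Lemma sums_mod_first z a (k : 'cV[A]_n.+1 -> A) (s : idx a -> T) :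
  near_infinity z -> a != 0 ->
  (forall (m : idx a), sums G (fun b => (z 0 ord0 + (ztilde z *m torsion_col m) 0 0 +
      zdot (ztilde z) b)^-1 *: chi (k (of_coefs m + a *: b))) (s m)) ->
  sums G (fun b => (Aemb X a * z 0 ord0 + zdot (ztilde z) b)^-1 *: chi (k b))
    ((Aemb X a)^-1 *: \sum_m s m).
Proof.
move=> hz a0 hs; have Ozt : Omega (ztilde z) by apply: Omega_ztilde; case: hz.
have [t ht] := sums_null_chi k (Aemb X a * z 0 ord0) Ozt.
suff <- : t = (Aemb X a)^-1 *: \sum_m s m by [].
rewrite scaler_sumr; apply: (sums_mod gauss_un a0 ht) => m.
apply: sums_ext (sums_scale (Aemb X a)^-1 (hs m)) => b; rewrite scalerA -invfM.
congr (_^-1 *: _); rewrite torsion_col_dot zdotD zdotZ.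
have Aa : Aemb X a != 0 by rewrite Aemb_eq0.
by field.
Qed.

Local Notation W z m := (XX z + torsion_exp m (ztilde z)).

Lemma lattice_exp_shift z a (m : idx a) : near_infinity z ->
  lattice_exp (lattice (ztilde z)) (z 0 ord0 + (ztilde z *m torsion_col m) 0 0) = W z m.
Proof. by move=> [Oz _]; rewrite (lattice_expD hX (Omega_ztilde Oz)). Qed.

Lemma sums_inv_shift z a (m : idx a) (c : T) : near_infinity z ->
  sums G (fun b => (z 0 ord0 + (ztilde z *m torsion_col m) 0 0 + zdot (ztilde z) b)^-1 *: c)
    ((W z m)^-1 *: c).
Proof.
move=> hz; have Ozt : Omega (ztilde z) by apply: Omega_ztilde; case: hz.
apply: sums_scalel; rewrite -lattice_exp_shift//.
have h b := near_infinity_not_lattice b hz (torsion_col_Kinf m).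
have := sums_opp (sums_inv_zdot hX Ozt h); apply: sums_ext => b.
by rewrite zdotN opprK.
Qed.

Lemma Eis_first z : near_infinity z ->
  sums G (fun a => (Aemb X a)^-1 *: \sum_(m : idx a) (W z m)^-1 *: chi a) (Eis 1 z ord0 0).
Proof.
move=> hz; have Oz : Omega z by case: hz.
apply: (sums_cons_col (Eis_sums hX Oz ord0 (ltn0Sn 0))) => a.
have [->|a0] := eqVneq a 0.
  rewrite rmorph0 invr0 scale0r; apply: sums_ext (sums0 gauss_un) => b.
  by rewrite cons_col0 rmorph0 scaler0.
have := @sums_mod_first z a (fun=> a) (fun m => (W z m)^-1 *: chi a) hz a0.
move=> /(_ (fun m => sums_inv_shift m (chi a) hz)); apply: sums_ext => b.
by rewrite zdot_cons_col cons_col0 expr1.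
Qed.

(** For b = m + a b', chi(b_j) = chi(m_j) + chi(a) chi(b'_j); after a change of sign of b', the
    second part gives - chi(a) times I at z_r + \tilde z m / a, divided by e. Additivity separates
    I(z_r), common to all a and m and multiplied by the series of [Eis_first]; a = 0 contributes the
    E_1 of \tilde z. *)
Lemma Eis_next z (I : X -> 'cV[T]_n.+1) j : near_infinity z ->
  {morph I : w w' / w + w'} ->
  (forall w, (forall a, w != zdot (ztilde z) a) -> forall i,
     sums G (fun a => (w - zdot (ztilde z) a)^-1 *: chi (a i 0))
       ((lattice_exp (lattice (ztilde z)) w)^-1 *: I w i 0)) ->
  sums G (fun a => (Aemb X a)^-1 *: \sum_(m : idx a) (W z m)^-1 *:
      (chi (of_coefs m j 0) - chi a * I ((ztilde z *m torsion_col m) 0 0) j 0))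
    (Eis 1 z (lift ord0 j) 0 - Eis 1 (ztilde z) j 0 + I (z 0 ord0) j 0 * Eis 1 z ord0 0).
Proof.
move=> hz ID hI; have Oz : Omega z by case: hz.
have Ozt : Omega (ztilde z) := Omega_ztilde Oz.
pose f a : T := (Aemb X a)^-1 *: \sum_(m : idx a) (W z m)^-1 *: chi a.
pose g a : T := (Aemb X a)^-1 *: \sum_(m : idx a) (W z m)^-1 *:
      (chi (of_coefs m j 0) - chi a * I ((ztilde z *m torsion_col m) 0 0) j 0).
pose d (a : A) : T := if a == 0 then Eis 1 (ztilde z) j 0 else 0.
have E : sums G (fun a => d a + g a - I (z 0 ord0) j 0 * f a) (Eis 1 z (lift ord0 j) 0).
  apply: (sums_cons_col (Eis_sums hX Oz (lift ord0 j) (ltn0Sn 0))) => a.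
  have [->|a0] := eqVneq a 0.
    rewrite /d /g /f eqxx rmorph0 invr0 !scale0r mulr0 subr0 addr0.
    apply: sums_ext (Eis_sums hX Ozt j (ltn0Sn 0)) => b.
    by rewrite zdot_cons_col cons_colS rmorph0 mul0r add0r.
  have -> : d a + g a - I (z 0 ord0) j 0 * f a = (Aemb X a)^-1 *: \sum_(m : idx a)
      ((W z m)^-1 *: chi (of_coefs m j 0) - chi a * ((W z m)^-1 *:
        I (z 0 ord0 + (ztilde z *m torsion_col m) 0 0) j 0)).
    rewrite /d (negPf a0) add0r /g /f -scalerAr -scalerBr; congr (_ *: _).
    rewrite mulr_sumr -sumrB; apply: eq_bigr => m _; rewrite ID [(I _ + I _) _ _]mxE.
    rewrite -!scalerAr -!scalerBr; congr (_ *: _).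
    by rewrite mulrDr opprD addrA addrAC [I _ _ _ * chi a]mulrC.
  have := @sums_mod_first z a (fun b => b j 0) (fun m => (W z m)^-1 *: chi (of_coefs m j 0) -
     chi a * ((W z m)^-1 *: I (z 0 ord0 + (ztilde z *m torsion_col m) 0 0) j 0)) hz a0.
  move=> H; have {}H := H _; apply: sums_ext (H _) => [b|m].
    by rewrite zdot_cons_col cons_colS expr1.
  have hw b := near_infinity_not_lattice b hz (torsion_col_Kinf m).
  have h1 := sums_inv_shift m (chi (of_coefs m j 0)) hz.
  have := sums_mull (- chi a) (sums_opp (hI _ hw j)).
  rewrite lattice_exp_shift// mulNr => h2.
  apply: sums_ext (sumsD gauss_un h1 h2) => b.
  rewrite zdotN opprK !mxE rmorphD rmorphM /= scalerDr; congr (_ + _).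
  by rewrite rmorphN /= scalerN mulrNN -scalerAr.
have h1 := sumsD gauss_un E (sums_mull (I (z 0 ord0) j 0) (Eis_first hz)).
have h2 : sums G (fun a => - d a) (- Eis 1 (ztilde z) j 0).
  have := @sums_fset _ _ _ gauss_un _ (fun a => - d a) [fset 0]%fset.
  rewrite big_seq_fset1 /d eqxx; apply => a; rewrite inE => /negPf ->.
  by rewrite oppr0.
have := sumsD gauss_un h1 h2; rewrite addrAC; apply: sums_ext => a.
by rewrite subrK addrC addKr.
Qed.

End TorsionSeries.

(** * Expansion of the coordinates of E_1 *)

Section DetExpansion.
Context {F : finFieldType} {R : realType} {X : valuedField F R}.
Context (hX : vcomplete X).
Local Notation q := #|F|.
Local Notation G := (@gauss_norm F R X).
Local Notation T := (tate X).
Local Notation th := (vtheta X).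
Local Notation A := {poly F}.
Context {lam : X} (hlam : lam ^+ (q - 1) = - th).
Local Notation ppi := (pitilde lam).

Lemma sum_units (V : lmodType X) (x : V) : \sum_(c : F | c != 0) x = - x.
Proof.
have : \sum_(c : F) x = 0 by rewrite sumr_const -scaler_nat q_eq0 scale0r.
by rewrite (bigD1 0)//= => /eqP; rewrite addrC addr_eq0 => /eqP.
Qed.

Context {n : nat}.
Implicit Types (z : 'rV[X]_n.+2) (y : 'rV[X]_n.+1).
Local Notation XX z := (lattice_exp (lattice (ztilde z)) (z 0 ord0)).
Local Notation u_ z := (upar lam z).
Local Notation idx a := 'M[F]_(n.+1, (size (a : A)).-1).

(** In the constant coefficient, chi(a)/a is multiplied by the number of residues modulo a, a power
    of q that vanishes in X unless a is a nonzero constant. Each of the q - 1 constants contributes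
    1, in total -1. *)
Lemma has_uexp_Eis_first :
  has_uexp lam (fun z => (u_ z)^-1 *: Eis 1 z ord0 0) (fun=> - ppi%:A).
Proof.
have [] := @has_uexp_torsion _ _ _ hX _ hlam n (fun a _ _ => chi a) (fun z => Eis 1 z ord0 0).
- by move=> a m; exact: bholomorphic_cst.
- by move=> M; exists 1 => // a m y _; exact: gauss_chi.
- by move=> z; exact: Eis_first.
move=> h hh h0; apply: has_uexp_ext hh => // y Oy.
suff : ppi^-1 *: h y = - 1.
  move=> /(congr1 (fun x => ppi *: x)); rewrite scalerA mulfV ?(pitilde_neq0 hX hlam)// scale1r.
  by move=> ->; rewrite scalerN.
apply: (sums_uniq gauss_un (h0 y Oy)); rewrite -[- 1]sum_units big_mkcond /=.
apply: (sums_inj gauss_un (f := fun c : F => c%:P)) => [c c' /polyC_inj//|a ha|].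
- rewrite sumr_const card_mx -scaler_nat natrX.
  have [sa|sa] := leqP (size a) 1; first by case: (ha a`_0); apply: size1_polyC.
  by rewrite q_eq0 expr0n muln_eq0 /= -subn1 subn_eq0 leqNgt sa scale0r scaler0.
- apply: sums_ext (sums_finType gauss_un _) => c /=; case: eqP => [->|/eqP c0] /=.
    by rewrite rmorph0 invr0 scale0r.
  rewrite sumr_const card_mx size_polyC c0 muln0 expn0 mulr1n chiC AembC scalerA mulVf ?scale1r//.
  by rewrite fmorph_eq0.
Qed.

(** S collects the torsion series, which are divisible by u; v is the value at z_r of the
    interpolating function, of which only the behaviour under tau is recorded. *)
Lemma has_uexp_Eis_next j : exists S v : 'rV[X]_n.+2 -> T,
  [/\ exists h, has_uexp lam (fun z => (u_ z)^-1 *: S z) h,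
      forall z, near_infinity z -> tau (v z) = v z + XX z *: Eis 1 (ztilde z) j 0
    & forall z, near_infinity z ->
        Eis 1 z (lift ord0 j) 0 = Eis 1 (ztilde z) j 0 + S z - v z * Eis 1 z ord0 0].
Proof.
have [g hg] := bholomorphic_interpolation hX j.
have {}hg a (m : idx a) := hg _ (torsion_col_Kinf m) (torsion_col_lt1 m).
(* At a torsion point w the interpolating function is e(w) times its series [g]; in this form it
   depends holomorphically on \tilde z, with bounds uniform in a and m. *)
pose Y a (m : idx a) y : T :=
  chi (of_coefs m j 0) - chi a * (torsion_exp m y *: g (torsion_col m) y).
have /choice[p hp] z : exists p : T * T, near_infinity z ->
    [/\ sums G (fun a => (Aemb X a)^-1 *: \sum_(m : idx a)
          (XX z + torsion_exp m (ztilde z))^-1 *: Y a m (ztilde z)) p.1,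
        tau p.2 = p.2 + XX z *: Eis 1 (ztilde z) j 0
      & p.1 = Eis 1 z (lift ord0 j) 0 - Eis 1 (ztilde z) j 0 + p.2 * Eis 1 z ord0 0].
  have [hz|nz] := pselect (near_infinity z); last by exists 0.
  have Ozt : Omega (ztilde z) by apply: Omega_ztilde; case: hz.
  have [I [ID I0 Is It]] := exists_interpolation hX Ozt.
  exists (Eis 1 z (lift ord0 j) 0 - Eis 1 (ztilde z) j 0 + I (z 0 ord0) j 0 * Eis 1 z ord0 0,
          I (z 0 ord0) j 0) => _ /=; split => //; last first.
    apply: It => a; apply/eqP => za; have := lattice_exp_near_infinity_neq0 hX hz.
    by rewrite za (lattice_exp_zdot hX Ozt) eqxx.
  apply: sums_ext (Eis_next hX j hz ID Is) => a; congr (_ *: _); apply: eq_bigr => m _.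
  (* For the zero column both sides vanish; for the others the torsion point lies outside the
     lattice, where the series represents the interpolating function. *)
  congr (_ *: (_ - _ * _)); have [c0|c0] := eqVneq (torsion_col (X := X) m) 0.
    rewrite /torsion_exp c0 mulmx0 mxE (lattice_exp0 hX Ozt) scale0r.
    by rewrite -(zdot0 (ztilde z)) I0 mxE rmorph0.
  have nl b := small_not_lattice hX b Ozt (torsion_col_Kinf m) (torsion_col_lt1 m) c0.
  have [_ _ /(_ _ Ozt) hs] := hg a m; rewrite -(sums_uniq gauss_un (Is _ nl j) hs).
  by rewrite scalerA mulfV ?scale1r//; exact: lattice_exp_neq0.
exists (fun z => (p z).1), (fun z => (p z).2); split.
- have [||z hz|h hh _] := @has_uexp_torsion _ _ _ hX _ hlam n Y (fun z => (p z).1).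
  + move=> a m; apply: bholomorphicB; first exact: bholomorphic_cst.
    apply: bholomorphicM; first exact: bholomorphic_cst.
    have [hgm _ _] := hg a m.
    apply: bholomorphic_ext (bholomorphicM (bholomorphic_torsion_exp hX m) hgm) => y _.
    by rewrite mulr_algl.
  + move=> M; have [C C1 hC] := torsion_exp_bound hX (n := n) M.
    have C0 : 0 <= C by apply: le_trans C1.
    exists (Num.max 1 (C * q%:R ^+ M)) => [|a m y Oy]; first by rewrite le_max ler01.
    apply: (unB_le gauss_un); rewrite le_max; apply/orP; [left; exact: gauss_chi|right].
    have [_ hgb _] := hg a m.
    apply: le_trans (gaussM _ _) _; rewrite gaussZ -[leRHS]mul1r.
    apply: ler_pM; rewrite ?mulr_ge0 ?vabs_ge0 ?gauss_ge0 ?gauss_chi//.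
    by apply: ler_pM; rewrite ?vabs_ge0 ?gauss_ge0 ?hC ?hgb.
  + by have [] := hp z hz.
  by exists h.
- by move=> z /hp[].
- by move=> z /hp[_ _ ->]; ring.
Qed.

End DetExpansion.

(** * Expansion of the determinant *)

Section DetXiExpansion.
Context {F : finFieldType} {R : realType} {X : valuedField F R}.
Context (hX : vcomplete X).
Local Notation q := #|F|.
Local Notation N := (@vabs F R X).
Local Notation T := (tate X).
Local Notation th := (vtheta X).
Local Notation A := {poly F}.
Context {lam : X} (hlam : lam ^+ (q - 1) = - th).
Local Notation ppi := (pitilde lam).
Context {n : nat}.
Implicit Types (z : 'rV[X]_n.+2) (y : 'rV[X]_n.+1).
Local Notation XX z := (lattice_exp (lattice (ztilde z)) (z 0 ord0)).
Local Notation u_ z := (upar lam z).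

(** The first coordinate is u times an expansion, so its k-th twist is divisible by u^(q^k) and
    absorbs a pole of order e < q^k. *)
Lemma has_uexp_itau_first k e : (e < q ^ k)%N ->
  has_uexp lam (fun z => (u_ z) ^- e *: itau k (Eis 1 z ord0 0)) (fun=> 0).
Proof.
move=> ek; apply: has_uexp_ext (has_uexp_upar_pow hX (k := q ^ k - e) _
  (has_uexp_itau k (has_uexp_Eis_first hX hlam (n := n)))) => // [z hz|]; last by rewrite subn_gt0.
rewrite itauZ scalerA; congr (_ *: _).
by rewrite expfB// exprVn mulrAC mulfV ?mul1r// expf_neq0// (upar_neq0 hX hlam).
Qed.

Lemma itau_quasi_periodic k (v E : T) (x : X) : tau v = v + x *: E ->
  itau k v = v + \sum_(l < k) x ^+ (q ^ l) *: itau l E.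
Proof.
move=> h; elim: k => [|k IH]; first by rewrite big_ord0 addr0.
by rewrite itauSr h rmorphD /= IH big_ord_recr /= itauZ addrA.
Qed.

Lemma has_uexp_det_Xi : has_uexp lam (fun z => (u_ z)^-1 *: \det (Xi z))
  (fun y => - (ppi *: tau (\det (Xi_tau y)))).
Proof.
have /choice[S /choice[v hSv]] j := has_uexp_Eis_next hX hlam (n := n) j.
have p0 := pitilde_neq0 hX hlam.
(* Subtracting v_j times the first row from row j removes the interpolating
   function, which has a pole at infinity, from the expansion of row j. *)
pose w z (i : 'I_n.+2) : T := if unlift ord0 i is Some j then v j z else 0.
pose d z (i : 'I_n.+2) : T := if i == ord0 then (u_ z)^-1%:A else 1.
pose L z : 'M[T]_n.+2 := \matrix_(i, j) ((i == j)%:R * d z i + (j == ord0)%:R * w z i).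
pose H y : 'M[T]_n.+2 := \matrix_(i, k)
  if unlift ord0 i is Some j then itau k (Eis 1 y j 0) else if k == ord0 then - ppi%:A else 0.
have LXi z i k : (L z *m Xi z) i k = d z i * Xi z i k + w z i * Xi z ord0 k.
  rewrite mxE; under eq_bigr do rewrite mxE mulrDl -!mulrA.
  rewrite big_split /= (bigD1 i)//= eqxx mul1r big1 ?addr0 => [|j /negPf].
    rewrite [in X in _ + X](bigD1 ord0)//= mul1r big1 ?addr0// => j /negPf ->.
    by rewrite mul0r.
  by rewrite eq_sym => ->; rewrite mul0r.
have detL z : \det (L z) = (u_ z)^-1%:A.
  rewrite det_trig; last first.
    apply/is_trig_mxP => i j ij; rewrite mxE [i == j]ltn_eqF// mul0r add0r.
    by rewrite [j == ord0]gtn_eqF ?mul0r//; exact: leq_ltn_trans ij.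
  rewrite (bigD1 ord0)//= big1 ?mulr1 => [|i i0].
    by rewrite mxE eqxx /w unlift_none mulr0 addr0 mul1r /d eqxx.
  by rewrite mxE eqxx /d (negPf i0) mul0r addr0 mulr1.
have detH y : \det (H y) = - (ppi *: tau (\det (Xi_tau y))).
  rewrite (expand_det_row _ ord0) (bigD1 ord0)//= big1 ?addr0 => [|k /negPf k0]; last first.
    by rewrite mxE unlift_none k0 mul0r.
  rewrite mxE unlift_none eqxx /cofactor expr0 mul1r mulNr mulr_algl; congr (- (_ *: _)).
  (* Deleting column 0 leaves the twists of exponent k + 1 of the coordinates in lower rank, whence
     one tau outside the determinant. *)
  rewrite -det_map_mx; congr (\det _); apply/matrixP => i k.
  by rewrite 3![LHS]mxE liftK lift0 [RHS]mxE /=; congr tau; rewrite [RHS]mxE.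
apply: has_uexp_ext (_ : has_uexp lam (fun z => \det (L z *m Xi z)) (fun y => \det (H y))).
- by move=> z hz; rewrite det_mulmx detL mulr_algl.
- by move=> y _; exact: detH.
apply: (has_uexp_det hX) => i k; case: (unliftP ord0 i) => [j ->|->]; last first.
  apply: has_uexp_ext (_ : has_uexp lam (fun z => (u_ z)^-1 *: itau k (Eis 1 z ord0 0))
    (fun y => if k == ord0 then - ppi%:A else 0)) => [z [Oz _]|y _|].
  - by rewrite LXi /d eqxx /w unlift_none mul0r addr0 mulr_algl (Xi_itau hX Oz).
  - by rewrite mxE unlift_none.
  - have [->|k0] := eqVneq k ord0; first exact: has_uexp_Eis_first.
    apply: (has_uexp_itau_first (e := 1)); rewrite -{1}(expn0 q) ltn_exp2l ?q_gt1//.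
    by rewrite lt0n.
have [[h hS] hv hE] := hSv j.
have hS0 : has_uexp lam (S j) (fun=> 0).
  apply: has_uexp_ext (has_uexp_upar_pow hX (ltn0Sn 0) hS) => // z hz.
  by rewrite expr1 scalerA mulfV ?scale1r// (upar_neq0 hX hlam).
have hEt l : bholomorphic (fun y => itau l (Eis 1 y j 0)).
  by apply: bholomorphic_itau; exact: (bholomorphic_Eis hX).
(* The difference tau^k(v) - v is a sum of terms e(z_r)^(q^l) tau^l(E_1) with l < k, that is of
   poles of order q^l in u; the factor tau^k(E_(1,r)), divisible by u^(q^k), leaves a series without
   constant term. *)
have hpole : has_uexp lam (fun z => \sum_(l < k) XX z ^+ (q ^ l) *:
    (itau l (Eis 1 (ztilde z) j 0) * itau k (Eis 1 z ord0 0))) (fun=> 0).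
  have H0 (l : 'I_k) : true -> has_uexp lam (fun z => XX z ^+ (q ^ l) *:
      (itau l (Eis 1 (ztilde z) j 0) * itau k (Eis 1 z ord0 0))) (fun=> 0).
    move=> _; have lk : (q ^ l < q ^ k)%N by rewrite ltn_exp2l ?q_gt1.
    apply: has_uexp_ext (has_uexpZ hX (ppi ^- (q ^ l))
      (has_uexpM hX (has_uexp_cst (hEt l)) (has_uexp_itau_first lk))) => [z hz|y _].
      rewrite -scalerAr scalerA; congr (_ *: _).
      have -> : u_ z = (ppi * XX z)^-1 by rewrite invfM.
      by rewrite exprVn invrK [(ppi * XX z) ^+ _]exprMn mulKf// expf_neq0.
    by rewrite mulr0 scaler0.
  by apply: has_uexp_ext (has_uexp_sum (index_enum 'I_k) H0) => // y _; rewrite big1.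
apply: has_uexp_ext (has_uexpD (has_uexpD (has_uexp_cst (hEt k)) (has_uexp_itau k hS0))
  (has_uexpN hX hpole)) => [z hz|y _]; last by rewrite rmorph0 subr0 addr0 [RHS]mxE liftK.
have Oz : Omega z by case: hz.
rewrite LXi /d /= mul1r /w liftK !(Xi_itau hX Oz) (hE z hz) rmorphB rmorphD rmorphM /=.
rewrite (itau_quasi_periodic k (hv z hz)).
under eq_bigr do rewrite scalerAl.
by rewrite -mulr_suml; ring.
Qed.

End DetXiExpansion.

(** * Uniqueness of the coefficient of u, and its value in rank 2 *)

Section Coefficients.
Context {F : finFieldType} {R : realType} {X : valuedField F R}.
Context (hX : vcomplete X).
Local Notation q := #|F|.
Local Notation N := (@vabs F R X).
Local Notation G := (@gauss_norm F R X).
Local Notation T := (tate X).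
Local Notation th := (vtheta X).
Local Notation A := {poly F}.
Context {lam : X} (hlam : lam ^+ (q - 1) = - th).
Local Notation ppi := (pitilde lam).

Section Uniqueness.
Context {n : nat}.
Implicit Types (z : 'rV[X]_n.+2) (y : 'rV[X]_n.+1).
Local Notation u_ z := (upar lam z).

Lemma sums_shift (x : nat -> T) s :
  sums G x s <-> sums G (fun i => if (0 < i)%N then x i.-1 else 0) s.
Proof.
split => [xs|/(sums_sub succn_inj) h].
  by apply: (sums_inj gauss_un succn_inj (x := fun i => if (0 < i)%N then x i.-1 else 0) _ xs) => -[|i] // h; case: (h i).
by apply: sums_ext (h _) => //= -[|i] // /(_ i).
Qed.

Lemma sum_from1 (x : nat -> T) k :
  \sum_(i < k) (if (0 < i)%N then x i else 0) = \sum_(1 <= i < k) x i.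
Proof.
rewrite -(big_mkord xpredT (fun i => if (0 < i)%N then x i else 0)).
by rewrite [RHS](big_nat_widenl _ 0)//= [RHS]big_mkcond.
Qed.

Lemma u_expansion_near_infinity (f : 'rV[X]_n.+2 -> T) fs : u_expansion lam f 1 fs ->
  exists B : R, forall z, near_infinity z -> B * vnorm (ztilde z) < imag_last z ->
    sums G (fun i => u_ z ^+ i *: fs i.+1 (ztilde z)) ((u_ z)^-1 *: f z).
Proof.
move=> [_ [B hB]]; exists B => z hz Bz; have u0 := upar_neq0 hX hlam hz.
have : sums G (fun i => if (0 < i)%N then u_ z ^+ i *: fs i (ztilde z) else 0) (f z).
  apply: (ncvg_sums gauss_un).
  rewrite (funext (sum_from1 (fun i => u_ z ^+ i *: fs i (ztilde z)))).
  by apply: hB => //; case: hz.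
move=> /(sums_scale (u_ z)^-1) h; apply/sums_shift; apply: sums_ext h => -[|i] /=.
  by rewrite scaler0.
by rewrite scalerA exprS mulKf.
Qed.

Lemma has_uexp_u_expansion (f : 'rV[X]_n.+2 -> T) h :
  has_uexp lam (fun z => (u_ z)^-1 *: f z) h ->
  exists2 fs, u_expansion lam f 1 fs & forall y, Omega y -> fs 1%N y = h y.
Proof.
move=> [gs [h1 h2 h3]]; exists (fun i => gs i.-1) => //; split.
  by move=> i _; exact: bholomorphic_holomorphic.
exists 1 => z Oz; rewrite mul1r => hz; have {}hz : near_infinity z by split.
rewrite -(funext (sum_from1 (fun i => u_ z ^+ i *: gs i.-1 (ztilde z)))).
apply: (sums_ncvg gauss_un (x := fun i => if (0 < i)%N then u_ z ^+ i *: gs i.-1 (ztilde z) else 0)).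
have u0 := upar_neq0 hX hlam hz.
have := sums_scale (u_ z) (h2 z hz); rewrite scalerA mulfV// scale1r => /sums_shift h'.
by apply: sums_ext h' => -[|i] //=; rewrite scalerA -exprS.
Qed.

(** Over a fixed \tilde z, u tends to 0 as z_r moves away from the span. The terms at a reference
    point z0 being bounded by C, those of index i >= 1 at z are at most |u(z) / u(z0)| C. *)
Lemma uexp_coef0 y (d : nat -> T) B : Omega y ->
  (forall z, near_infinity z -> ztilde z = y -> B < imag_last z ->
    sums G (fun i => u_ z ^+ i *: d i) 0) -> d 0%N = 0.
Proof.
move=> Oy hd; have p0 := pitilde_neq0 hX hlam.
have large M : exists z, [/\ near_infinity z, ztilde z = y, B < imag_last z & M < imag_last z].
  have [t [Oz hz]] := exists_large hX (Num.max (vnorm y) (Num.max B M)) Oy.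
  exists (rcons_row t y); move: hz; rewrite !gt_max => /and3P[h1 h2 h3].
  by split => //; rewrite ?ztilde_rcons//; split => //; rewrite ztilde_rcons.
have [z0 [hz0 zy0 Bz0 _]] := large 0.
have u0 := upar_neq0 hX hlam hz0.
have [C C0 hC] := nullfam_bounded gauss_un (sums_null (hd z0 hz0 zy0 Bz0)).
have Nu0 : 0 < N (u_ z0) by rewrite vabs_gt0.
have Np : 0 < N ppi by rewrite vabs_gt0.
apply: (un_eq0_lt gauss_un) => e e0.
pose dl := Num.min (N (u_ z0)) (e * N (u_ z0) / C).
have dl0 : 0 < dl by rewrite lt_min Nu0 divr_gt0// mulr_gt0.
have [z [hz zy Bz Mz]] := large (N ppi * dl)^-1.
have [_ iz] := near_infinity_vnorm hz.
have Nu : N (u_ z) < dl.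
  rewrite /upar vabsM !vabsV -invfM invf_plt ?posrE ?mulr_gt0 ?vabs_gt0 ?lattice_exp_near_infinity_neq0//.
  rewrite mulrC -ltr_pdivrMr// -invfM; apply: lt_le_trans (vabs_lattice_exp_near_infinity hX hz).
  by rewrite mulrC.
move: Nu; rewrite lt_min => /andP[/ltW uu0 ue].
apply: le_lt_trans (_ : N (u_ z) / N (u_ z0) * C < e); last first.
  by rewrite mulrAC ltr_pdivrMr// -ltr_pdivlMr.
have M0 : 0 <= N (u_ z) / N (u_ z0) * C by rewrite !mulr_ge0 ?invr_ge0 ?vabs_ge0// ltW.
have h1 : sums G (fun i => if i == 0%N then - d 0%N else 0) (- d 0%N).
  have := @sums_fset _ _ _ gauss_un _ (fun i => if i == 0%N then - d 0%N else 0) [fset 0%N]%fset.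
  by rewrite big_seq_fset1; apply => i; rewrite inE => /negPf ->.
have := sumsD gauss_un (hd z hz zy Bz) h1; rewrite add0r => h2.
rewrite -[G _](unN gauss_un); apply: (sums_le gauss_un M0 h2) => -[|i] /=.
  by rewrite expr0 scale1r subrr (un0 gauss_un).
rewrite addr0 gaussZ vabsX; have := hC i.+1; rewrite gaussZ vabsX.
have r0 : 0 <= N (u_ z) / N (u_ z0) by rewrite divr_ge0 ?vabs_ge0.
have r1 : N (u_ z) / N (u_ z0) <= 1 by rewrite ler_pdivrMr// mul1r.
move=> h; rewrite -{1}[N (u_ z)](divfK (lt0r_neq0 Nu0)) exprMn -[leLHS]mulrA.
apply: ler_pM; rewrite ?mulr_ge0 ?exprn_ge0 ?vabs_ge0 ?gauss_ge0//.
by rewrite exprS ler_piMr// exprn_ile1.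
Qed.

Lemma u_expansion_coef1 (f : 'rV[X]_n.+2 -> T) h fs y :
  has_uexp lam (fun z => (u_ z)^-1 *: f z) h -> u_expansion lam f 1 fs -> Omega y ->
  fs 1%N y = h y.
Proof.
move=> [gs [_ h2 h3]] /u_expansion_near_infinity[B hB] Oy.
have := @uexp_coef0 y (fun i => fs i.+1 y - gs i y) (B * vnorm y) Oy.
move=> /(_ _)/eqP; rewrite subr_eq0 h3// => hz; apply/eqP/hz => z z_inf zy Bz.
have := h2 z z_inf; have := hB z z_inf; rewrite zy => /(_ Bz) a b.
have := sumsD gauss_un a (sums_scale (-1) b); rewrite scaleN1r subrr.
by apply: sums_ext => i; rewrite scaleN1r scalerBr.
Qed.

End Uniqueness.

(* Every nonzero a is uniquely c b with c a nonzero constant and b monic, and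
   the terms of index c b and b are equal. *)
Lemma tau_Eis_Lchi (y : 'rV[X]_1) : Omega y -> tau (Eis 1 y 0 0) = - Lchi X.
Proof.
move=> Oy; have y1 : y 0 0 = 1 by case: Oy => + _; rewrite [ord_max]ord1.
pose Z (a : A) : T := (Aemb X a ^+ q)^-1 *: chi a.
have Z0 : Z 0 = 0 by rewrite /Z !rmorph0 scaler0.
have hZ : sums G Z (tau (Eis 1 y 0 0)).
  have := sums_tau (Eis_sums hX Oy 0 (ltn0Sn 0)).
  move=> /(sums_sub (f := fun a : A => const_mx a : 'cV[A]_1)) h.
  have {}h := h _ _; apply: sums_ext (h _ _) => [a|a b /matrixP/(_ 0 0)|c hc].
  - rewrite /= tauZ tau_chi zdotE big_ord1 y1 mul1r !mxE expr1 exprVn //.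
  - by rewrite !mxE.
  - by case: (hc (c 0 0)); apply/matrixP => i j; rewrite !mxE !ord1.
suff h : sums G (fun a => if a \is monic then Z a else 0) (- tau (Eis 1 y 0 0)).
  by rewrite -[LHS]opprK; congr (- _); rewrite -(sums_nsum gauss_un h).
suff h : sums G (fun a => if a \is monic then - Z a else 0) (tau (Eis 1 y 0 0)).
  have := sums_scale (-1) h; rewrite scaleN1r; apply: sums_ext => a.
  by case: ifP => _; rewrite ?scaler0// scaleN1r opprK.
apply: (sums_regroup gauss_un (p := fun a : A => (lead_coef a)^-1 *: a) hZ) => b.
have mon (a : A) : a != 0 -> (lead_coef a)^-1 *: a \is monic.
  by move=> a0; rewrite monicE lead_coefZ mulVf// lead_coef_eq0.
case: ifP => bm; last first.
  apply: sums_ext (sums0 gauss_un) => a; case: eqP => // ab.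
  have [->|/mon] := eqVneq a 0; first by rewrite Z0.
  by rewrite ab bm.
have b0 : b != 0 by apply: monic_neq0.
have lb : lead_coef b = 1 by apply/eqP.
rewrite -sum_units big_mkcond /=.
apply: (sums_inj gauss_un (f := fun c : F => c *: b)) => [c c' cc|a ha|].
- by have := congr1 lead_coef cc; rewrite !lead_coefZ lb !mulr1.
- case: eqP => // ab; have [a0|a0] := eqVneq a 0; first by rewrite a0 Z0.
  by case: (ha (lead_coef a)); rewrite -ab scalerA mulfV ?scale1r// lead_coef_eq0.
- apply: sums_ext (sums_finType gauss_un _) => c /=; case: eqP => [->|/eqP c0] /=.
    by rewrite scale0r Z0 if_same.
  rewrite lead_coefZ lb mulr1 scalerA mulVf// scale1r eqxx /Z -mul_polyC !rmorphM /= chiC.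
  rewrite AembC exprMn -{2}(expn1 q) vemb_frob mulr_algl scalerA invfM mulrAC mulVf ?mul1r//.
  by rewrite fmorph_eq0.
Qed.

End Coefficients.

(** * Action of GL_r(A) *)

Section Modularity.
Context {F : finFieldType} {R : realType} {X : valuedField F R}.
Context (hX : vcomplete X).
Local Notation q := #|F|.
Local Notation G := (@gauss_norm F R X).
Local Notation T := (tate X).
Local Notation A := {poly F}.
Context {lam : X} (hlam : lam ^+ (q - 1) = - vtheta X).

(** Invertibility of g over A makes a = g b a permutation of the lattice indices, and the product of
    [gact g z] with g b is (z b) / [jfac g z]. *)
Lemma Eis_gact n (g : 'M[A]_n.+1) k z i : (0 < k)%N -> g \in unitmx -> Omega z ->
  Eis k (gact g z) i 0 = jfac g z ^+ k *: (map_mx (@chi F R X) g *m Eis k z) i 0.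
Proof.
move=> k0 gu Oz; rewrite [LHS]mxE; apply: (sums_nsum gauss_un).
have zg b : zdot (gact g z) (g *m b) = (jfac g z)^-1 * zdot z b.
  by rewrite /zdot -scalemxAl mxE -mulmxA -map_mxM mulKmx.
apply: (sums_inj gauss_un (f := mulmx g)) => [b c|a ha|].
- exact: (can_inj (mulKmx gu)).
- by case: (ha (invmx g *m a)); rewrite mulKVmx.
have h : sums G (fun b => (zdot z b ^+ k)^-1 *: chi ((g *m b) i 0))
    ((map_mx (@chi F R X) g *m Eis k z) i 0).
  rewrite mxE; under [X in sums _ _ X]eq_bigr do rewrite mxE.
  have h l : true -> sums G (fun b => chi (g i l) * ((zdot z b ^+ k)^-1 *: chi (b l 0)))
      (chi (g i l) * Eis k z l 0).
    by move=> _; apply: sums_mull; exact: (Eis_sums hX Oz l k0).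
  have := sums_sum gauss_un (index_enum 'I_n.+1) h.
  apply: sums_ext => b; rewrite mxE rmorph_sum scaler_sumr; apply: eq_bigr => l _.
  by rewrite rmorphM scalerAr.
apply: sums_ext (sums_scale (jfac g z ^+ k) h) => b /=.
rewrite -/(zdot (gact g z) (g *m b)) zg scalerA; case: eqP => [gb|_] /=.
  by rewrite gb chi_mx0 scaler0.
by rewrite exprMn exprVn invfM invrK.
Qed.

(** Units of A are constants, on which theta |-> t and the embedding agree; applied to \det g, this
    gives the type 1. *)
Lemma chi_unit (a : A) : a \is a GRing.unit -> chi a = (Aemb X a)%:A.
Proof.
rewrite poly_unitE => /andP[/size_poly1P[c _ ->] _].
by rewrite chiC AembC.
Qed.

(** Rows are transformed by chi(g) and column k is scaled by j^(q^k); the weights of the columns add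
    up in the determinant. *)
Lemma det_Xi_gact n (g : 'M[A]_n.+1) z : g \in unitmx -> Omega z ->
  \det (Xi (gact g z)) =
  (jfac g z ^+ (\sum_(i < n.+1) q ^ i) * Aemb X (\det g)) *: \det (Xi z).
Proof.
move=> gu Oz.
have -> : Xi (gact g z) = map_mx (@chi F R X) g *m Xi z *m
    diag_mx (\row_(k < n.+1) (jfac g z ^+ (q ^ k))%:A).
  apply/matrixP => i k; rewrite mul_mx_diag mxE (Eis_gact i (qX_gt0 k) gu Oz).
  rewrite [RHS]mxE [X in _ * X]mxE mulr_algr; congr (_ *: _).
  by rewrite !mxE; apply: eq_bigr => l _; rewrite [Xi _ _ _]mxE.
rewrite !det_mulmx det_diag det_map_mx /= chi_unit -?unitmxE//.
under [X in _ * X]eq_bigr do rewrite mxE.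
have -> : \prod_(k < n.+1) (jfac g z ^+ (q ^ k))%:A =
    (jfac g z ^+ (\sum_(i < n.+1) q ^ i))%:A :> T.
  elim/big_rec2: _ => [|k x y _ ->]; first by rewrite expr0 scale1r.
  by rewrite exprD algM.
by rewrite mulr_algr mulr_algl scalerA.
Qed.

(** The constant nu covers both det Xi itself and the form normalised by its value at a base
    point. *)
Lemma deformation_det_Xi n (nu : T) :
  deformation lam (\sum_(i < n.+2) q ^ i)%N%:Z 1 (fun z : 'rV[X]_n.+2 => nu * \det (Xi z)).
Proof.
split.
- apply: bholomorphic_holomorphic; apply: bholomorphicM; first exact: bholomorphic_cst.
  apply: bholomorphic_det => i k.
  apply: bholomorphic_ext (bholomorphic_Eis hX i (qX_gt0 k)) => z _.
  by rewrite [RHS]mxE.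
- move=> g gu z Oz; rewrite (det_Xi_gact gu Oz) expr1z -exprnP scalerAr//.
exists 1%N.
have hu : has_uexp lam (fun z : 'rV[X]_n.+2 => (upar lam z)^-1 *: (nu * \det (Xi z)))
    (fun y => nu * - (pitilde lam *: tau (\det (Xi_tau y)))).
  apply: has_uexp_ext (has_uexpM hX (has_uexp_cst (bholomorphic_cst nu))
    (has_uexp_det_Xi hX hlam)) => // z _.
  by rewrite scalerAr.
have [fs hfs _] := has_uexp_u_expansion hX hlam hu.
by exists fs.
Qed.

End Modularity.

(* The rank is r = n.+2. *)
Theorem theorem4p3 (F : finFieldType) (R : realType) (X : valuedField F R)
    (hX : is_Cinf X) (lam : X) (hlam : lam ^+ (#|F| - 1)%N = - vtheta X) (n : nat) :
  let detXi : 'rV[X]_n.+2 -> tate X := fun z => \det (Xi z) in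
  let k : nat := (\sum_(i < n.+2) #|F| ^ i)%N in
  [/\ deformation lam k%:Z 1 detXi,
      nowhere_vanishing detXi,
      single_cuspidal lam detXi,
      (exists mu : tate X, exists g : 'rV[X]_n.+2 -> tate X,
         [/\ is_unit mu, modular_form lam k%:Z 1 g
           & forall z, Omega z -> detXi z = mu * g z])
    & forall fs : nat -> 'rV[X]_n.+1 -> tate X, u_expansion lam detXi 1 fs ->
      forall z : 'rV[X]_n.+1, Omega z ->
        (n = 0%N -> fs 1%N z = pitilde lam *: Lchi X) /\
        ((0 < n)%N -> fs 1%N z = - (pitilde lam *: tau (\det (Xi_tau z))))].
Proof.
move=> detXi k; have {}hX : vcomplete X := hX.1.
have hD := has_uexp_det_Xi hX hlam (n := n).
split.
- have := deformation_det_Xi hX hlam n 1.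
  by congr deformation; apply: funext => z; rewrite mul1r.
- by move=> z Oz; apply: is_unit_neq0; exact: unit_det_Xi.
- have [fs hfs h1] := has_uexp_u_expansion hX hlam hD; exists fs => //.
  have [y Oy] := Omega_nonempty hX n; exists y => //.
  (* This coefficient is a nonzero scalar times tau of the determinant in rank n.+1, which is a unit
     by [unit_det_Xi] there. *)
  rewrite h1// oppr_eq0; apply/eqP => /(congr1 (fun x => (pitilde lam)^-1 *: x)).
  rewrite scaler0 scalerA mulVf ?(pitilde_neq0 hX hlam)// scale1r => /eqP.
  apply/negP/is_unit_neq0; apply: (is_unit_tau 1).
  by rewrite -(Xi_Xi_tau hX Oy); exact: unit_det_Xi.
- have [z0 Oz0] := Omega_nonempty hX n.+1.
  have [nu Dnu] := unit_det_Xi hX Oz0.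
  (* The unit is the value at a base point; after division by it all values are constants, by
     [det_Xi_ratio]. *)
  exists (\det (Xi z0)), (fun z => nu * \det (Xi z)); split.
  + exact: unit_det_Xi.
  + split; first exact: deformation_det_Xi.
    by move=> z Oz; apply: (det_Xi_ratio hX Oz Oz0); rewrite mulrC.
  + by move=> z _; rewrite mulrA Dnu mul1r.
- move=> fs hfs z Oz; have fsE := u_expansion_coef1 hX hlam hD hfs Oz; split => // n0.
  (* In rank 2 the lower determinant is the single entry E_1 of the point 1, and the sign of its
     twist - L(chi_t, q) cancels the one in front. *)
  rewrite fsE; move: z Oz {fsE fs hfs hD detXi k}; rewrite n0 => z Oz.
  by rewrite det_mx11 mxE /= (tau_Eis_Lchi hX Oz) scalerN opprK.
Qed.
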